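(* Let $(Z_n)$ be a BPREI as in the context such that $\mathbf E\log M_0=0$ and $0<\mathrm{Var}(\log M_0)<\infty$; $\eta_n\ge1$ a.s. for every $n\ge1$; and $\mathbf E[\eta_{n+1}\mid\mathcal E_n]\le\overline\eta$ a.s. for every $n\ge0$, for some constant $\overline\eta<\infty$. Then there is a probability law $\nu^-$ on $\{1,2,\dots\}$, independent of the fixed initial state $i$, such that for every fixed $i$ $$\|\nu_{i,n}^--\nu^-\|_{\mathrm{TV}}\longrightarrow0\qquad(n\to\infty),$$ where $\nu_{i,n}^-:=\mathbf P_i(Z_n\in\cdot\mid\tau_n=n)$. Moreover, $$\sup_{n\ge1}\mathbf E_i[Z_n\mid\tau_n=n]<\infty .$$
   Context: $\mathbf P_i,\mathbf E_i$ refer to $Z_0=i$. BPREI (branching process in an i.i.d. random environment with immigration). $\mathcal E_n=(Q_n,G_n)$, $n\ge0$, are i.i.d. marks, where $Q_n$ (reproduction law) and $G_n$ (immigration law) are random probability measures on $\{0,1,2,\dots\}$, possibly dependent on each other. Conditional on the environment, $Z_{n+1}=\sum_{i=1}^{Z_n}\xi_{n,i}+\eta_{n+1}$, where all the variables $\xi_{n,i},\eta_{n+1}$ are independent, $\xi_{n,i}\sim Q_n$, $\eta_{n+1}\sim G_n$. $M_n$ is the mean of $Q_n$, in $(0,\infty)$ a.s. Environmental walk: $S_0:=0$, $S_n:=\sum_{j=0}^{n-1}\log M_j$; $\tau_n:=\min\{0\le j\le n:S_j=\min_{0\le l\le n}S_l\}$ is the first time the minimum over $\{0,\dots,n\}$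 is attained. *)

(* Defs.v *)
From HB Require Import structures.
From mathcomp Require Export all_boot all_order all_algebra.
From mathcomp Require Export all_classical all_reals all_analysis.
From mathcomp Require Export measurable_realfun.

Set Implicit Arguments.
Unset Strict Implicit.
Unset Printing Implicit Defensive.

Import Order.TTheory GRing.Theory Num.Theory.
Import numFieldNormedType.Exports.

Local Open Scope classical_set_scope.
Local Open Scope ring_scope.

Section Conditioning.
Context {d : measure_display} {Omega : measurableType d} {R : realType}.
Variable P : probability Omega R.
Local Open Scope ereal_scope.

(* Y is a version of E[X | F]. Here X is nonnegative (hence quasi-integrable)
   and F is a sub-sigma-algebra of the measurable sets of Omega. *)
Definition is_cond_exp (F : set (set Omega)) (X Y : Omega -> \bar R) : Prop :=
  (forall B : set (\bar R), measurable B -> F (Y @^-1` B)) /\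
  (forall A, F A -> \int[P]_(w in A) Y w = \int[P]_(w in A) X w).

Definition is_cond_prob (F : set (set Omega)) (A : set Omega)
    (Y : Omega -> \bar R) : Prop :=
  is_cond_exp F (fun w => (\1_A w)%:E) Y.

(* Elementary conditioning on an event B; meaningful when P B > 0. *)
Definition cond_law (X : Omega -> nat) (B : set Omega) (A : set nat) : \bar R :=
  P (X @^-1` A `&` B) / P B.

Definition cond_mean (X : Omega -> nat) (B : set Omega) : \bar R :=
  (\int[P]_(w in B) ((X w)%:R)%:E) / P B.

Definition mutually_independent {d'} {T : measurableType d'}
    (X : nat -> Omega -> T) : Prop :=
  forall (s : seq nat) (B : nat -> set T), uniq s ->
    (forall n, measurable (B n)) ->
    P (\bigcap_(n in [set` s]) (X n @^-1` B n)) =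
    \prod_(n <- s) P (X n @^-1` B n).

Definition identically_distributed {d'} {T : measurableType d'}
    (X : nat -> Omega -> T) : Prop :=
  forall (n : nat) (B : set T), measurable B ->
    P (X n @^-1` B) = P (X 0%N @^-1` B).

End Conditioning.

Definition tv_dist {R : realType} (mu nu : set nat -> \bar R) : \bar R :=
  ereal_sup [set `|mu A - nu A|%E | A in [set: set nat]].

(* A mark (Q, G): reproduction law and immigration law. Probability measures
   on nat carry the sigma-algebra generated by the evaluations mu |-> mu U. *)
Notation mark R := (pprobability nat R * pprobability nat R)%type.

Section BPREI.
Context {d : measure_display} {Omega : measurableType d} {R : realType}.
Variable P : probability Omega R.
Variable env : nat -> {RV P >-> mark R}.
Variable xi : nat -> nat -> {RV P >-> nat}.
Variable eta : nat -> {RV P >-> nat}.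

Definition repro (n : nat) (w : Omega) : probability nat R := (env n w).1.
Definition immig (n : nat) (w : Omega) : probability nat R := (env n w).2.

Definition sigma_mark (n : nat) : set (set Omega) :=
  preimage_set_system setT (env n) (measurable : set (set (mark R))).

Definition sigma_env : set (set Omega) := <<s \bigcup_n sigma_mark n >>.

Definition repro_mean (n : nat) (w : Omega) : \bar R :=
  (\int[repro n w]_k (k%:R)%:E)%E.

Definition log_mean (n : nat) (w : Omega) : R := ln (fine (repro_mean n w)).

(* The j-th individual (0-based) of generation n has xi n j w children, and
   eta n.+1 w immigrants arrive in generation n.+1; eta 0 is never used. All
   initial states i are realised on the same probability space: under P, the
   process Zproc i has the law of (Z_n) under P_i. *)
Fixpoint Zproc (i n : nat) (w : Omega) : nat :=
  if n is m.+1 then (\sum_(j < Zproc i m w) xi m j w + eta m.+1 w)%N else i.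

(* Conditional on the environment, the xi n j and eta n.+1 are independent with
   xi n j ~ repro n and eta n.+1 ~ immig n. Arbitrary finite subfamilies are
   covered by taking some of the sets C m j, D m equal to setT. *)
Definition cond_indep_given_env : Prop :=
  forall (N K : nat) (C : nat -> nat -> set nat) (D : nat -> set nat),
    is_cond_prob P sigma_env
      (\bigcap_(m < N)
         ((\bigcap_(j < K) (xi m j @^-1` C m j)) `&` eta m.+1 @^-1` D m))
      (fun w => \prod_(m < N)
         ((\prod_(j < K) repro m w (C m j)) * immig m w (D m)))%E.

Record is_BPREI : Prop := IsBPREI {
  env_indep : mutually_independent P (fun n => env n : Omega -> mark R) ;
  env_ident : identically_distributed P (fun n => env n : Omega -> mark R) ;
  offspring_immigration : cond_indep_given_env ;
  repro_mean_pos_finite :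
    forall n, {ae P, forall w, (0 < repro_mean n w < +oo)%E} }.

Definition walk (n : nat) (w : Omega) : R := \sum_(j < n) log_mean j w.

Definition walk_min (n : nat) (w : Omega) : R :=
  \big[Num.min/walk 0 w]_(l < n.+1) walk l w.

(* index returns the first position, hence the first time of the minimum. *)
Definition tau (n : nat) (w : Omega) : nat :=
  index (walk_min n w) [seq walk j w | j <- iota 0 n.+1].

Definition min_at_end (n : nat) : set Omega := [set w | tau n w = n].

Definition nu_minus_n (i n : nat) : set nat -> \bar R :=
  cond_law P (Zproc i n) (min_at_end n).

End BPREI.

(* Main.v *)
(* In reversed time the event {tau_n = n} says that the walk with steps
   -log M stays positive up to time n, and the conditional law of Z_n given the
   environment is obtained by feeding a function f through the n marks, newest
   first. One mark multiplies the Lipschitz constant of f by its mean M, so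
   ignoring all marks but the newest m costs at most
   (etabar + i) * sum_(k >= m) exp(- S_k), where S is the reversed walk. Given
   survival, this sum has expectation O(m^(-1/4)), uniformly in n: for f = 1_A
   this makes the law of Z_n asymptotically independent of i and of the old
   marks, and for f = id it bounds the mean. The newest m marks given survival
   up to n converge in law as n -> oo, so the conditional laws of Z_n are
   uniformly Cauchy. The random walk estimates use second moments only, through
   the duality of strict minima, Cauchy-Schwarz and the L1 growth of symmetrized
   sums; they give survival probabilities of exact order n^(-1/2). *)

From HB Require Import structures.
Require Import Defs.
From mathcomp Require Import ring lra zify.

Set Implicit Arguments.
Unset Strict Implicit.
Unset Printing Implicit Defensive.

Import Order.TTheory GRing.Theory Num.Theory.
Import numFieldNormedType.Exports.

Local Open Scope classical_set_scope.
Local Open Scope ring_scope.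

(** * Independent sequences *)

Local Open Scope ereal_scope.

(** The steps of the walk may or may not be lattice and have two moments, so no local limit theorem
    is invoked and orders of magnitude have to suffice. With p_n the survival probability and A_n
    its partial sums, optional stopping and Cauchy-Schwarz give p_(n+1) A_n >= c, hence A_n >= c
    sqrt n by iteration; disjointness of strict minima then turns this lower bound for the reflected
    walk into an upper bound for p_n. The exponent 1/4 is the price of a crude concentration bound:
    squaring P(S_n in I) compares two independent copies, whose difference visits a bounded interval
    O(sqrt n) times in mean up to time n. Cutting a path into thirds then gives n^(-1/2) n^(-1/4)
    n^(-1/2) = n^(-5/4) for staying nonnegative and ending in a unit interval. This is summable with
    tail m^(-1/4), and convolution with p_n preserves that tail. Independence is handled on the
    space of sequences: gluing two independent copies plays the part of the Markov property, and
    time reversal is a permutation of coordinates. *)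

Section SequenceSpace.
Context {d : measure_display} {T : measurableType d}.

Definition cylinder : set (set (nat -> T)) :=
  [set A | exists K : nat, exists2 B : nat -> set T,
     (forall n, measurable (B n)) &
     A = \bigcap_(k in [set` iota 0 K]) [set x : nat -> T | B k (x k)]].

(** The product sigma-algebra, presented by a pi-system on which laws can be compared. *)
Definition seqspace : measurableType cylinder.-sigma := g_sigma_algebraType cylinder.

Lemma cylinder_setI : setI_closed cylinder.
Proof.
move=> _ _ [K [B mB ->]] [K' [B' mB' ->]].
(* Padding with [setT] beyond its own range puts each rectangle on the common range [maxn K K']. *)
pose C (K : nat) (B : nat -> set T) n := if (n < K)%N then B n else setT.
exists (maxn K K'); exists (fun n => C K B n `&` C K' B' n).
  by move=> n; apply: measurableI; rewrite /C; case: ifP.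
apply/seteqP; split => [x [h h'] k /= _|x h]; last split => k /=.
- split; rewrite /C; case: ifPn => // kK.
    by apply: h; rewrite /= mem_iota.
  by apply: h'; rewrite /= mem_iota.
- rewrite mem_iota /= add0n => kK.
  have [] := h k; first by rewrite /= mem_iota /= add0n leq_max kK.
  by rewrite /C kK.
- rewrite mem_iota /= add0n => kK.
  have [|_] := h k; first by rewrite /= mem_iota /= add0n leq_max kK orbT.
  by rewrite /C kK.
Qed.

Lemma cylinder_setT : cylinder setT.
Proof.
exists 0%N; exists (fun _ => setT) => //.
by apply/seteqP; split => // x _ k /=.
Qed.

Lemma measurable_coord n : measurable_fun setT (fun x : seqspace => x n).
Proof.
move=> _ B mB; rewrite setTI; apply: sub_sigma_algebra.
exists n.+1; exists (fun k => if k == n then B else setT).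
  by move=> k; case: ifP.
apply/seteqP; split => [x /= xB k _ /=|x h].
  by case: eqP => // ->.
have nn : n \in iota 0 n.+1 by rewrite mem_iota ltnSn.
by have := h n nn; rewrite /= eqxx.
Qed.

Lemma measurable_to_seqspace d' (U : measurableType d') (f : U -> seqspace) :
  (forall n, measurable_fun setT (fun u => f u n)) -> measurable_fun setT f.
Proof.
move=> mf; apply: (@measurability _ _ U seqspace setT f cylinder) => //.
move=> _ [_ [K [B mB ->]] <-]; rewrite setTI.
rewrite (_ : _ @^-1` _ =
  \bigcap_(k in [set` iota 0 K]) ((fun u => f u k) @^-1` B k)); last first.
  by apply/seteqP; split => u /= h k /= kK; exact: h.
apply: fin_bigcap_measurable; first exact: finite_seq.
by move=> k _; rewrite -[X in measurable X]setTI; exact: mf.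
Qed.

Definition reindex (s : nat -> nat) (x : seqspace) : seqspace := fun n => x (s n).

(** Past from one sequence, future from the start of another. That a function depends on the first m
    coordinates alone is expressed throughout as invariance: its value at [splice m (x, y)] is its
    value at x. *)
Definition splice (m : nat) (xy : seqspace * seqspace) : seqspace :=
  fun n => if (n < m)%N then xy.1 n else xy.2 (n - m)%N.

Definition shift (m : nat) : seqspace -> seqspace := reindex (addn m).

Lemma measurable_reindex s : measurable_fun setT (reindex s).
Proof. by apply: measurable_to_seqspace => n; exact: measurable_coord. Qed.

Lemma measurable_splice m : measurable_fun setT (splice m).
Proof.
apply: measurable_to_seqspace => n; rewrite /splice; case: (n < m)%N.
  exact: (measurableT_comp (measurable_coord n) measurable_fst).
exact: (measurableT_comp (measurable_coord (n - m)) measurable_snd).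
Qed.

Lemma shift_splice m x y : shift m (splice m (x, y)) = y.
Proof.
by apply/funext => n; rewrite /shift /reindex /splice /= ltnNge leq_addr /= addKn.
Qed.

Context {R : realType}.
Variable mu : probability seqspace R.

(** Comparing every factor with coordinate 0 encodes independence and equality of the marginals in
    one identity. *)
Definition iid_law : Prop := forall (s : seq nat) (B : nat -> set T), uniq s ->
  (forall n, measurable (B n)) ->
  mu (\bigcap_(n in [set` s]) [set x | B n (x n)]) =
  \prod_(n <- s) mu [set x | B n (x 0%N)].

Hypothesis iid : iid_law.

(** Pi-lambda argument: the product formula on [cylinder] determines the law. *)
Lemma law_unique (nu : {measure set seqspace -> \bar R}) :
  nu setT = 1 -> 
  (forall K (B : nat -> set T), (forall n, measurable (B n)) ->
    nu (\bigcap_(k in [set` iota 0 K]) [set x | B k (x k)]) =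
    \prod_(k <- iota 0 K) mu [set x | B k (x 0%N)]) ->
  forall A, measurable A -> nu A = mu A.
Proof.
move=> nuT nuE A mA.
apply: (@g_sigma_algebra_measure_unique _ _ seqspace cylinder _ (fun=> setT) _ _ nu mu) => //.
- by move=> B BC; exact: sub_sigma_algebra.
- by move=> _; exact: cylinder_setT.
- by apply/seteqP; split => // x _; exists 0%N.
- exact: cylinder_setI.
- move=> _ [K [B mB ->]]; rewrite nuE//; apply/esym/iid; rewrite ?iota_uniq//.
- by move=> _; rewrite nuT ltry.
Qed.

Lemma law_reindex (s : nat -> nat) : injective s ->
  forall A, measurable A -> mu (reindex s @^-1` A) = mu A.
Proof.
move=> s_inj A mA.
pose f : {mfun seqspace >-> seqspace} := mfun_Sub (mem_set (measurable_reindex s)).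
rewrite -[LHS]/(pushforward mu f A).
apply: law_unique => //; first exact: (@probability_setT _ _ _ mu).
move=> K B mB; rewrite /pushforward /=.
(* Since [s] is injective, [index] inverts it on 0, ..., K-1, and the constraint on coordinate k
   moves to coordinate s k. *)
pose B' j := B (index j (map s (iota 0 K))).
transitivity (mu (\bigcap_(n in [set` map s (iota 0 K)]) [set x : seqspace | B' n (x n)])).
  congr (mu _); apply/seteqP; split => [x h j /= /mapP[k kK ->]|x h k kK /=].
    by rewrite /B' index_map//; have := h _ kK; rewrite /= mem_iota in kK *;
     rewrite -[in index _ _](add0n k) -{1}(nth_iota 0 0 kK) index_uniq// ?size_iota// iota_uniq.
  have := h (s k) (map_f s kK); rewrite /B' /= index_map//.
  rewrite /= mem_iota in kK.
  by rewrite -{1}[k in index k _](add0n k) -{1}(nth_iota 0 0 kK) index_uniq// ?size_iota// iota_uniq.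
rewrite iid; [|by rewrite map_inj_uniq// iota_uniq|by move=> n; exact: mB].
rewrite big_map big_seq [RHS]big_seq; apply: eq_bigr => k; rewrite mem_iota => kK.
rewrite /B' index_map//.
by rewrite -{1}[k in index k _](add0n k) -{1}(nth_iota 0 0 kK) index_uniq// ?size_iota// iota_uniq.
Qed.

(** A cylinder over the first K coordinates pulls back to a rectangle, with min(m, K) constraints on
    the first copy and K - m (truncated) on the second, and the product formula applies to each
    side. *)
Lemma law_splice m : 
  forall A, measurable A -> (mu \x mu) (splice m @^-1` A) = mu A.
Proof.
move=> A mA.
pose f : {mfun (seqspace * seqspace)%type >-> seqspace} := mfun_Sub (mem_set (measurable_splice m)).
rewrite -[LHS]/(pushforward (mu \x mu) f A).
apply: law_unique => //.
  rewrite [LHS](_ : _ = (mu \x mu) (setT `*` setT)); last by rewrite setXTT.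
  transitivity (mu setT * mu setT); first exact: product_measure1E.
  by rewrite probability_setT mule1.
move=> K B mB; rewrite /pushforward /=.
transitivity ((mu \x mu) ((\bigcap_(n in [set` iota 0 (minn m K)]) [set x : seqspace | B n (x n)])
  `*` (\bigcap_(n in [set` iota 0 (K - m)]) [set x : seqspace | B (m + n)%N (x n)]))).
  congr ((mu \x mu) _); apply/seteqP; split => [[x y] h|[x y] [h h'] k]; first split => k /=.
  - rewrite mem_iota /= add0n leq_min => /andP[km kK].
    by have := h k; rewrite /= mem_iota /= add0n => /(_ kK); rewrite /splice km.
  - rewrite mem_iota /= add0n ltn_subRL => kK.
    by have := h (m + k)%N; rewrite /= mem_iota /= add0n => /(_ kK);
      rewrite /splice /= ltnNge leq_addr /= addKn.
  - rewrite /= mem_iota /= add0n => kK; rewrite /splice /=; case: ltnP => km.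
      by apply: h; rewrite /= mem_iota /= add0n leq_min km.
    by have := h' (k - m)%N; rewrite /= mem_iota /= add0n ltn_sub2rE// subnKC//; exact.
rewrite product_measure1E//; first last.
- by apply: fin_bigcap_measurable; [exact: finite_seq|move=> k _;
    rewrite -[X in measurable X]setTI; exact: measurable_coord].
- by apply: fin_bigcap_measurable; [exact: finite_seq|move=> k _;
    rewrite -[X in measurable X]setTI; exact: measurable_coord].
transitivity ((\prod_(n <- iota 0 (minn m K)) mu [set x : seqspace | B n (x 0%N)]) *
    \prod_(n <- iota 0 (K - m)) mu [set x : seqspace | B (m + n)%N (x 0%N)]).
  congr (_ * _); first by apply: iid => //; rewrite iota_uniq.
  by apply: (iid (B := fun n => B (m + n)%N)) => //; rewrite iota_uniq.
have -> : iota 0 K = iota 0 (minn m K) ++ map (addn m) (iota 0 (K - m)).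
  rewrite -iotaDl addn0; case: (leqP m K) => mK; first by rewrite -[in LHS](subnKC mK) iotaD.
  have -> : (K - m = 0)%N by apply/eqP; rewrite subn_eq0 ltnW.
  by rewrite cats0.
by rewrite big_cat big_map.
Qed.

Lemma integral_reindex s (F : seqspace -> \bar R) : injective s ->
  measurable_fun setT F -> (forall x, 0 <= F x) ->
  \int[mu]_x F (reindex s x) = \int[mu]_x F x.
Proof.
move=> s_inj mF F0.
pose f : {mfun seqspace >-> seqspace} := mfun_Sub (mem_set (measurable_reindex s)).
transitivity (\int[pushforward mu f]_x F x).
  by rewrite ge0_integral_pushforward//; exact: measurable_reindex.
apply: eq_measure_integral => A mA _; exact: law_reindex.
Qed.

Lemma integral_splice m (F : seqspace -> \bar R) :
  measurable_fun setT F -> (forall x, 0 <= F x) ->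
  \int[mu]_x F x = \int[mu]_x \int[mu]_y F (splice m (x, y)).
Proof.
move=> mF F0.
pose f : {mfun (seqspace * seqspace)%type >-> seqspace} := mfun_Sub (mem_set (measurable_splice m)).
have -> : \int[mu]_x F x = \int[mu \x mu]_z F (splice m z).
  transitivity (\int[pushforward (mu \x mu) f]_x F x).
    by apply: eq_measure_integral => A mA _; apply/esym; exact: law_splice.
  by rewrite ge0_integral_pushforward//; exact: measurable_splice.
rewrite fubini_tonelli1//.
by apply: measurableT_comp => //; exact: measurable_splice.
Qed.

Lemma measurable_integral_splice m (F : seqspace -> \bar R) :
  measurable_fun setT F -> (forall x, 0 <= F x) ->
  measurable_fun setT (fun x => \int[mu]_y F (splice m (x, y))).
Proof.
move=> mF F0.
apply: (@measurable_fun_fubini_tonelli_F _ _ _ _ _ mu (F \o splice m)) => //.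
  exact: measurableT_comp mF (measurable_splice m).
by move=> z; exact: F0.
Qed.

(** Independence of the past before m and of the future, for signed functions: Tonelli on the
    absolute value gives integrability on the product, which then allows Fubini. *)
Lemma integral_prod_shift m (f g : seqspace -> R) :
  (forall x y, f (splice m (x, y)) = f x) ->
  mu.-integrable setT (EFin \o f) -> mu.-integrable setT (EFin \o g) ->
  mu.-integrable setT (fun x => (f x * g (shift m x))%:E) /\
  \int[mu]_x (f x * g (shift m x))%:E =
  \int[mu]_x (f x)%:E * \int[mu]_x (g x)%:E.
Proof.
move=> fm fi gi.
have mf : measurable_fun setT f by apply/measurable_EFinP; exact: measurable_int fi.
have mg : measurable_fun setT g by apply/measurable_EFinP; exact: measurable_int gi.
pose F x := (f x * g (shift m x))%R.
have mF : measurable_fun setT F.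
  apply: measurable_funM => //; apply: measurableT_comp => //.
  exact: measurable_reindex.
have FE x y : F (splice m (x, y)) = (f x * g y)%R by rewrite /F fm shift_splice.
pose h : {mfun (seqspace * seqspace)%type >-> seqspace} := mfun_Sub (mem_set (measurable_splice m)).
have Fi : mu.-integrable setT (EFin \o F).
  apply/integrableP; split; first exact/measurable_EFinP.
  rewrite (integral_splice m)//; last first.
    by apply: measurableT_comp => //; exact/measurable_EFinP.
  under eq_integral do under eq_integral do rewrite /= FE normrM EFinM.
  under eq_integral => x _.
    rewrite ge0_integralZl//; last first.
      by apply/measurable_EFinP; exact: measurableT_comp.
    over.
  rewrite ge0_integralZr//; last 2 first.
  - by apply/measurable_EFinP; exact: measurableT_comp.
  - by apply: integral_ge0 => x _; rewrite lee_fin.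
  apply: lte_mul_pinfty; first exact: integral_ge0.
    exact: (integrable_fin_num measurableT (integrable_abse fi)).
  exact: (integrable_lty measurableT (integrable_abse gi)).
have hFi : (mu \x mu).-integrable setT (fun z => (F (splice m z))%:E).
  apply/(integrable12ltyP mu mu).
    apply: measurableT_comp => //; apply: measurableT_comp => //.
    exact: measurable_splice.
  have /integrableP[_] := Fi; rewrite (integral_splice m)//.
  by apply: measurableT_comp => //; exact/measurable_EFinP.
split => //.
transitivity (\int[pushforward (mu \x mu) h]_x (F x)%:E).
  by apply: eq_measure_integral => A mA _; apply/esym; exact: law_splice.
rewrite integral_pushforward//; last exact/measurable_EFinP.
rewrite preimage_setT -(integral12_prod_meas1 hFi) /fubini_F.
under eq_integral => x _.
  under eq_integral do rewrite /= FE EFinM.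
  rewrite integralZl//.
  over.
rewrite -[in RHS](fineK (integrable_fin_num measurableT gi)) -integralZr//.
by apply: eq_integral => x _; rewrite fineK//; exact: integrable_fin_num.
Qed.

End SequenceSpace.

Local Close Scope ereal_scope.

(** * Measurable path events and real-valued probabilities *)

Lemma measurable_setb {d} {T : measurableType d} (b : T -> bool) :
  measurable_fun setT b -> measurable [set x | b x].
Proof.
move=> mb; have := mb measurableT [set true] I; rewrite setTI.
by congr measurable; apply/seteqP; split => x /=.
Qed.

Lemma measurable_ltset {d} {T : measurableType d} {R : realType} (f g : T -> R) :
  measurable_fun setT f -> measurable_fun setT g -> measurable [set x | f x < g x].
Proof. by move=> mf mg; apply: measurable_setb; exact: measurable_fun_ltr. Qed.

Lemma measurable_leset {d} {T : measurableType d} {R : realType} (f g : T -> R) :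
  measurable_fun setT f -> measurable_fun setT g -> measurable [set x | f x <= g x].
Proof. by move=> mf mg; apply: measurable_setb; exact: measurable_fun_ler. Qed.

Lemma measurable_forall_nat {d} {T : measurableType d} (D : nat -> Prop)
    (A : nat -> set T) : (forall k, D k -> measurable (A k)) ->
  measurable [set x | forall k, D k -> A k x].
Proof.
move=> mA; have -> : [set x | forall k, D k -> A k x] = \bigcap_(k in D) A k.
  by apply/seteqP; split => x /=.
exact: bigcap_measurableType.
Qed.

Lemma measurable_EFin_indic {d} {T : measurableType d} {R : realType} (A : set T) :
  measurable A -> measurable_fun setT (fun x => (\1_A x)%:E : \bar R).
Proof. by move=> mA; apply/measurable_EFinP; exact: measurable_indic. Qed.

Section Pr.
Context {d} {T : measurableType d} {R : realType} (mu : probability T R).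

Definition pr (A : set T) : R := fine (mu A).

Lemma prE A : measurable A -> mu A = (pr A)%:E.
Proof. by move=> mA; rewrite /pr fineK// fin_num_measure. Qed.

Lemma integral_indicT A : measurable A -> (\int[mu]_x (\1_A x)%:E = mu A)%E.
Proof. by move=> mA; rewrite integral_indic// setIT. Qed.

Lemma pr_ge0 A : 0 <= pr A.
Proof. by rewrite fine_ge0. Qed.

Lemma pr_le1 A : measurable A -> pr A <= 1.
Proof. by move=> mA; rewrite -lee_fin -prE// probability_le1. Qed.

Lemma prT : pr setT = 1.
Proof. by rewrite /pr probability_setT. Qed.

Lemma le_pr A B : measurable A -> measurable B -> A `<=` B -> pr A <= pr B.
Proof.
by move=> mA mB AB; rewrite -lee_fin -!prE//; apply: le_measure; rewrite ?inE.
Qed.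

Lemma prU A B : measurable A -> measurable B -> (forall x, A x -> B x -> False) ->
  pr (A `|` B) = pr A + pr B.
Proof.
move=> mA mB AB; apply: EFin_inj; rewrite EFinD -!prE//; last exact: measurableU.
by rewrite measureU//; apply/seteqP; split => // x [/AB].
Qed.

Lemma prU_le A B : measurable A -> measurable B -> pr (A `|` B) <= pr A + pr B.
Proof.
move=> mA mB; rewrite -lee_fin EFinD -!prE//; last exact: measurableU.
exact: measureU2.
Qed.

Lemma pr_sub_le A B C : measurable A -> measurable B -> measurable C ->
  A `<=` B `|` C -> pr A <= pr B + pr C.
Proof.
by move=> mA mB mC ABC; apply: le_trans (prU_le mB mC); apply: le_pr => //;
  exact: measurableU.
Qed.

Lemma pr_sum n (A : nat -> set T) : (forall k, measurable (A k)) ->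
  (forall i j x, (i < n)%N -> (j < n)%N -> A i x -> A j x -> i = j) ->
  pr [set x | exists2 k, (k < n)%N & A k x] = \sum_(k < n) pr (A k).
Proof.
move=> mA; elim: n => [|n IH] AI.
  rewrite big_ord0 (_ : [set x | _] = set0) ?/pr ?measure0//.
  by apply/seteqP; split => // x [].
rewrite big_ord_recr /= -IH; last first.
  by move=> i j x ni nj; apply: AI; rewrite ltnW.
rewrite -prU//.
- congr pr; apply/seteqP; split => [x [k]|x [[k kn Ak]|An]].
  + by rewrite ltnS leq_eqVlt => /orP[/eqP -> An|kn Ak]; [right|left; exists k].
  + by exists k => //; rewrite ltnW.
  + by exists n.
- rewrite (_ : [set x | _] = \bigcup_(k in `I_n) A k).
    by apply: bigcup_measurable => k _.
  by apply/seteqP; split => x [k]; exists k.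
- move=> x [k kn Ak] An; have := AI k n x _ _ Ak An.
  by rewrite ltnS ltnW// ltnS => /(_ isT (leqnn _)) kE; rewrite kE ltnn in kn.
Qed.

End Pr.

Section SplicePr.
Context {d} {T : measurableType d} {R : realType}.
Variable mu : probability (seqspace (T := T)) R.
Hypothesis iid : iid_law mu.
Local Notation X := (@seqspace d T).

Lemma measurable_splice_section m (A : set X) x : measurable A ->
  measurable [set y | A (splice m (x, y))].
Proof.
move=> mA.
have := measurable_xsection x (measurable_splice m measurableT mA).
rewrite setTI /xsection; congr measurable.
by apply/seteqP; split => y /=; rewrite inE.
Qed.

Lemma measure_splice m (A : set X) : measurable A ->
  mu A = (\int[mu]_x mu [set y | A (splice m (x, y))])%E.
Proof.
move=> mA; rewrite -integral_indicT//.
rewrite (integral_splice iid m)//; last first.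
  exact: measurable_EFin_indic.
apply: eq_integral => x _.
rewrite -integral_indicT//.
exact: measurable_splice_section.
Qed.

Lemma measurable_measure_splice m (A : set X) : measurable A ->
  measurable_fun setT (fun x => mu [set y | A (splice m (x, y))]).
Proof.
move=> mA.
have := measurable_fun_xsection mu (measurable_splice m measurableT mA).
apply: eq_measurable_fun => x _ /=; congr (mu _).
by rewrite setTI /xsection; apply/seteqP; split => y /=; rewrite inE.
Qed.

(** Once the first m coordinates are frozen, the rest is a fresh copy. [B] is what the event
    requires of the past; outside it the section is empty. This bound, the converse one and the
    product formula below stand in for the Markov property. *)
Lemma pr_splice_le m (A B : set X) (c : R) : measurable A -> measurable B ->
  (forall x y, A (splice m (x, y)) -> B x) ->
  (forall x, B x -> pr mu [set y | A (splice m (x, y))] <= c) -> 0 <= c ->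
  pr mu A <= c * pr mu B.
Proof.
move=> mA mB AB Ac c0; rewrite -lee_fin EFinM -!prE// (measure_splice m mA).
rewrite -(integral_indicT mu mB) -ge0_integralZl//; last exact: measurable_EFin_indic.
apply: ge0_le_integral => //.
- exact: measurable_measure_splice.
- by apply: emeasurable_funM => //; exact: measurable_EFin_indic.
move=> x _; rewrite indicE; have [xB|xB] := boolP (x \in B).
  rewrite mule1 prE; last exact: measurable_splice_section.
  by rewrite lee_fin Ac// -in_setE.
rewrite (_ : [set _ | _] = set0) ?measure0 ?mule0//.
by apply/seteqP; split => // y /= /AB; rewrite -in_setE (negPf xB).
Qed.

Lemma pr_splice_ge m (A B : set X) (c : R) : measurable A -> measurable B ->
  (forall x, B x -> c <= pr mu [set y | A (splice m (x, y))]) -> 0 <= c ->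
  c * pr mu B <= pr mu A.
Proof.
move=> mA mB Ac c0; rewrite -lee_fin EFinM -!prE// (measure_splice m mA).
rewrite -(integral_indicT mu mB) -ge0_integralZl//; last exact: measurable_EFin_indic.
apply: ge0_le_integral => //.
- by move=> x _; rewrite mule_ge0 ?lee_fin.
- by apply: emeasurable_funM => //; exact: measurable_EFin_indic.
- exact: measurable_measure_splice.
move=> x _; rewrite indicE; have [xB|xB] := boolP (x \in B).
  rewrite mule1 prE; last exact: measurable_splice_section.
  by rewrite lee_fin Ac// -in_setE.
by rewrite mule0.
Qed.

Lemma pr_splice_eq m (A B C : set X) : measurable A -> measurable B -> measurable C ->
  (forall x y, A (splice m (x, y)) <-> B x /\ C y) ->
  pr mu A = pr mu B * pr mu C.
Proof.
move=> mA mB mC ABC.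
have E x : B x -> [set y | A (splice m (x, y))] = C.
  by move=> Bx; apply/seteqP; split => y /= => [/ABC[]|Cy]//; apply/ABC.
apply/eqP; rewrite eq_le mulrC; apply/andP; split.
  by apply: (@pr_splice_le m) => //; [move=> x y /ABC[]|move=> x /E ->|exact: pr_ge0].
by apply: (@pr_splice_ge m) => //; [move=> x /E ->|exact: pr_ge0].
Qed.

(** The identity beyond n makes the reversal injective on all of nat, as [law_reindex] requires. *)
Definition rev (n k : nat) : nat := if (k < n)%N then (n - k.+1)%N else k.

Lemma rev_inj n : injective (rev n).
Proof. by move=> i j; rewrite /rev; case: (ltnP i n) => hi; case: (ltnP j n) => hj h; lia. Qed.

Lemma pr_reindex s (A : set X) : injective s -> measurable A ->
  pr mu [set x | A (reindex s x)] = pr mu A.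
Proof. by move=> si mA; rewrite /pr -(law_reindex iid si mA). Qed.

End SplicePr.

(** * Random walks staying positive *)

(** Taking the last minimiser makes the inequality strict after k, so the later path fits [stay],
    and weak before k, which is the form of [descent] after reversal. *)
Lemma last_argmin {R : realType} (f : nat -> R) n : exists2 k, (k <= n)%N &
  (forall j, (j <= k)%N -> f k <= f j) /\ (forall j, (k < j <= n)%N -> f k < f j).
Proof.
elim: n => [|n [k kn [h1 h2]]].
  exists 0%N => //; split => [[|j]//|j]; by rewrite leqn0 andbC; case: j.
have [le|lt] := lerP (f n.+1) (f k).
  exists n.+1 => //; split => [j|j /andP[]]; last by move=> /leq_trans h /h; rewrite ltnn.
  rewrite leq_eqVlt => /orP[/eqP ->//|]; rewrite ltnS => jn.
  have [jk|kj] := leqP j k; first exact: le_trans le (h1 _ jk).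
  by apply: le_trans le (ltW (h2 _ _)); rewrite kj.
exists k; first exact: leqW.
split => // j /andP[kj]; rewrite leq_eqVlt => /orP[/eqP ->//|]; rewrite ltnS => jn.
by apply: h2; rewrite kj.
Qed.

Lemma measurable_oppfun {d} {T : measurableType d} {R : realType} (L : T -> R) :
  measurable_fun setT L -> measurable_fun setT (\- L).
Proof. by move=> mL; apply: measurableT_comp. Qed.

Section Walk.
Context {d} {T : measurableType d} {R : realType}.
Local Notation X := (@seqspace d T).

Definition rwalk (L : T -> R) (n : nat) (x : X) : R := \sum_(k < n) L (x k).

Lemma rwalk0 (L : T -> R) x : rwalk L 0 x = 0.
Proof. by rewrite /rwalk big_ord0. Qed.

Lemma rwalkS (L : T -> R) n x : rwalk L n.+1 x = rwalk L n x + L (x n).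
Proof. by rewrite /rwalk big_ord_recr. Qed.

Lemma rwalk1 (L : T -> R) x : rwalk L 1 x = L (x 0%N).
Proof. by rewrite rwalkS rwalk0 add0r. Qed.

Lemma rwalkN (L : T -> R) n x : rwalk (\- L) n x = - rwalk L n x.
Proof. by rewrite /rwalk -sumrN. Qed.

Lemma rwalk_splice (L : T -> R) m n (x y : X) : (n <= m)%N ->
  rwalk L n (splice m (x, y)) = rwalk L n x.
Proof.
move=> nm; rewrite /rwalk; apply: eq_bigr => k _.
by rewrite /splice (leq_trans (ltn_ord k) nm).
Qed.

Lemma rwalk_spliceD (L : T -> R) m n (x y : X) :
  rwalk L (m + n) (splice m (x, y)) = rwalk L m x + rwalk L n y.
Proof.
rewrite /rwalk big_split_ord /=; congr (_ + _); apply: eq_bigr => k _.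
  by rewrite /splice ltn_ord.
by rewrite /splice ltnNge leq_addr /= addKn.
Qed.

Lemma rwalk_spliceB (L : T -> R) m n (x y : X) : (m <= n)%N ->
  rwalk L n (splice m (x, y)) = rwalk L m x + rwalk L (n - m) y.
Proof. by move=> mn; rewrite -{1}(subnKC mn) rwalk_spliceD. Qed.

(** Partial sums of the reversed path are final increments: this turns conditions on the past of a
    minimum into conditions of staying on one side of 0. *)
Lemma rwalk_rev (L : T -> R) n j (x : X) : (j <= n)%N ->
  rwalk L j (reindex (rev n) x) = rwalk L n x - rwalk L (n - j) x.
Proof.
elim: j => [|j IH] jn; first by rewrite rwalk0 subn0 subrr.
rewrite rwalkS IH ?(ltnW jn)// -(subnSK jn) rwalkS /reindex /rev jn.
by rewrite opprD addrA subrK.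
Qed.

Lemma rwalk_rev_full (L : T -> R) n (x : X) : rwalk L n (reindex (rev n) x) = rwalk L n x.
Proof. by rewrite rwalk_rev// subnn rwalk0 subr0. Qed.

Lemma measurable_rwalk (L : T -> R) n : measurable_fun setT L -> measurable_fun setT (rwalk L n).
Proof.
move=> mL; apply: measurable_sum => k.
by apply: measurableT_comp => //; exact: measurable_coord.
Qed.

(** The constraint begins at time 1, so the starting level [a = 0] is allowed. *)
Definition stay (L : T -> R) n a : set X :=
  [set x | forall k, (0 < k <= n)%N -> 0 < a + rwalk L k x].

Definition wstay (L : T -> R) n : set X :=
  [set x | forall k, (k <= n)%N -> 0 <= rwalk L k x].

Lemma measurable_stay (L : T -> R) n a : measurable_fun setT L -> measurable (stay L n a).
Proof.
move=> mL; apply: measurable_forall_nat => k _; apply: measurable_ltset => //.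
by apply: measurable_funD => //; exact: measurable_rwalk.
Qed.

Lemma measurable_wstay (L : T -> R) n : measurable_fun setT L -> measurable (wstay L n).
Proof.
move=> mL; apply: measurable_forall_nat => k _; apply: measurable_leset => //.
exact: measurable_rwalk.
Qed.

Lemma stay_splice (L : T -> R) m n a (x y : X) :
  stay L (m + n) a (splice m (x, y)) <->
  stay L m a x /\ stay L n (a + rwalk L m x) y.
Proof.
split=> [h|[h1 h2] k /andP[k0 kn]].
  split=> k /andP[k0 kn].
    by rewrite -(rwalk_splice L x y kn); apply: h; lia.
  by rewrite -addrA -rwalk_spliceD; apply: h; lia.
have [km|mk] := leqP k m; first by rewrite rwalk_splice//; apply: h1; lia.
by rewrite rwalk_spliceB ?(ltnW mk)// addrA; apply: h2; lia.
Qed.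

Lemma stay_le (L : T -> R) m n a b x : (m <= n)%N -> a <= b -> stay L n a x -> stay L m b x.
Proof.
by move=> mn ab h k kn; apply: (lt_le_trans (h k _)); [lia|rewrite lerD2r].
Qed.

Lemma stay_wstay (L : T -> R) n x : stay L n 0 x -> wstay L n x.
Proof.
by move=> h [_|k kn]; [rewrite rwalk0|apply: ltW; rewrite -[ltRHS]add0r; exact: h].
Qed.

Variable mu : probability X R.
Hypothesis iid : iid_law mu.

Definition survival (L : T -> R) n a : R := pr mu (stay L n a).

Lemma survival_ge0 (L : T -> R) n a : 0 <= survival L n a. Proof. exact: pr_ge0. Qed.

Lemma survival_le1 (L : T -> R) n a : measurable_fun setT L -> survival L n a <= 1.
Proof. by move=> mL; apply: pr_le1; exact: measurable_stay. Qed.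

Lemma survival0 (L : T -> R) a : survival L 0 a = 1.
Proof.
rewrite /survival (_ : stay L 0 a = setT) ?prT//.
by apply/seteqP; split => // x _ k; case: k.
Qed.

Lemma le_survival (L : T -> R) m n a b : measurable_fun setT L -> (m <= n)%N -> a <= b ->
  survival L n a <= survival L m b.
Proof.
move=> mL mn ab; apply: le_pr; [exact: measurable_stay|exact: measurable_stay|].
by move=> x; exact: stay_le.
Qed.

Lemma measurable_below (L : T -> R) k : measurable_fun setT L ->
  measurable [set x : X | forall j, (j < k)%N -> rwalk L k x < rwalk L j x].
Proof.
move=> mL; apply: measurable_forall_nat => j _.
by apply: measurable_ltset; exact: measurable_rwalk.
Qed.

(** Reversal turns the increments S_k - S_(k-j) into partial sums, and at a strict minimum all of
    them are negative. *)
Lemma pr_below (L : T -> R) k : measurable_fun setT L ->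
  pr mu [set x | forall j, (j < k)%N -> rwalk L k x < rwalk L j x] =
  survival (\- L) k 0.
Proof.
move=> mL; rewrite /survival -[RHS](pr_reindex iid (@rev_inj k)); last first.
  by apply: measurable_stay; exact: measurable_oppfun.
congr pr; apply/seteqP; split => [x h j /andP[j0 jk]|x h j jk] /=.
  by rewrite rwalkN rwalk_rev// add0r opprB subr_gt0; apply: h; lia.
have := h (k - j)%N; rewrite rwalkN rwalk_rev ?leq_subr// add0r opprB subr_gt0.
by rewrite subKn ?(ltnW jk)//; apply; lia.
Qed.

(* The events "the walk has its strict minimum over [0, n] at time k" are
   disjoint. *)
Lemma survival_duality (L : T -> R) n : measurable_fun setT L ->
  \sum_(k < n.+1) survival (\- L) k 0 * survival L (n - k) 0 <= 1.
Proof.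
move=> mL.
pose D k := [set x : X | (forall j, (j < k)%N -> rwalk L k x < rwalk L j x) /\
  forall j, (k < j <= n)%N -> rwalk L k x < rwalk L j x].
have mD k : measurable (D k).
  apply: measurableI; first exact: measurable_below.
  apply: measurable_forall_nat => j _.
  by apply: measurable_ltset; exact: measurable_rwalk.
have DE k : (k < n.+1)%N ->
    survival (\- L) k 0 * survival L (n - k) 0 = pr mu (D k).
  rewrite ltnS => kn; rewrite -pr_below//; apply/esym.
  apply: (pr_splice_eq iid (m := k)) => //.
  - exact: measurable_below.
  - exact: measurable_stay.
  - move=> x y; split=> [[h1 h2]|[h1 h2]]; split.
    + by move=> j jk; have := h1 j jk; rewrite !rwalk_splice// ltnW.
    + move=> j /andP[j0 jn]; have := h2 (k + j)%N.
      rewrite rwalk_splice// rwalk_spliceD -ltrBlDl subrr add0r; apply; lia.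
    + by move=> j jk; rewrite !rwalk_splice ?(ltnW jk)//; exact: h1.
    + move=> j /andP[kj jn].
      rewrite rwalk_splice// rwalk_spliceB ?(ltnW kj)// -ltrBlDl subrr -[ltRHS]add0r.
      by apply: h2; lia.
under eq_bigr => k _ do rewrite DE//.
rewrite -pr_sum//.
  apply: pr_le1; rewrite (_ : [set x | _] = \bigcup_(k in `I_n.+1) D k).
    by apply: bigcup_measurable => k _.
  by apply/seteqP; split => x [k]; exists k.
move=> i j x ni nj [h1 h2] [h1' h2'].
have [ij|ji|//] := ltngtP i j.
  have ijn : (i < j <= n)%N by lia.
  by have := lt_trans (h1' i ij) (h2 j ijn); rewrite ltxx.
have jin : (j < i <= n)%N by lia.
by have := lt_trans (h1 j ji) (h2' i jin); rewrite ltxx.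
Qed.

(** After reversal, the probability that the walk has a weak minimum over [0, k] at time k, at depth
    less than a. *)
Definition descent (L : T -> R) k a : R :=
  pr mu [set x | (forall j, (j <= k)%N -> rwalk L j x <= 0) /\ 0 < a + rwalk L k x].

Lemma measurable_descent (L : T -> R) k a : measurable_fun setT L ->
  measurable [set x : X |
    (forall j, (j <= k)%N -> rwalk L j x <= 0) /\ 0 < a + rwalk L k x].
Proof.
move=> mL; apply: measurableI.
  apply: measurable_forall_nat => j _; apply: measurable_leset => //.
  exact: measurable_rwalk.
by apply: measurable_ltset => //; apply: measurable_funD => //; exact: measurable_rwalk.
Qed.

(* Decomposition at the last time of the minimum, the part before it being
   reversed. *)
Lemma survival_descent (L : T -> R) n a : measurable_fun setT L -> 0 < a ->
  survival L n a = \sum_(k < n.+1) descent L k a * survival L (n - k) 0.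
Proof.
move=> mL a0.
pose B k := [set x : X | (forall j, (j <= k)%N -> rwalk L k x <= rwalk L j x) /\
  0 < a + rwalk L k x].
have mB k : measurable (B k).
  apply: measurableI.
    apply: measurable_forall_nat => j _.
    by apply: measurable_leset => //; exact: measurable_rwalk.
  by apply: measurable_ltset => //; apply: measurable_funD => //; exact: measurable_rwalk.
have BE k : descent L k a = pr mu (B k).
  rewrite /descent -[LHS](pr_reindex iid (@rev_inj k)); last exact: measurable_descent.
  congr pr; apply/seteqP; split=> x /= [h1 h2]; split.
  - move=> j jk; have := h1 (k - j)%N (leq_subr _ _).
    by rewrite rwalk_rev ?leq_subr// subKn// subr_le0.
  - by rewrite rwalk_rev_full in h2.
  - by move=> j jk; rewrite rwalk_rev// subr_le0; apply: h1; exact: leq_subr.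
  - by rewrite rwalk_rev_full.
pose D k := [set x : X | B k x /\ forall j, (k < j <= n)%N -> rwalk L k x < rwalk L j x].
have mD k : measurable (D k).
  apply: measurableI => //; apply: measurable_forall_nat => j _.
  by apply: measurable_ltset => //; exact: measurable_rwalk.
have DE k : (k < n.+1)%N -> descent L k a * survival L (n - k) 0 = pr mu (D k).
  rewrite ltnS => kn; rewrite BE; apply/esym.
  apply: (pr_splice_eq iid (m := k)) => //.
  - exact: measurable_stay.
  - move=> x y; split=> [[[h0 h1] h2]|[[h0 h1] h2]]; split; try split.
    + by move=> j jk; have := h0 j jk; rewrite !rwalk_splice.
    + by move: h1; rewrite rwalk_splice.
    + move=> j /andP[j0 jn]; have := h2 (k + j)%N.
      rewrite rwalk_splice// rwalk_spliceD -ltrBlDl subrr add0r; apply; lia.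
    + by move=> j jk; rewrite !rwalk_splice//; exact: h0.
    + by rewrite rwalk_splice.
    + move=> j /andP[kj jn].
      rewrite rwalk_splice// rwalk_spliceB ?(ltnW kj)// -ltrBlDl subrr -[ltRHS]add0r.
      by apply: h2; lia.
under eq_bigr => k _ do rewrite DE//.
rewrite -pr_sum//; last first.
  move=> i j x ni nj [[h1 _] h2] [[h1' _] h2'].
  have [ij|ji|//] := ltngtP i j.
    have ijn : (i < j <= n)%N by lia.
    by have := lt_le_trans (h2 j ijn) (h1' i (ltnW ij)); rewrite ltxx.
  have jin : (j < i <= n)%N by lia.
  by have := lt_le_trans (h2' i jin) (h1 j (ltnW ji)); rewrite ltxx.
congr pr; apply/seteqP; split => [x h|x [k kn [[h1 h0] h2]] j /andP[j0 jn]].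
  have [k kn [h1 h2]] := last_argmin (rwalk L ^~ x) n.
  exists k => //; split => //; split => //.
  by case: k kn {h1 h2} => [|k] kn; [rewrite rwalk0 addr0|exact: h].
apply: (lt_le_trans h0); rewrite lerD2l.
have [jk|kj] := leqP j k; first exact: h1.
by apply/ltW/h2; rewrite kj.
Qed.

(** A first step of size at least e lifts the whole later path: weak positivity becomes strict at
    the price of a constant factor. *)
Lemma wstay_le_survival (L : T -> R) n e : measurable_fun setT L -> 0 < e ->
  pr mu (wstay L n) * pr mu [set x | e <= L (x 0%N)] <= survival L n.+1 0.
Proof.
move=> mL e0; apply: (pr_splice_ge iid (m := 1)).
- exact: measurable_stay.
- apply: measurable_leset => //.
  by apply: measurableT_comp => //; exact: measurable_coord.
- move=> x /= Lx; apply: le_pr; first exact: measurable_wstay.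
    by apply: measurable_splice_section; exact: measurable_stay.
  move=> y hy /=; rewrite -add1n; apply/stay_splice; split.
    move=> k /andP[k0 k1]; have -> : k = 1%N by lia.
    by rewrite rwalk1 add0r; exact: lt_le_trans Lx.
  move=> k /andP[k0 kn]; rewrite rwalk1 add0r.
  by apply: ltr_pwDl; [exact: lt_le_trans Lx|exact: hy].
- exact: pr_ge0.
Qed.

End Walk.

(** * Second moments and the Green function *)

Section IntegrableReal.
Context {d} {T : measurableType d} {R : realType} (mu : probability T R).

Definition rintegrable (f : T -> R) := mu.-integrable setT (EFin \o f).

Lemma rintegrable_measurable (f : T -> R) : rintegrable f -> measurable_fun setT f.
Proof. by move=> fi; apply/measurable_EFinP; exact: measurable_int fi. Qed.

Lemma le_rintegrable (f g : T -> R) : measurable_fun setT f -> (forall x, `|f x| <= `|g x|) ->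
  rintegrable g -> rintegrable f.
Proof.
move=> mf fg; apply: le_integrable => //; first exact/measurable_EFinP.
by move=> x _; rewrite /= lee_fin.
Qed.

Lemma rintegrable_cst c : rintegrable (fun=> c).
Proof. exact: finite_measure_integrable_cst. Qed.

Lemma rintegrableD (f g : T -> R) : rintegrable f -> rintegrable g ->
  rintegrable (fun x => f x + g x).
Proof. by move=> fi gi; exact: (integrableD measurableT fi gi). Qed.

Lemma rintegrableZ c (f : T -> R) : rintegrable f -> rintegrable (fun x => c * f x).
Proof. by move=> fi; exact: (integrableZl measurableT c fi). Qed.

Lemma rintegrable_indic A : measurable A -> rintegrable (\1_A).
Proof. by move=> mA; exact: (integrable_indic mu mA). Qed.

Lemma Rintegral_indicT A : measurable A -> \int[mu]_x \1_A x = pr mu A.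
Proof. by move=> mA; rewrite /Rintegral integral_indicT. Qed.

Lemma Rintegral_EFin (f : T -> R) : rintegrable f ->
  (\int[mu]_x (f x)%:E = (\int[mu]_x f x)%R%:E)%E.
Proof. by move=> fi; rewrite /Rintegral fineK//; exact: integrable_fin_num fi. Qed.

Lemma RintegralZT c (f : T -> R) : rintegrable f ->
  \int[mu]_x (c * f x) = c * \int[mu]_x f x.
Proof. by move=> fi; rewrite RintegralZl. Qed.

Lemma integral_cstT (c : \bar R) : (\int[mu]_x c = c)%E.
Proof. by rewrite integral_cst// -[RHS]mule1 -(probability_setT mu). Qed.

Lemma Rintegral_cstT (c : R) : \int[mu]_x c = c.
Proof. by rewrite /Rintegral integral_cstT. Qed.

End IntegrableReal.

Section Moments.
Context {d} {T : measurableType d} {R : realType}.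
Local Notation X := (@seqspace d T).
Variable mu : probability X R.
Hypothesis iid : iid_law mu.

Record centered (L : T -> R) : Prop := Centered {
  centered_meas : measurable_fun setT L ;
  centered_int : rintegrable mu (fun x => L (x 0%N)) ;
  centered_int2 : rintegrable mu (fun x => L (x 0%N) ^+ 2) ;
  centered_mean : \int[mu]_x L (x 0%N) = 0 ;
  centered_var : 0 < \int[mu]_x (L (x 0%N) ^+ 2) }.

Definition step_var (L : T -> R) := \int[mu]_x (L (x 0%N) ^+ 2).

Lemma centeredN (L : T -> R) : centered L -> centered (\- L).
Proof.
case=> mL i1 i2 m v; split.
- exact: measurable_oppfun.
- have := rintegrableZ (-1) i1; congr (rintegrable mu); apply/funext => x /=.
  by rewrite mulN1r.
- by move: i2; congr (rintegrable mu); apply/funext => x /=; rewrite sqrrN.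
- under eq_Rintegral do rewrite /= -mulN1r.
  by rewrite RintegralZl// m mulr0.
- by under eq_Rintegral do rewrite /= sqrrN.
Qed.

Lemma Rintegral_prod_shift m (f g : X -> R) :
  (forall x y, f (splice m (x, y)) = f x) ->
  rintegrable mu f -> rintegrable mu g ->
  rintegrable mu (fun x => f x * g (shift m x)) /\
  \int[mu]_x (f x * g (shift m x)) = \int[mu]_x f x * \int[mu]_x g x.
Proof.
move=> fm fi gi; have [h1 h2] := integral_prod_shift iid fm fi gi; split => //.
by rewrite /Rintegral h2 fineM//; exact: integrable_fin_num.
Qed.

(** Martingale transform of the walk. Predictability, that [e k] depends on the coordinates before
    k, is a hypothesis phrased with [splice] in the next lemma. *)
Definition mart (L : T -> R) (e : nat -> X -> R) n x := \sum_(k < n) e k x * L (x k).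

(** Orthogonality of the increments: the integral of the cross term factors, and the fresh step has
    mean 0. *)
Lemma mart_moments (L : T -> R) (e : nat -> X -> R) n : centered L ->
  (forall k, measurable_fun setT (e k)) -> (forall k x, `|e k x| <= 1) ->
  (forall k m x y, (k <= m)%N -> e k (splice m (x, y)) = e k x) ->
  [/\ rintegrable mu (mart L e n), \int[mu]_x mart L e n x = 0,
      rintegrable mu (fun x => mart L e n x ^+ 2) &
      \int[mu]_x (mart L e n x ^+ 2) =
        step_var L * \sum_(k < n) \int[mu]_x (e k x ^+ 2)].
Proof.
move=> [mL i1 i2 m0 v0] me e1 ea.
have Lk (k : nat) (x : X) : L (x k) = (fun y : X => L (y 0%N)) (shift k x).
  by rewrite /shift /reindex /= addn0.
have ei k : rintegrable mu (e k).
  by apply: le_rintegrable (rintegrable_cst mu 1) => // x; rewrite normr1.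
have e2i k : rintegrable mu (fun x => e k x ^+ 2).
  apply: le_rintegrable (rintegrable_cst mu 1) => //.
    exact: measurable_funX.
  by move=> x; rewrite normr1 normrX exprn_ile1.
elim: n => [|n [I1 E1 I2 E2]].
  have Z : mart L e 0 = fun=> 0 by apply/funext => x; rewrite /mart big_ord0.
  rewrite Z; split.
  - exact: rintegrable_cst.
  - by rewrite Rintegral_cst// mul0r.
  - by rewrite expr0n; exact: rintegrable_cst.
  - by rewrite big_ord0 mulr0 expr0n /= Rintegral_cst// mul0r.
have mY := rintegrable_measurable I1.
have S x : mart L e n.+1 x = mart L e n x + e n x * (fun y : X => L (y 0%N)) (shift n x).
  by rewrite /mart big_ord_recr /= -Lk.
have Ya x y : mart L e n (splice n (x, y)) = mart L e n x.
  apply: eq_bigr => k _; rewrite (ea k n x y (ltnW (ltn_ord k))).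
  by rewrite /splice ltn_ord.
have Yei : rintegrable mu (fun x => mart L e n x * e n x).
  apply: le_rintegrable I1; first exact: measurable_funM.
  by move=> x; rewrite normrM ler_piMr.
have [J1 F1] := Rintegral_prod_shift (fun x y => ea n n x y (leqnn n)) (ei n) i1.
have [J2 F2] := Rintegral_prod_shift
  (fun x y => f_equal2 *%R (Ya x y) (ea n n x y (leqnn n))) Yei i1.
have [J3 F3] := Rintegral_prod_shift
  (fun x y => f_equal (fun t => t ^+ 2) (ea n n x y (leqnn n))) (e2i n) i2.
have S2 x : mart L e n.+1 x ^+ 2 = mart L e n x ^+ 2 +
    (2 * (mart L e n x * e n x * (fun y : X => L (y 0%N)) (shift n x)) +
     e n x ^+ 2 * (fun y : X => L (y 0%N) ^+ 2) (shift n x)).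
  by rewrite S /=; ring.
have K2 := rintegrableD (rintegrableZ 2 J2) J3.
split.
- by rewrite (funext S); exact: rintegrableD.
- under eq_Rintegral do rewrite S.
  by rewrite RintegralD// E1 F1 m0 mulr0 addr0.
- by rewrite (funext S2); exact: rintegrableD.
- under eq_Rintegral do rewrite S2.
  rewrite RintegralD// RintegralD//; last exact: rintegrableZ.
  rewrite RintegralZl// E2 F2 F3 m0 !mulr0 add0r big_ord_recr /= mulrDr.
  by congr (_ + _); rewrite mulrC.
Qed.

Lemma rwalk_moments (L : T -> R) n : centered L ->
  [/\ rintegrable mu (rwalk L n), \int[mu]_x rwalk L n x = 0,
      rintegrable mu (fun x => rwalk L n x ^+ 2) &
      \int[mu]_x (rwalk L n x ^+ 2) = step_var L * n%:R].
Proof.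
move=> cL; have [//|k x|//|I1 E1 I2 E2] := @mart_moments L (fun _ _ => 1) n cL.
  by rewrite normr1.
have ME : mart L (fun _ _ => 1) n = rwalk L n.
  by apply/funext => x; rewrite /mart; under eq_bigr do rewrite mul1r.
rewrite ME in I1 E1 I2 E2; split => //; rewrite E2; congr (_ * _).
under eq_bigr do rewrite expr1n Rintegral_cst//.
rewrite (_ : fine (mu setT) = 1) ?mulr1 ?sumr_const ?card_ord//.
by rewrite probability_setT.
Qed.

(** With survival indicators as weights, the transform is the walk stopped on leaving the positive
    half-line. Once stopped it is nonpositive, and a nonpositive first step stops it at once. *)
Lemma mart_stay (L : T -> R) n x :
  let Y := mart L (fun k => \1_(stay L k 0)) n.+1 x in
  (stay L n.+1 0 x /\ Y = rwalk L n.+1 x) \/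
  [/\ ~ stay L n.+1 0 x, Y <= 0 & L (x 0%N) <= 0 -> Y = L (x 0%N)].
Proof.
elim: n => [|n IH] /=.
  have -> : mart L (fun k => \1_(stay L k 0)) 1 x = L (x 0%N).
    rewrite /mart big_ord1 indicE mem_set ?mul1r// => k; by case: k.
  rewrite rwalk1; have [h|h] := ltrP 0 (L (x 0%N)).
    left; split => // k kn; have -> : k = 1%N by lia.
    by rewrite rwalk1 add0r.
  right; split => // /(_ 1%N isT); rewrite rwalk1 add0r => h'.
  by have := lt_le_trans h' h; rewrite ltxx.
have E : mart L (fun k => \1_(stay L k 0)) n.+2 x =
    mart L (fun k => \1_(stay L k 0)) n.+1 x + \1_(stay L n.+1 0) x * L (x n.+1).
  by rewrite /mart big_ord_recr.
rewrite E; case: IH => [[h ->]|[h Y0 Y1]].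
  rewrite indicE mem_set// mul1r -rwalkS.
  have [p|p] := ltrP 0 (rwalk L n.+2 x).
    left; split => // k /andP[k0]; rewrite leq_eqVlt => /orP[/eqP ->|]; first by rewrite add0r.
    by rewrite ltnS => kn; apply: h; rewrite k0.
  right; split => //.
    by move=> /(_ n.+2); rewrite leqnn add0r => /(_ isT) p'; have := lt_le_trans p' p; rewrite ltxx.
  by have := h 1%N isT; rewrite rwalk1 add0r => /lt_le_trans h' /h'; rewrite ltxx.
right; rewrite indicE memNset// mul0r addr0; split => // h'; apply: h => k kn.
by apply: h'; lia.
Qed.

(** Otherwise |L| = L + 2 max(0, -L) has mean 0, so L vanishes almost surely, against the positive
    variance. *)
Lemma neg_part_pos (L : T -> R) : centered L ->
  0 < \int[mu]_x Num.max 0 (- L (x 0%N)).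
Proof.
case=> mL i1 i2 m0 v0.
have mL0 : measurable_fun setT (fun x : X => L (x 0%N)).
  by apply: measurableT_comp => //; exact: measurable_coord.
have mN : measurable_fun setT (fun x : X => Num.max 0 (- L (x 0%N))).
  by apply: measurable_maxr => //; exact: measurableT_comp.
have iN : rintegrable mu (fun x => Num.max 0 (- L (x 0%N))).
  by apply: le_rintegrable i1 => // x; case: (ltrgt0P (- L (x 0%N))) => h;
    rewrite ?normrN ?normr0 ?normr_ge0//.
rewrite lt_neqAle Rintegral_ge0 ?andbT; last first.
  by move=> x _; rewrite le_max lexx.
apply/eqP => N0.
have iA : rintegrable mu (fun x => `|L (x 0%N)|).
  by apply: le_rintegrable i1; [exact: measurableT_comp|move=> x; rewrite normr_id].
have A0 : \int[mu]_x `|L (x 0%N)| = 0.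
  have E x : `|L (x 0%N)| = L (x 0%N) + 2 * Num.max 0 (- L (x 0%N)).
    case: (lerP 0 (- L (x 0%N))) => h.
      by rewrite ler0_norm; [ring|rewrite -oppr_ge0].
    by rewrite gtr0_norm ?mulr0 ?addr0// -oppr_lt0.
  under eq_Rintegral do rewrite E.
  by rewrite RintegralD//; [rewrite RintegralZl// m0 -N0; ring|exact: rintegrableZ].
have : (\int[mu]_x `|(L (x 0%N))%:E| = 0)%E.
  by have := Rintegral_EFin iA; rewrite A0.
move/(ae_eq_integral_abs mu measurableT (measurable_int mu i1)) => L0.
move: v0; rewrite (_ : \int[mu]_x _ = 0) ?ltxx//.
rewrite /Rintegral (_ : (\int[mu]_x _)%E = 0%E)//.
transitivity (\int[mu]_(x in (setT : set X)) (cst 0 x))%E; last exact: integral0.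
apply: ae_eq_integral => //.
  by apply/measurable_EFinP; exact: measurable_funX.
by apply: filterS L0 => x h _; have := h I; case=> ->; rewrite expr0n.
Qed.

(** The positive part of L has positive mean, by [neg_part_pos] for -L, and {L > 0} is the union of
    the sets {L >= 1/(n+1)}; they cannot all be null. *)
Lemma exists_step (L : T -> R) : centered L ->
  exists2 e : R, 0 < e & 0 < pr mu [set x | e <= L (x 0%N)].
Proof.
move=> cL; have [mL _ _ _ _] := cL.
have mS c : measurable [set x : X | c <= L (x 0%N)].
  apply: measurable_leset => //.
  by apply: measurableT_comp => //; exact: measurable_coord.
apply/not_exists2P => H.
have := neg_part_pos (centeredN cL); rewrite /Rintegral.
under eq_integral do rewrite /= opprK.
rewrite (_ : (\int[mu]_x _)%E = 0%E) ?ltxx//.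
transitivity (\int[mu]_(x in (setT : set X)) (cst 0 x))%E; last exact: integral0.
apply: ae_eq_integral => //.
  apply/measurable_EFinP; apply: measurable_maxr => //.
  by apply: measurableT_comp => //; exact: measurable_coord.
have pos0 : mu [set x : X | 0 < L (x 0%N)] = 0%E.
  have -> : [set x : X | 0 < L (x 0%N)] = \bigcup_n [set x : X | n.+1%:R^-1 <= L (x 0%N)].
    apply/seteqP; split => x /= => [h|[n _ /=]].
      have [n hn] := ltr_add_invr h; exists n => //=.
      by apply: ltW; rewrite -[X in X < _]add0r.
    by apply: lt_le_trans; rewrite invr_gt0.
  apply: measure_negligible; first by apply: bigcupT_measurable => n; exact: mS.
  apply: negligible_bigcup => n; apply/negligibleP; first exact: mS.
  case: (H n.+1%:R^-1) => [h|]; first by exfalso; apply: h; rewrite invr_gt0.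
  move/negP; rewrite -leNgt => h; apply: etrans (prE mu (mS _)) _; congr EFin; apply/eqP.
  by rewrite eq_le h pr_ge0.
exists [set x : X | 0 < L (x 0%N)]; split => //.
  apply: measurable_ltset => //.
  by apply: measurableT_comp => //; exact: measurable_coord.
move=> x /= /not_implyP[_]; case: (lerP 0 (L (x 0%N))) => h h'; last by case: h'.
by rewrite lt_neqAle h andbT; apply/eqP => h0; apply: h'; rewrite -h0.
Qed.

(** The stopped walk Y has mean 0, so its part on survival has mean at least that of the negative
    part of the first step. Cauchy-Schwarz bounds the square of this by E Y^2 times the survival
    probability, and E Y^2 is the variance times the truncated mean lifetime. *)
Lemma survival_green (L : T -> R) n : centered L ->
  (\int[mu]_x Num.max 0 (- L (x 0%N))) ^+ 2 <=
  step_var L * survival mu L n.+1 0 * \sum_(k < n.+1) survival mu L k 0.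
Proof.
move=> cL; have [mL i1 i2 m0 v0] := cL.
set c := \int[mu]_x _; have c0 : 0 < c := neg_part_pos cL.
pose e k := \1_(stay L k 0) : X -> R.
have [k|k x|k m x y km|I1 E1 I2 E2] := @mart_moments L e n.+1 cL.
- by apply: measurable_indic; exact: measurable_stay.
- by rewrite /e indicE; case: (_ \in _); rewrite ?normr1 ?normr0.
- rewrite /e !indicE; congr (_%:R); congr nat_of_bool.
  by apply/idP/idP; rewrite !in_setE => h j jk; have := h j jk;
    rewrite rwalk_splice//; lia.
have E2' : \int[mu]_x (mart L e n.+1 x ^+ 2) =
    step_var L * \sum_(k < n.+1) survival mu L k 0.
  rewrite E2; congr (_ * _); apply: eq_bigr => k _.
  under eq_Rintegral do rewrite /e indicE -natrX.
  rewrite /survival -Rintegral_indicT; last exact: measurable_stay.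
  by apply: eq_Rintegral => x _; rewrite indicE; case: (_ \in _).
set A := \sum_(k < _) _ in E2' *; set s := step_var L in E2' *.
have A1 : 1 <= A.
  rewrite /A big_ord_recl survival0 lerDl sumr_ge0// => k _; exact: survival_ge0.
(* Cauchy-Schwarz in the form 2y <= l y^2 + 1/l. This l makes the quadratic term integrate to c, so
   no square root is taken. *)
pose l := c / (s * A).
have sA : 0 < s * A by rewrite mulr_gt0//; lra.
have l0 : 0 < l by rewrite divr_gt0.
have iN : rintegrable mu (fun x => Num.max 0 (- L (x 0%N))).
  apply: le_rintegrable i1.
    apply: measurable_maxr => //; apply: measurableT_comp => //.
    by apply: measurableT_comp => //; exact: measurable_coord.
  by move=> x; case: (ltrgt0P (- L (x 0%N))) => h;
    rewrite ?normrN ?normr0 ?normr_ge0//.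
have mst := measurable_stay n.+1 0 mL.
have : 2 * c <= l * (s * A) + l^-1 * survival mu L n.+1 0.
  rewrite -E2' /survival -Rintegral_indicT//.
  have -> : 2 * c = \int[mu]_x (2 * (mart L e n.+1 x + Num.max 0 (- L (x 0%N)))).
    rewrite RintegralZl//; last exact: rintegrableD.
    by rewrite RintegralD// E1 add0r.
  rewrite -!RintegralZl//; last exact: rintegrable_indic.
  have j1 := rintegrableZ l I2; have j2 := rintegrableZ l^-1 (rintegrable_indic mu mst).
  rewrite -RintegralD//; apply: le_Rintegral => //.
  - by apply: rintegrableZ; exact: rintegrableD.
  - exact: rintegrableD.
  move=> x _; set Y := mart L e n.+1 x.
  have := mart_stay L n x; rewrite /= -/e -/Y => -[[h YE]|[h Y0 Y1]].
    rewrite indicE mem_set// mulr1.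
    have -> : Num.max 0 (- L (x 0%N)) = 0.
      apply/max_idPl; rewrite oppr_le0.
      by have := h 1%N isT; rewrite rwalk1 add0r => /ltW.
    rewrite addr0 -subr_ge0 (_ : _ - _ = l^-1 * (l * Y - 1) ^+ 2).
      by rewrite mulr_ge0 ?invr_ge0 ?sqr_ge0// ltW.
    by field; rewrite gt_eqF.
  (* The path has stopped: whatever the sign of the first step, Y + max(0, -L) <= 0. *)
  rewrite indicE memNset// mulr0 addr0.
  apply: (@le_trans _ _ 0); last by rewrite mulr_ge0 ?sqr_ge0// ltW.
  case: (lerP 0 (- L (x 0%N))) => h'; first by rewrite Y1; [lra|lra].
  by lra.
have -> : l * (s * A) = c by rewrite /l divfK// gt_eqF.
rewrite mulr2n mulrDl mul1r lerD2l => h.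
have : c * c <= c * (l^-1 * survival mu L n.+1 0) by rewrite ler_pM2l.
rewrite -expr2 => /le_trans; apply; rewrite le_eqVlt; apply/orP; left; apply/eqP.
by rewrite /l invf_div; field; rewrite gt_eqF.
Qed.

End Moments.

(** * Survival probabilities *)

Section Roots.
Context {R : realType}.

(** The shift by one makes [rt2 0] and [rt4 0] equal to 1, so that quotients by them are meaningful
    at n = 0. *)
Definition rt2 (n : nat) : R := Num.sqrt n.+1%:R.
Definition rt4 (n : nat) : R := Num.sqrt (rt2 n).

Lemma rt2_gt0 n : 0 < rt2 n. Proof. by rewrite sqrtr_gt0. Qed.
Lemma rt4_gt0 n : 0 < rt4 n. Proof. by rewrite sqrtr_gt0 rt2_gt0. Qed.
Lemma rt2K n : rt2 n ^+ 2 = n.+1%:R. Proof. by rewrite sqr_sqrtr. Qed.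
Lemma rt4K n : rt4 n ^+ 2 = rt2 n. Proof. by rewrite sqr_sqrtr// ltW// rt2_gt0. Qed.
Lemma rt4K4 n : rt4 n ^+ 4 = n.+1%:R.
Proof. by rewrite (exprM _ 2 2) rt4K rt2K. Qed.
Lemma le_rt2 m n : (m <= n)%N -> rt2 m <= rt2 n.
Proof. by move=> mn; rewrite ler_wsqrtr// ler_nat. Qed.
Lemma le_rt4 m n : (m <= n)%N -> rt4 m <= rt4 n.
Proof. by move=> mn; rewrite ler_wsqrtr// le_rt2. Qed.
Lemma rt4_le3 m n : (n.+1 <= 3 * m.+1)%N -> rt4 n <= 3 * rt4 m.
Proof.
move=> nm; have h : 0 <= 3 * rt4 m by rewrite mulr_ge0// ltW// rt4_gt0.
rewrite -(ler_pXn2r (n := 4))// ?nnegrE// ?(ltW (rt4_gt0 _))//.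
rewrite exprMn !rt4K4 -natrX -natrM ler_nat; move: nm; clear; lia.
Qed.
Lemma rt2_ge1 n : 1 <= rt2 n.
Proof. by rewrite -sqrtr1 ler_wsqrtr// ler1n. Qed.
Lemma rt4_ge1 n : 1 <= rt4 n.
Proof. by rewrite -sqrtr1 ler_wsqrtr// rt2_ge1. Qed.

Lemma sum_rt2V n : \sum_(k < n.+1) (rt2 k)^-1 <= 2 * rt2 n.
Proof.
elim: n => [|n IH].
  by rewrite big_ord_recr big_ord0 /= add0r /rt2 sqrtr1 invr1 mulr1 ler1n.
rewrite big_ord_recr /=; apply: (le_trans (lerD IH (lexx _))).
rewrite -lerBrDl -mulrBr -(ler_pM2r (rt2_gt0 n.+1)) mulVf ?gt_eqF ?rt2_gt0//.
have := rt2K n; have := rt2K n.+1; rewrite -(natr1 n.+1) => h1 h2.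
have : (rt2 n.+1 - rt2 n) ^+ 2 >= 0 by exact: sqr_ge0.
by nra.
Qed.

End Roots.

Section Bounds.
Context {d} {T : measurableType d} {R : realType}.
Local Notation X := (@seqspace d T).
Variable mu : probability X R.
Hypothesis iid : iid_law mu.

Local Notation p L n := (survival mu L n 0).

(** With A_n the partial sums, A_(n+1) = A_n + p_(n+1) and p_(n+1) A_n >= k0 give A_(n+1)^2 >= A_n^2
    + 2 k0, so A_n^2 grows linearly. *)
Lemma survival_sum_lower (L : T -> R) : centered mu L ->
  exists2 c : R, 0 < c & forall n, c * rt2 n <= \sum_(k < n.+1) p L k /\
     c <= p L n.+1 * \sum_(k < n.+1) p L k.
Proof.
move=> cL; have [mL i1 i2 m0 v0] := cL.
pose k0 := (\int[mu]_x Num.max 0 (- L (x 0%N))) ^+ 2 / step_var mu L.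
have k00 : 0 < k0 by rewrite divr_gt0// exprn_gt0//; exact: neg_part_pos.
have G n : k0 <= p L n.+1 * \sum_(k < n.+1) p L k.
  by rewrite ler_pdivrMr// mulrC mulrA; exact: survival_green.
(* The three bounds serve the start A_0 = 1, the product bound and the increment 2 k0
   respectively. *)
pose k := Num.min (Num.min 1 k0) (2 * k0).
have kP : 0 < k by rewrite !lt_min k00 ltr01 mulr_gt0.
have [k1 k2 k3] : [/\ k <= 1, k <= k0 & k <= 2 * k0].
  by split; rewrite /k !ge_min lexx ?orbT.
have S n : k * n.+1%:R <= (\sum_(k < n.+1) p L k) ^+ 2.
  elim: n => [|n IH].
    by rewrite big_ord_recr big_ord0 /= survival0 add0r expr1n mulr1.
  rewrite big_ord_recr /= -natr1 mulrDr mulr1 sqrrD.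
  have := G n; have := sqr_ge0 (p L n.+1).
  move: IH; set a := \sum_(k < n.+1) _; set b := p L n.+1 => IH b2 ab.
  by rewrite mulr2n; lra.
exists k => // n; split; last exact: le_trans (G n).
have kk : k * rt2 n <= Num.sqrt (k * n.+1%:R).
  rewrite sqrtrM ?(ltW kP)// ler_pM2r ?rt2_gt0//.
  by rewrite -{1}(sqr_sqrtr (ltW kP)) expr2 ler_piMr// ?sqrtr_ge0// -sqrtr1 ler_wsqrtr.
apply: (le_trans kk); rewrite -[leRHS]ger0_norm; last first.
  by rewrite sumr_ge0// => i _; exact: survival_ge0.
by rewrite -sqrtr_sqr ler_wsqrtr.
Qed.

(** In the duality sum p(n-k) >= p(n), so p(n) times the partial sum for -L, itself at least c' sqrt
    n, is at most 1. Summing this upper bound controls A_n from above, and p_(n+1) A_n >= c then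
    gives the lower bound. *)
Lemma survival_bounds (L : T -> R) : centered mu L ->
  exists c C : R, [/\ 0 < c, 0 < C &
    forall n, [/\ c / rt2 n <= p L n, p L n <= C / rt2 n &
     \sum_(k < n.+1) p L k <= C * rt2 n]].
Proof.
move=> cL; have [mL _ _ _ _] := cL.
have [c c0 G] := survival_sum_lower cL.
have [c' c'0 G'] := survival_sum_lower (centeredN cL).
have U n : p L n <= c'^-1 / rt2 n.
  rewrite -invfM -[leRHS]div1r ler_pdivlMr ?mulr_gt0 ?rt2_gt0//.
  apply: le_trans (survival_duality iid n mL).
  have [+ _] := G' n => /(ler_wpM2l (survival_ge0 mu L n 0)) /le_trans; apply.
  rewrite mulr_sumr; apply: ler_sum => k _.
  rewrite mulrC; apply: ler_wpM2l; first exact: survival_ge0.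
  by apply: le_survival => //; exact: leq_subr.
have A n : \sum_(k < n.+1) p L k <= 2 * c'^-1 * rt2 n.
  apply: (@le_trans _ _ (\sum_(k < n.+1) c'^-1 / rt2 k)).
    by apply: ler_sum => k _; exact: U.
  by rewrite -mulr_sumr -mulrA mulrCA ler_pM2l ?invr_gt0//; exact: sum_rt2V.
(* The 1 covers n = 0, where the survival probability is 1. *)
pose l := Num.min 1 (c / (2 * c'^-1)).
have l0 : 0 < l by rewrite lt_min ltr01 divr_gt0// mulr_gt0// invr_gt0.
exists l, (2 * c'^-1); split => //; first by rewrite mulr_gt0 ?invr_gt0.
have cV : 0 < c'^-1 by rewrite invr_gt0.
move=> n; split => //.
- case: n => [|n].
    by rewrite survival0 /rt2 sqrtr1 invr1 mulr1 /l ge_min lexx.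
  have [_ H] := G n; have An := A n.
  apply: (@le_trans _ _ (c / (2 * c'^-1) / rt2 n)).
    rewrite ler_pM ?invr_ge0 ?(ltW l0)//; first by rewrite ltW// rt2_gt0.
      by rewrite /l ge_min lexx orbT.
    by rewrite lef_pV2 ?posrE ?rt2_gt0// le_rt2.
  rewrite -mulrA -invfM ler_pdivrMr ?mulr_gt0 ?rt2_gt0//.
  by apply: (le_trans H); rewrite ler_wpM2l//; exact: survival_ge0.
- apply: (le_trans (U n)); rewrite ler_pM2r ?invr_gt0 ?rt2_gt0//.
  by rewrite mulr2n mulrDl mul1r lerDl ltW.
Qed.

End Bounds.

(** * Concentration *)

Section Concentration.
Context {d} {T : measurableType d} {R : realType}.
Local Notation X := (@seqspace d T).
Variable mu : probability X R.
Hypothesis iid : iid_law mu.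

(** Difference of two independent walks, carried by the even and the odd coordinates; n steps use 2n
    coordinates. *)
Definition symwalk (L : T -> R) n (x : X) : R :=
  \sum_(k < n) (L (x k.*2) - L (x k.*2.+1)).

Lemma measurable_symwalk (L : T -> R) n : measurable_fun setT L ->
  measurable_fun setT (symwalk L n).
Proof.
move=> mL; apply: measurable_sum => k; apply: measurable_funB;
  by apply: measurableT_comp => //; exact: measurable_coord.
Qed.

Lemma symwalk_splice (L : T -> R) n x y :
  symwalk L n (splice n.*2 (x, y)) = symwalk L n x.
Proof.
apply: eq_bigr => k _; have kn := ltn_ord k.
by rewrite /splice /= !ifT//; lia.
Qed.

Lemma symwalkS_splice (L : T -> R) n x y :
  symwalk L n.+1 (splice n.*2 (x, y)) = symwalk L n x + (L (y 0%N) - L (y 1%N)).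
Proof.
rewrite {1}/symwalk big_ord_recr /=; congr (_ + _); first exact: symwalk_splice.
by rewrite /splice /= !ifF ?subnn ?subSnn//; lia.
Qed.

Lemma symwalkE (L : T -> R) n (x : X) :
  symwalk L n x = rwalk L n (reindex double x) - rwalk L n (reindex (fun k => k.*2.+1) x).
Proof. by rewrite /symwalk sumrB. Qed.

Lemma integral_sq_reindex (L : T -> R) s n : centered mu L -> injective s ->
  (\int[mu]_x (rwalk L n (reindex s x) ^+ 2)%:E = (step_var mu L * n%:R)%:E)%E.
Proof.
move=> cL si; have [mL _ _ _ _] := cL.
rewrite (integral_reindex iid (F := fun x => (rwalk L n x ^+ 2)%:E) si)//; last 2 first.
- by apply/measurable_EFinP; apply: measurable_funX; exact: measurable_rwalk.
- by move=> x; rewrite lee_fin sqr_ge0.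
have [_ _ I2 E2] := rwalk_moments iid n cL.
by rewrite Rintegral_EFin// E2.
Qed.

Lemma symwalk_abs (L : T -> R) n : centered mu L ->
  (\int[mu]_x `|symwalk L n.+1 x|%:E <= ((2 * step_var mu L + 1) * rt2 n)%:E)%E.
Proof.
move=> cL; have [mL _ _ _ _] := cL.
(* Scale in 2|w| <= l w^2 + 1/l that makes both terms of order sqrt n in mean. *)
pose l : R := (rt2 n)^-1; have l0 : 0 < l by rewrite invr_gt0 rt2_gt0.
have m1 s : measurable_fun setT (fun x : X => (l * rwalk L n.+1 (reindex s x) ^+ 2)%:E).
  apply/measurable_EFinP; apply: measurable_funM => //; apply: measurable_funX.
  by apply: measurableT_comp; [exact: measurable_rwalk|exact: measurable_reindex].
apply: (@le_trans _ _ (\int[mu]_x ((l * rwalk L n.+1 (reindex double x) ^+ 2)%:E +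
   ((l * rwalk L n.+1 (reindex (fun k => k.*2.+1) x) ^+ 2)%:E + (l^-1)%:E)))%E).
  apply: ge0_le_integral => //.
  - by apply/measurable_EFinP; apply: measurableT_comp => //; exact: measurable_symwalk.
  - by apply: emeasurable_funD => //; exact: emeasurable_funD.
  - move=> x _; rewrite -!EFinD lee_fin symwalkE.
    set a := rwalk _ _ _; set b := rwalk _ _ _.
    have h1 : `|a - b| ^+ 2 <= 2 * a ^+ 2 + 2 * b ^+ 2.
      by rewrite real_normK ?num_real//; have := sqr_ge0 (a + b); nra.
    have h2 : 0 <= l^-1 * (l * `|a - b| - 1) ^+ 2.
      by rewrite mulr_ge0 ?sqr_ge0// invr_ge0 ltW.
    have h3 : l^-1 * (l * `|a - b| - 1) ^+ 2 = l * `|a - b| ^+ 2 - 2 * `|a - b| + l^-1.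
      by field; rewrite gt_eqF.
    have h4 : l * `|a - b| ^+ 2 <= l * (2 * a ^+ 2 + 2 * b ^+ 2) by rewrite ler_pM2l.
    have : 0 <= l^-1 by rewrite invr_ge0 ltW.
    by lra.
have inj1 : injective double by exact: double_inj.
have inj2 : injective (fun k => k.*2.+1) by move=> i j [] /double_inj.
have pos s x : (0 <= (l * rwalk L n.+1 (reindex s x) ^+ 2)%:E)%E.
  by rewrite lee_fin mulr_ge0 ?sqr_ge0// ltW.
have lV : (0 <= (l^-1)%:E)%E by rewrite lee_fin invr_ge0 ltW.
have E s : injective s ->
    (\int[mu]_x (l * rwalk L n.+1 (reindex s x) ^+ 2)%:E = (l * (step_var mu L * n.+1%:R))%:E)%E.
  move=> si; under eq_integral do rewrite EFinM.
  rewrite ge0_integralZl//; last 3 first.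
  - apply/measurable_EFinP; apply: measurable_funX.
    by apply: measurableT_comp; [exact: measurable_rwalk|exact: measurable_reindex].
  - by move=> x _; rewrite lee_fin sqr_ge0.
  - by rewrite lee_fin ltW.
  by rewrite integral_sq_reindex.
rewrite ge0_integralD//; last 2 first.
- by move=> x _; rewrite adde_ge0.
- exact: emeasurable_funD.
rewrite ge0_integralD// !E// integral_cstT -!EFinD lee_fin.
have -> : l * (step_var mu L * n.+1%:R) = step_var mu L * rt2 n.
  by rewrite -rt2K /l; field; rewrite gt_eqF// rt2_gt0.
by rewrite /l invrK; lra.
Qed.

(** Discrete Tanaka formula: the modulus of the symmetric walk is a submartingale gaining at least e
    pi in mean at each visit to [-e/2, e/2], so its mean dominates the expected number of visits. *)
Lemma symwalk_green (L : T -> R) (e e' pi : R) : centered mu L -> 0 < e -> 0 < e' ->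
  pr mu [set x | e <= L (x 0%N)] * pr mu [set x | e' <= - L (x 0%N)] = pi ->
  forall n, ((e * pi * \sum_(k < n) pr mu [set x | `|symwalk L k x| <= e / 2])%:E
    <= \int[mu]_x `|symwalk L n x|%:E)%E.
Proof.
move=> cL e0 e'0 piE; have [mL i1 i2 m0 v0] := cL.
have mA k : measurable [set x : X | `|symwalk L k x| <= e / 2].
  apply: measurable_leset => //; apply: measurableT_comp => //.
  exact: measurable_symwalk.
have pi0 : 0 <= pi by rewrite -piE mulr_ge0// pr_ge0.
have mc k : measurable_fun setT (fun x : X => L (x k)).
  by apply: measurableT_comp => //; exact: measurable_coord.
have i1' : rintegrable mu (fun x => L (x 1%N)).
  have [I1 _ _ _] := rwalk_moments iid 2 cL.
  have := rintegrableD I1 (rintegrableZ (-1) i1); congr rintegrable.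
  by apply/funext => x; rewrite !rwalkS rwalk0 add0r mulN1r addrAC subrr add0r.
have m1 : \int[mu]_x L (x 1%N) = 0.
  have [_ + _ _] := rwalk_moments iid 2 cL.
  under eq_Rintegral do rewrite rwalkS rwalk1.
  by rewrite RintegralD// m0 add0r.
pose Y (x : X) := L (x 0%N) - L (x 1%N).
have iY : rintegrable mu Y.
  have := rintegrableD i1 (rintegrableZ (-1) i1'); congr rintegrable.
  by apply/funext => x; rewrite mulN1r.
have mY : \int[mu]_x Y x = 0 by rewrite /Y RintegralB// m0 m1 subr0.
have mYf : measurable_fun setT Y by exact: rintegrable_measurable iY.
(* A step of at least e in one copy and a negative step in the other are independent and force Y >=
   e; exchanging the copies gives the opposite jump. *)
have pY1 : pi <= pr mu [set y | e <= Y y].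
  rewrite -piE -(pr_splice_eq iid (m := 1)
    (A := [set x : X | e <= L (x 0%N) /\ e' <= - L (x 1%N)])).
  - apply: le_pr.
    + by apply: measurableI; apply: measurable_leset => //; exact: measurableT_comp.
    + by apply: measurable_leset.
    + by move=> y /= [h1 h2]; rewrite /Y; lra.
  - by apply: measurableI; apply: measurable_leset => //; exact: measurableT_comp.
  - by apply: measurable_leset.
  - by apply: measurable_leset => //; exact: measurableT_comp.
  - by move=> x y; rewrite /splice.
have pY2 : pi <= pr mu [set y | e <= - Y y].
  rewrite -piE mulrC -(pr_splice_eq iid (m := 1)
    (A := [set x : X | e' <= - L (x 0%N) /\ e <= L (x 1%N)])).
  - apply: le_pr.
    + by apply: measurableI; apply: measurable_leset => //; exact: measurableT_comp.
    + by apply: measurable_leset => //; exact: measurableT_comp.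
    + by move=> y /= [h1 h2]; rewrite /Y; lra.
  - by apply: measurableI; apply: measurable_leset => //; exact: measurableT_comp.
  - by apply: measurable_leset => //; exact: measurableT_comp.
  - by apply: measurable_leset.
  - by move=> x y; rewrite /splice.
have iW (w : R) : rintegrable mu (fun y => `|w + Y y|).
  have h := rintegrableD (rintegrable_cst mu w) iY.
  by apply: le_rintegrable h; [apply: measurableT_comp => //;
    exact: measurable_funD|move=> y; rewrite normr_id].
(* |w + y| - |w| - sgn(w) y is nonnegative, and at least e when |w| <= e/2 and
   y is a jump of size at least e across 0. *)
have key (w : R) : `|w| + (e * pi) * (`|w| <= e / 2)%R%:R <= \int[mu]_y `|w + Y y|.
  pose sg : R := if 0 <= w then 1 else -1.
  pose J := if 0 <= w then [set y : X | e <= - Y y] else [set y : X | e <= Y y].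
  have mJ : measurable J.
    by rewrite /J; case: ifP => _; apply: measurable_leset => //; exact: measurableT_comp.
  have pJ : pi <= pr mu J by rewrite /J; case: ifP.
  pose b : R := (`|w| <= e / 2)%R%:R.
  have b0 : 0 <= b by rewrite /b.
  apply: (@le_trans _ _ (\int[mu]_y (`|w| + (sg * Y y + e * b * \1_J y)))).
    rewrite RintegralD//; first last.
    - by apply: rintegrableD; [exact: rintegrableZ|apply: rintegrableZ; exact: rintegrable_indic].
    - exact: rintegrable_cst.
    rewrite RintegralD//; first last.
    - by apply: rintegrableZ; exact: rintegrable_indic.
    - exact: rintegrableZ.
    rewrite Rintegral_cstT RintegralZl// mY mulr0 add0r.
    rewrite RintegralZl//; last exact: rintegrable_indic.
    rewrite Rintegral_indicT// lerD2l -/b mulrAC.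
    by rewrite ler_wpM2l// mulr_ge0// ltW.
  apply: le_Rintegral => //.
  - apply: rintegrableD; first exact: rintegrable_cst.
    by apply: rintegrableD; [exact: rintegrableZ|apply: rintegrableZ; exact: rintegrable_indic].
  - exact: iW.
  move=> y _; rewrite /sg /J /b indicE.
  have [w0|w0] := leP 0 w.
    have [/set_mem /= h|_] := boolP (y \in _); last first.
      by rewrite mulr0 addr0 mul1r (ger0_norm w0) ler_norm.
    rewrite (ger0_norm w0) mul1r mulr1; have [we|we] := lerP w (e / 2) => /=.
      by rewrite mulr1 ler0_norm; lra.
    by rewrite mulr0 addr0 ler_norm.
  have [/set_mem /= h|_] := boolP (y \in _); last first.
    by rewrite mulr0 addr0 mulN1r (ltr0_norm w0) -opprD ler_normr lexx orbT.
  rewrite (ltr0_norm w0) mulN1r mulr1; have [we|we] := lerP (- w) (e / 2) => /=.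
    by rewrite mulr1 ger0_norm; lra.
  by rewrite mulr0 addr0 -opprD ler_normr lexx orbT.
elim=> [|n IH].
  by rewrite big_ord0 mulr0; apply: integral_ge0 => x _; rewrite lee_fin.
have mWn k : measurable_fun setT (fun x => `|symwalk L k x|%:E).
  by apply/measurable_EFinP; apply: measurableT_comp => //; exact: measurable_symwalk.
rewrite [leRHS](integral_splice iid n.*2)//.
rewrite big_ord_recr /= mulrDr EFinD.
apply: le_trans (leeD IH (lexx _)) _.
rewrite EFinM -prE// -(integral_indicT mu (mA n)) -ge0_integralZl//; last 2 first.
- exact: measurable_EFin_indic.
- by rewrite lee_fin mulr_ge0// ltW.
rewrite -ge0_integralD//; last 2 first.
- by move=> x _; rewrite mule_ge0// lee_fin ?mulr_ge0// ltW.
- by apply: emeasurable_funM => //; exact: measurable_EFin_indic.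
apply: ge0_le_integral => //.
- by move=> x _; rewrite adde_ge0// mule_ge0// lee_fin ?mulr_ge0// ltW.
- apply: emeasurable_funD => //; apply: emeasurable_funM => //.
  exact: measurable_EFin_indic.
- exact: (measurable_integral_splice mu n.*2 (mWn n.+1)).
move=> x _; under eq_integral do rewrite symwalkS_splice.
rewrite (Rintegral_EFin (iW (symwalk L n x))).
rewrite -EFinM -EFinD lee_fin; apply: le_trans (key _).
by rewrite indicE lerD2l ler_wpM2l// ?mulr_ge0 ?(ltW e0)// mem_setE.
Qed.

End Concentration.

(** * Survival from a positive level *)

Section LocalBounds.
Context {d} {T : measurableType d} {R : realType}.
Local Notation X := (@seqspace d T).
Variable mu : probability X R.
Hypothesis iid : iid_law mu.

Local Notation p L n := (survival mu L n 0).

Lemma measurable_itvset (L : T -> R) n a b : measurable_fun setT L ->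
  measurable [set x : X | a <= rwalk L n x <= b].
Proof.
move=> mL; rewrite (_ : [set x | _] =
  [set x : X | a <= rwalk L n x] `&` [set x : X | rwalk L n x <= b]).
  by apply: measurableI; apply: measurable_leset => //; exact: measurable_rwalk.
by apply/seteqP; split => x /= => [/andP[]|[-> ->]].
Qed.

Lemma measurable_itvoset (L : T -> R) n a b : measurable_fun setT L ->
  measurable [set x : X | a <= rwalk L n x < b].
Proof.
move=> mL; rewrite (_ : [set x | _] =
  [set x : X | a <= rwalk L n x] `&` [set x : X | rwalk L n x < b]).
  by apply: measurableI; [apply: measurable_leset|apply: measurable_ltset] => //;
    exact: measurable_rwalk.
by apply/seteqP; split => x /= => [/andP[]|[-> ->]].
Qed.

(** Two independent copies lying in one interval of length e differ by at most e. *)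
Lemma interval_sq_le_symwalk (L : T -> R) k a e : measurable_fun setT L ->
  pr mu [set x | a <= rwalk L k x <= a + e] ^+ 2 <=
  pr mu [set x | `|symwalk L k x| <= e].
Proof.
move=> mL.
(* The two copies occupy the coordinates 0, ..., k-1 and k, ..., 2k-1; [s] sends them to the even
   and odd coordinates and is the identity beyond, hence injective. *)
pose s j := if (j < k)%N then j.*2 else if (j < k.*2)%N then (j - k).*2.+1 else j.
have s_inj : injective s.
  by move=> i j; rewrite /s; case: (ltnP i k) => ik; case: (ltnP j k) => jk;
    case: (ltnP i k.*2) => ik2; case: (ltnP j k.*2) => jk2; lia.
pose A := [set x : X | a <= rwalk L k x <= a + e /\ a <= rwalk L k (shift k x) <= a + e].
have mA : measurable A.
  apply: measurableI; first exact: measurable_itvset.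
  have := measurable_reindex (addn k) measurableT (measurable_itvset k a (a + e) mL).
  by rewrite setTI.
have mW : measurable [set x : X | `|symwalk L k x| <= e].
  apply: measurable_leset => //; apply: measurableT_comp => //.
  exact: measurable_symwalk.
rewrite expr2 -(pr_splice_eq iid (m := k) (A := A)) //; try exact: measurable_itvset.
  rewrite -(pr_reindex iid s_inj mA); apply: le_pr => //.
    by have := measurable_reindex s measurableT mA; rewrite setTI.
  move=> x [/andP[h1 h2] /andP[h3 h4]] /=; rewrite symwalkE.
  have -> : rwalk L k (reindex double x) = rwalk L k (reindex s x).
    by apply: eq_bigr => j _; rewrite /reindex /s ltn_ord.
  have -> : rwalk L k (reindex (fun k => k.*2.+1) x) = rwalk L k (shift k (reindex s x)).
    apply: eq_bigr => j _; have jk := ltn_ord j; rewrite /shift /reindex /s ifF; last lia.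
    by rewrite ifT ?addKn//; lia.
  by rewrite ler_norml; apply/andP; split; lra.
by move=> x y; rewrite /A /= shift_splice rwalk_splice.
Qed.

(** The worst-case probability of an interval decreases in time, so Q^2 is below each of n + 1 visit
    probabilities of the symmetric walk, whose sum is O(sqrt n). *)
Lemma concentration_step (L : T -> R) : centered mu L -> exists e C : R,
  [/\ 0 < e, 0 < C & forall n a,
    pr mu [set x | a <= rwalk L n x <= a + e] <= C / rt4 n].
Proof.
move=> cL; have [mL _ _ _ v0] := cL.
have [e e0 pe] := exists_step cL.
have [e' e'0 pe'] := exists_step (centeredN cL).
set pi := pr mu [set x | e <= L (x 0%N)] * pr mu [set x | e' <= - L (x 0%N)].
have pi0 : 0 < pi by rewrite mulr_gt0.
have G := symwalk_green iid cL e0 e'0 (erefl pi).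
pose D := (2 * step_var mu L + 1) / (e * pi).
have D0 : 0 < D.
  by rewrite divr_gt0// ?mulr_gt0// addr_gt0// mulr_gt0.
(* [e / 2] is the half-width of the visited interval in [symwalk_green], and [D + 1] bounds the
   square root of [D]. *)
exists (e / 2), (D + 1); split; [by rewrite divr_gt0|by rewrite addr_gt0|].
move=> n a; set Q := pr mu _.
pose w k := pr mu [set x : X | `|symwalk L k x| <= e / 2].
have Qw k : (k <= n)%N -> Q ^+ 2 <= w k.
  move=> kn; have w0 : 0 <= w k by exact: pr_ge0.
  rewrite -(sqr_sqrtr w0) ler_sqr ?nnegrE ?pr_ge0 ?sqrtr_ge0//.
  rewrite -[leRHS]mulr1 -(prT mu).
  (* Frozen, the first n - k steps merely translate the interval for the last k. *)
  apply: (pr_splice_le iid (m := (n - k)%N)) => //.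
  - exact: measurable_itvset.
  - move=> x _.
    rewrite -[leLHS]ger0_norm ?pr_ge0// -sqrtr_sqr ler_wsqrtr//.
    rewrite (_ : [set y | _] = [set y : X | a - rwalk L (n - k) x <= rwalk L k y <=
      a - rwalk L (n - k) x + e / 2]).
      exact: interval_sq_le_symwalk.
    apply/seteqP; split => y /=; rewrite rwalk_spliceB ?leq_subr// subKn// => /andP[h1 h2];
      by apply/andP; split; lra.
have : n.+1%:R * Q ^+ 2 <= D * rt2 n.
  have h : n.+1%:R * Q ^+ 2 <= \sum_(k < n.+1) w k.
    rewrite mulr_natl -[X in _ *+ X]card_ord -sumr_const; apply: ler_sum => k _.
    by apply: Qw; rewrite -ltnS.
  apply: (le_trans h).
  have := le_trans (G n.+1) (symwalk_abs iid n cL); rewrite lee_fin.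
  move=> H; rewrite -(ler_pM2l (mulr_gt0 e0 pi0)); apply: (le_trans H).
  rewrite le_eqVlt; apply/orP; left; apply/eqP; rewrite /D.
  by field; rewrite !gt_eqF.
rewrite -rt2K expr2 -mulrA [D * _]mulrC ler_pM2l ?rt2_gt0// -rt4K => h.
rewrite ler_pdivlMr ?rt4_gt0// -ler_sqr ?nnegrE ?mulr_ge0 ?pr_ge0 ?(ltW (rt4_gt0 _))//; last lra.
by rewrite exprMn mulrC (le_trans h)//; nra.
Qed.

Lemma concentration (L : T -> R) : centered mu L -> exists2 C : R, 0 < C &
  forall n (a w : R), 0 <= w ->
    pr mu [set x | a <= rwalk L n x <= a + w] <= C * (1 + w) / rt4 n.
Proof.
move=> cL; have [mL _ _ _ _] := cL.
have [e [C [e0 C0 H]]] := concentration_step cL.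
have HN n a N : pr mu [set x | a <= rwalk L n x <= a + N.+1%:R * e] <= N.+1%:R * (C / rt4 n).
  elim: N => [|N IH]; first by rewrite !mul1r.
  rewrite -(natr1 N.+1) !mulrDl !mul1r.
  apply: le_trans (lerD IH (H n (a + N.+1%:R * e))).
  apply: pr_sub_le; try exact: measurable_itvset.
  move=> x /= /andP[h1 h2]; have [h|h] := lerP (rwalk L n x) (a + N.+1%:R * e).
    by left; rewrite /= h1.
  by right; rewrite /= (ltW h) -addrA.
exists (C * (1 + e^-1)); first by rewrite mulr_gt0// addr_gt0// invr_gt0.
move=> n a w w0; pose N := Num.truncn (w / e).
have we0 : 0 <= w / e by rewrite divr_ge0// ltW.
have /andP[N1 N2] := truncn_itv we0.
apply: (@le_trans _ _ (N.+1%:R * (C / rt4 n))).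
  apply: le_trans (HN n a N); apply: le_pr; try exact: measurable_itvset.
  move=> x /= /andP[-> h] /=; apply: (le_trans h); rewrite lerD2l.
  by rewrite -ler_pdivrMr// ltW.
rewrite mulrA ler_pM2r ?invr_gt0 ?rt4_gt0// mulrC -mulrA ler_pM2l//.
have : 0 < e^-1 by rewrite invr_gt0.
rewrite -natr1; move: N1; rewrite -/N.
by set u := e^-1; nra.
Qed.

(** Climbing from 0 to b alive costs a factor of order (1+b)^(-2). Run 2m steps with m of order
    (1+b)^4: survival has probability of order m^(-1/2), and by concentration a fixed fraction of it
    ends above b. From there the walk survives at least as well as from b, and the product is at
    most p(n). *)
Lemma survival_quadratic (L : T -> R) : centered mu L -> exists2 C : R, 0 < C &
  forall n (b : R), 0 <= b -> survival mu L n b <= C * (1 + b) ^+ 2 * p L n.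
Proof.
move=> cL; have [mL _ _ _ _] := cL.
have [K K0 HK] := concentration cL.
have [c [C [c0 C0 HB]]] := survival_bounds iid cL.
(* Since v <= rt4 m, this makes ending at or below b cost at most half of the lower bound for
   survival; the + 1 gives v >= 1. *)
pose D := 4 * K * C / c + 1.
have D0 : 0 < 4 * K * C / c by rewrite divr_gt0// !mulr_gt0.
exists (8 * D ^+ 2 / c); first by rewrite divr_gt0// mulr_gt0// exprn_gt0// addr_gt0.
move=> n b b0; pose v := D * (1 + b).
have v1 : 1 <= v by rewrite /v /D; nra.
pose m := Num.truncn (v ^+ 4).
have v40 : 0 <= v ^+ 4 by rewrite exprn_ge0//; lra.
have /andP[m1 m2] := truncn_itv v40; rewrite -/m in m1 m2.
have rt4m : v <= rt4 m.
  rewrite -(ler_pXn2r (n := 4))// ?nnegrE ?(ltW (rt4_gt0 _))//; last lra.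
  by rewrite rt4K4 ltW.
have rt2m : rt2 m <= 2 * v ^+ 2.
  have v20 : 0 <= 2 * v ^+ 2 by apply: mulr_ge0; [|exact: sqr_ge0].
  rewrite -ler_sqr ?nnegrE ?(ltW (rt2_gt0 _))//.
  rewrite rt2K -natr1 exprMn -exprM.
  have : 1 <= v ^+ 4 by rewrite exprn_ege1.
  by move: m1; set u := v ^+ (2 * 2); rewrite -/u; lra.
have r20 := rt2_gt0 (R := R) m; have r40 := rt4_gt0 (R := R) m.
(* Two blocks of m steps, so that survival of the first and concentration of the second multiply in
   the bound for [A']. *)
pose A := [set x : X | stay L (m + m) 0 x /\ b < rwalk L (m + m) x].
pose A' := [set x : X | stay L (m + m) 0 x /\ rwalk L (m + m) x <= b].
have mA : measurable A.
  apply: measurableI; first exact: measurable_stay.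
  by apply: measurable_ltset => //; exact: measurable_rwalk.
have mA' : measurable A'.
  apply: measurableI; first exact: measurable_stay.
  by apply: measurable_leset => //; exact: measurable_rwalk.
have prA' : pr mu A' <= K * (1 + b) / rt4 m * (C / rt2 m).
  have [_ pm _] := HB m.
  apply: (@le_trans _ _ (K * (1 + b) / rt4 m * p L m)); last first.
    by rewrite ler_wpM2l// divr_ge0 ?(ltW r40)// mulr_ge0 ?(ltW K0)//; lra.
  apply: (pr_splice_le iid (m := m)) => //.
  - exact: measurable_stay.
  - by move=> x y [/stay_splice[]].
  - move=> x hx; apply: le_trans (HK m (- rwalk L m x) b b0).
    apply: le_pr; [exact: measurable_splice_section|exact: measurable_itvset|].
    move=> y [/stay_wstay /(_ _ (leqnn _))]; rewrite rwalk_spliceD => h1 h2 /=.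
    by apply/andP; split; lra.
  - by rewrite divr_ge0 ?(ltW r40)// mulr_ge0 ?(ltW K0)//; lra.
have prA : c / (4 * rt2 m) <= pr mu A.
  have [pm _ _] := HB (m + m)%N.
  have h : p L (m + m) <= pr mu A + pr mu A'.
    apply: pr_sub_le => //; first exact: measurable_stay.
    by move=> x hx; have [h|h] := lerP (rwalk L (m + m) x) b; [right|left].
  have h1 : c / (2 * rt2 m) <= c / rt2 (m + m).
    rewrite ler_pM2l// lef_pV2 ?posrE ?mulr_gt0 ?rt2_gt0//.
    rewrite -ler_sqr ?nnegrE ?mulr_ge0 ?(ltW (rt2_gt0 _))// exprMn !rt2K.
    by rewrite -!natr1 natrD; have : 0 <= m%:R :> R by []; lra.
  have h2 : K * (1 + b) / rt4 m * (C / rt2 m) <= c / (4 * rt2 m).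
    rewrite invfM !mulrA ler_pM2r ?invr_gt0// mulrAC ler_pdivrMr//.
    rewrite [leRHS]mulrC mulrA ler_pdivlMr// (le_trans _ (ler_wpM2r (ltW c0) rt4m))//.
    have -> : v * c = 4 * K * C * (1 + b) + c * (1 + b).
      by rewrite /v /D; field; rewrite gt_eqF.
    have : 0 <= c * (1 + b) by rewrite mulr_ge0 ?(ltW c0)//; lra.
    have -> : K * (1 + b) * C * 4 = 4 * K * C * (1 + b) by ring.
    by lra.
  have h3 : c / (2 * rt2 m) = 2 * (c / (4 * rt2 m)) by field; rewrite gt_eqF.
  by lra.
have : pr mu A * survival mu L n b <= p L n.
  apply: (@le_trans _ _ (p L (m + m + n))); last first.
    by apply: le_survival => //; exact: leq_addl.
  rewrite mulrC; apply: (pr_splice_ge iid (m := (m + m)%N)) => //.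
  - exact: measurable_stay.
  - move=> x [hx bx]; apply: le_pr; first exact: measurable_stay.
      by apply: measurable_splice_section; exact: measurable_stay.
    move=> y hy; apply/stay_splice; split => //.
    by apply: stay_le hy => //; rewrite add0r ltW.
  - exact: survival_ge0.
move=> h; have h' : c / (4 * rt2 m) * survival mu L n b <= p L n.
  by apply: le_trans h; rewrite ler_wpM2r// survival_ge0.
have : survival mu L n b <= p L n * (4 * rt2 m / c).
  rewrite -ler_pdivrMr ?divr_gt0 ?mulr_gt0// invf_div mulrC//.
move/le_trans; apply; rewrite mulrC ler_wpM2r ?survival_ge0//.
rewrite [leRHS]mulrAC ler_pM2r ?invr_gt0//.
by move: rt2m; rewrite /v exprMn; lra.
Qed.

(** Cut the path into thirds. Staying nonnegative on the first costs n^(-1/2); the last third,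
    reversed, is a walk with steps -L staying positive from v and costs (1+v)^2 n^(-1/2); meeting
    the unit window through the middle costs n^(-1/4). *)
Lemma local_bound (L : T -> R) : centered mu L -> exists2 C : R, 0 < C &
  forall n (v : R), 0 <= v ->
    pr mu [set x | wstay L n x /\ v - 1 <= rwalk L n x < v] <=
    C * (1 + v) ^+ 2 / (n.+1%:R * rt4 n).
Proof.
move=> cL; have [mL _ _ _ _] := cL; have cN := centeredN cL; have [mN _ _ _ _] := cN.
have [K K0 HK] := concentration cL.
have [cc [C [_ C0 HB]]] := survival_bounds iid cL.
have [cc' [C' [_ C'0 HB']]] := survival_bounds iid cN.
have [E E0 HE] := survival_quadratic cN.
have [e e0 pe] := exists_step cL.
set g := pr mu _ in pe.
(* The last m of N steps are reversed; the window is then paid for by the other N - m. *)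
have H1 m N v a : (m <= N)%N -> 0 <= v ->
    pr mu [set y | (forall k, (k <= m)%N -> rwalk L N y - rwalk L (N - k) y < v) /\
       a <= rwalk L N y <= a + 1] <= K * 2 / rt4 (N - m) * survival mu (\- L) m v.
  move=> mN' v0.
  pose A := [set y : X | stay (\- L) m v y /\ a <= rwalk L N y <= a + 1].
  have mA : measurable A.
    by apply: measurableI; [exact: measurable_stay|exact: measurable_itvset].
  apply: (@le_trans _ _ (pr mu A)).
    rewrite -(pr_reindex iid (@rev_inj N) mA); apply: le_pr.
    - apply: measurableI; last exact: measurable_itvset.
      apply: measurable_forall_nat => k _; apply: measurable_ltset => //.
      by apply: measurable_funB; exact: measurable_rwalk.
    - by have := measurable_reindex (rev N) measurableT mA; rewrite setTI.
    - move=> y [h1 h2]; split; last by rewrite rwalk_rev_full.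
      move=> k /andP[k0 km]; rewrite rwalkN rwalk_rev; last exact: leq_trans mN'.
      by rewrite subr_gt0; exact: h1.
  apply: (pr_splice_le iid (m := m)) => //.
  - exact: measurable_stay.
  - move=> x y [h _] k km; have := h k km; rewrite !rwalkN rwalk_splice//.
    by case/andP: km.
  - move=> x _; apply: le_trans (HK (N - m)%N (a - rwalk L m x) 1 ler01).
    apply: le_pr; [exact: measurable_splice_section|exact: measurable_itvset|].
    move=> y [_] /=; rewrite rwalk_spliceB// => /andP[h1 h2]; apply/andP; split; lra.
  - by rewrite divr_ge0 ?(ltW (rt4_gt0 _))// mulr_ge0// ltW.
(* The 9 absorbs n+1 <= 3(m+1) and rt4 n <= 3 rt4 m; the 2 is 1 + w for a window of width 1;
   dividing by g passes from weak to strict positivity. *)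
pose F := 9 * (C / g) * (K * 2) * (E * C').
have F0 : 0 < F by rewrite !mulr_gt0// invr_gt0.
exists F => //.
move=> n v v0.
have [m [mn mn3 mlen n3N]] : exists m, [/\ m <= n - m, m <= n - m - m, m <= n &
    n.+1 <= 3 * m.+1]%N.
  by clear; exists (n %/ 3)%N; split; lia.
have r2 := rt2_gt0 (R := R) m; have r4 := rt4_gt0 (R := R) m.
have S : survival mu (\- L) m v <= E * (1 + v) ^+ 2 * (C' / rt2 m).
  apply: (le_trans (HE m v v0)); have [_ h _] := HB' m.
  by rewrite ler_wpM2l// mulr_ge0 ?sqr_ge0// ltW.
have W : pr mu (wstay L m) <= C / g / rt2 m.
  rewrite mulrAC ler_pdivlMr//; apply: (le_trans (wstay_le_survival iid m mL e0)).
  have [_ h _] := HB m.+1; apply: (le_trans h).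
  by rewrite ler_pM2l// lef_pV2 ?posrE ?rt2_gt0// le_rt2.
have mW : measurable [set x : X | wstay L n x /\ v - 1 <= rwalk L n x < v].
  apply: measurableI; first exact: measurable_wstay.
  exact: measurable_itvoset.
have c0 : 0 <= K * 2 / rt4 m * (E * (1 + v) ^+ 2 * (C' / rt2 m)).
  by rewrite !mulr_ge0 ?invr_ge0 ?addr_ge0 ?(ltW K0) ?(ltW E0) ?(ltW C'0)
    ?(ltW r2) ?(ltW r4).
have M : pr mu [set x | wstay L n x /\ v - 1 <= rwalk L n x < v] <=
    K * 2 / rt4 m * (E * (1 + v) ^+ 2 * (C' / rt2 m)) * pr mu (wstay L m).
  apply: (pr_splice_le iid (m := m)) => //.
  - exact: measurable_wstay.
  - move=> x y [h _] k km; have := h k; rewrite rwalk_splice//; apply.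
    exact: leq_trans km mlen.
  - move=> x hx.
    apply: (@le_trans _ _ (K * 2 / rt4 (n - m - m) * survival mu (\- L) m v)).
      apply: le_trans (H1 m (n - m)%N v (v - 1 - rwalk L m x) mn v0).
      apply: le_pr; first exact: measurable_splice_section.
        apply: measurableI; last exact: measurable_itvset.
        apply: measurable_forall_nat => k _; apply: measurable_ltset => //.
        by apply: measurable_funB; exact: measurable_rwalk.
      move=> y [h /andP[h1 h2]]; rewrite rwalk_spliceB// in h1 h2; split.
        move=> k km; have := h (n - k)%N (leq_subr _ _).
        rewrite rwalk_spliceB; last by move: km mn; clear; lia.
        have -> : (n - k - m = n - m - k)%N by rewrite subnAC.
        by lra.
      by apply/andP; split; lra.
    apply: ler_pM => //.
    - by rewrite divr_ge0 ?(ltW (rt4_gt0 _))// mulr_ge0// ltW.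
    - exact: survival_ge0.
    - by rewrite ler_pM2l ?mulr_gt0// lef_pV2 ?posrE ?rt4_gt0// le_rt4.
apply: (le_trans M); apply: (le_trans (ler_wpM2l c0 W)).
have n3 : n.+1%:R <= 3 * m.+1%:R :> R by rewrite -natrM ler_nat.
have r43 : rt4 n <= 3 * rt4 m :> R by exact: rt4_le3.
have -> : K * 2 / rt4 m * (E * (1 + v) ^+ 2 * (C' / rt2 m)) * (C / g / rt2 m) =
    F * (1 + v) ^+ 2 / (3 * m.+1%:R * (3 * rt4 m)).
  by rewrite -(rt2K m) /F; field; rewrite !gt_eqF.
apply: ler_wpM2l; first by rewrite (mulr_ge0 (ltW F0))// sqr_ge0.
rewrite lef_pV2 ?posrE ?mulr_gt0 ?rt4_gt0//.
by rewrite ler_pM// ltW// rt4_gt0.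
Qed.

End LocalBounds.

(** * Exponential weights along surviving walks *)

Section Convolution.
Context {R : realType}.
Implicit Types (b p : nat -> R).

(* Telescoping: with a = rt4 k and a' = rt4 k.+1, a'^4 - a^4 = 1 gives
   1/a - 1/a' >= 1/(32 a^5). *)
Lemma rt4_telescope k : (k.+1%:R * rt4 k)^-1 <= 32 * ((rt4 k)^-1 - (rt4 k.+1)^-1) :> R.
Proof.
have a1 := rt4_ge1 (R := R) k; have b1 := rt4_ge1 (R := R) k.+1.
have ab := le_rt4 (R := R) (leqnSn k).
have := rt4K4 (R := R) k.+1; rewrite -natr1 -(rt4K4 k).
move: (rt4 k) (rt4 k.+1) a1 b1 ab => a b a1 b1 ab ba.
have a0 : 0 < a by lra.
have b0 : 0 < b by lra.
pose s := b ^+ 3 + b ^+ 2 * a + b * a ^+ 2 + a ^+ 3.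
have s0 : 0 < s by rewrite !addr_gt0 ?mulr_gt0 ?exprn_gt0.
have sE : (b - a) * s = 1.
  by transitivity (b ^+ 4 - a ^+ 4); [rewrite /s; ring|rewrite ba; ring].
have b2a : b <= 2 * a.
  rewrite -(ler_pXn2r (n := 4))// ?nnegrE; [|lra|lra].
  rewrite ba exprMn; have : 1 <= a ^+ 4 by rewrite exprn_ege1.
  by rewrite (_ : 2 ^+ 4 = 16 :> R) -?natrX//; lra.
have s15 : s <= 15 * a ^+ 3.
  have h2 : b ^+ 2 <= 4 * a ^+ 2.
    by rewrite (_ : 4 * a ^+ 2 = (2 * a) ^+ 2); [rewrite ler_sqr ?nnegrE; lra|ring].
  have h3 : b ^+ 3 <= 8 * a ^+ 3.
    by rewrite (_ : 8 * a ^+ 3 = (2 * a) ^+ 3); [rewrite ler_pXn2r ?nnegrE//; lra|ring].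
  have h4 : b ^+ 2 * a <= 4 * a ^+ 3.
    by rewrite (_ : 4 * a ^+ 3 = 4 * a ^+ 2 * a); [rewrite ler_pM2r|ring].
  have h5 : b * a ^+ 2 <= 2 * a ^+ 3.
    by rewrite (_ : 2 * a ^+ 3 = 2 * a * a ^+ 2); [rewrite ler_pM2r ?exprn_gt0|ring].
  by rewrite /s; lra.
have key : b <= 32 * a ^+ 4 * (b - a).
  rewrite -(ler_pM2r s0) -[leRHS](mulrA _ (b - a) s) sE mulr1.
  apply: (@le_trans _ _ (2 * a * (15 * a ^+ 3))); first by apply: ler_pM => //; lra.
  rewrite (_ : 2 * a * (15 * a ^+ 3) = 30 * a ^+ 4); last by ring.
  by have : 0 <= a ^+ 4; [rewrite exprn_ge0//; lra|lra].
have -> : 32 * (a^-1 - b^-1) = 32 * a ^+ 4 * (b - a) / (a ^+ 4 * a * b).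
  by field; rewrite !gt_eqF.
have -> : (a ^+ 4 * a)^-1 = b / (a ^+ 4 * a * b) by field; rewrite !gt_eqF.
by rewrite ler_pM2r// invr_gt0 !mulr_gt0// exprn_gt0.
Qed.

Lemma sum_rt4V m n : \sum_(m <= k < n) (k.+1%:R * rt4 k)^-1 <= 32 / rt4 m :> R.
Proof.
have [nm|mn] := leqP n m.
  by rewrite big_geq// divr_ge0// ltW// rt4_gt0.
suff : \sum_(m <= k < n) (k.+1%:R * rt4 k)^-1 <= 32 * ((rt4 m)^-1 - (rt4 n)^-1) :> R.
  move/le_trans; apply; rewrite ler_pM2l// lerBlDr lerDl invr_ge0.
  by rewrite ltW// rt4_gt0.
elim: n mn => // n IH; rewrite ltnS leq_eqVlt => /orP[/eqP ->|mn].
  by rewrite big_nat1; exact: rt4_telescope.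
rewrite big_nat_recr /=; last exact: ltnW.
apply: (le_trans (lerD (IH mn) (rt4_telescope n))).
by rewrite -mulrDr addrA subrK.
Qed.

(** Split at 2k = n. For small k, p(n-k) is at most a constant times p(n) and the tail of b yields
    1/rt4 m; for large k, b k is at most of order 1/(n rt4 m) and the sum of p is of order sqrt n,
    that is n p(n). The first range contributes 64 = 2 * 32, the second 2. *)
Lemma conv_bound b p (B c C : R) : 0 < B -> 0 < c -> 0 < C ->
  (forall k, 0 <= b k) -> (forall k, 0 <= p k) ->
  (forall k, b k <= B / (k.+1%:R * rt4 k)) ->
  (forall k, c / rt2 k <= p k) -> (forall k, p k <= C / rt2 k) ->
  (forall k, \sum_(j < k.+1) p j <= C * rt2 k) ->
  forall m n, \sum_(m <= k < n.+1) b k * p (n - k)%N <= 66 * B * C / c / rt4 m * p n.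
Proof.
move=> B0 c0 C0 b0 p0 bB pc pC pA m n.
have r2 := rt2_gt0 (R := R) n; have r4 := rt4_gt0 (R := R) m.
have pV : (rt2 n)^-1 <= p n / c.
  by rewrite ler_pdivlMr// mulrC; exact: pc.
apply: (@le_trans _ _ (\sum_(m <= k < n.+1)
   ((2 * C / c * p n * B) * (k.+1%:R * rt4 k)^-1 + 2 * B / (n.+1%:R * rt4 m) * p (n - k)%N))).
  rewrite big_nat [leRHS]big_nat; apply: ler_sum => k /andP[mk kn].
  have t1 : 0 <= (2 * C / c * p n * B) * (k.+1%:R * rt4 k)^-1.
    by rewrite !mulr_ge0 ?invr_ge0 ?mulr_ge0 ?p0 ?(ltW B0) ?(ltW C0) ?(ltW c0)// ltW// rt4_gt0.
  have t2 : 0 <= 2 * B / (n.+1%:R * rt4 m) * p (n - k)%N.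
    by rewrite !mulr_ge0 ?invr_ge0 ?mulr_ge0 ?p0 ?(ltW B0)// ltW.
  have [k2|k2] := leqP (k + k) n.
    apply: (ler_wpDr t2).
    have h : p (n - k)%N <= 2 * C / c * p n.
      apply: (le_trans (pC _)).
      apply: (@le_trans _ _ (2 * C / rt2 n)).
        rewrite ler_pdivrMr ?rt2_gt0// [leRHS]mulrAC ler_pdivlMr//.
        rewrite [2 * C]mulrC -[leRHS]mulrA ler_pM2l//.
        rewrite -ler_sqr ?nnegrE ?mulr_ge0 ?(ltW (rt2_gt0 _))// exprMn !rt2K.
        rewrite -natrX -natrM ler_nat; lia.
      rewrite -[leRHS]mulrA ler_pM2l ?mulr_gt0// mulrC; exact: pV.
    rewrite [leRHS]mulrC mulrA [in leRHS]mulrC.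
    apply: (@le_trans _ _ (B / (k.+1%:R * rt4 k) * (2 * C / c * p n))).
      exact: ler_pM.
    by rewrite le_eqVlt; apply/orP; left; apply/eqP; ring.
  apply: (ler_wpDl t1).
  rewrite ler_wpM2r//; apply: (le_trans (bB k)).
  rewrite ler_pdivrMr ?mulr_gt0 ?rt4_gt0// [leRHS]mulrAC ler_pdivlMr ?mulr_gt0//.
  rewrite [2 * B]mulrC -[leRHS]mulrA ler_pM2l// mulrA ler_pM ?(ltW r4)//.
    by rewrite -natrM ler_nat; lia.
  exact: le_rt4.
rewrite big_split /= -!mulr_sumr.
have S1 := sum_rt4V m n.+1.
have S2 : \sum_(m <= k < n.+1) p (n - k)%N <= C * rt2 n.
  apply: le_trans (pA n); rewrite -(big_mkord xpredT p) [leRHS]big_nat_rev /= add0n.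
  have [nm|mn] := leqP n.+1 m.
    by rewrite big_geq// sumr_ge0.
  rewrite [leRHS](big_cat_nat _ (n := m))//=; last exact: ltnW.
  by rewrite -[leLHS]add0r lerD ?sumr_ge0//.
apply: (@le_trans _ _ (2 * C / c * p n * B * (32 / rt4 m) +
   2 * B / (n.+1%:R * rt4 m) * (C * rt2 n))).
  apply: lerD; apply: ler_wpM2l => //.
    by rewrite !mulr_ge0 ?invr_ge0 ?p0 ?(ltW B0) ?(ltW C0) ?(ltW c0).
  by rewrite !mulr_ge0 ?invr_ge0 ?mulr_ge0 ?(ltW B0)// ltW.
have -> : 2 * B / (n.+1%:R * rt4 m) * (C * rt2 n) = 2 * B * C / rt4 m * (rt2 n)^-1.
  by rewrite -(rt2K n); field; rewrite !gt_eqF.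
have -> : 66 * B * C / c / rt4 m * p n =
   2 * C / c * p n * B * (32 / rt4 m) + 2 * B * C / rt4 m * (p n / c).
  by field; rewrite !gt_eqF.
rewrite lerD2l; apply: ler_wpM2l => //.
by rewrite !mulr_ge0 ?invr_ge0 ?(ltW B0) ?(ltW C0)// ltW.
Qed.

End Convolution.

Section Kernel.
Context {d} {T : measurableType d} {R : realType}.
Local Notation X := (@seqspace d T).
Variable mu : probability X R.
Hypothesis iid : iid_law mu.

Local Notation p L n := (survival mu L n 0).

(** The power 4 is summable over unit windows against the factor (1+v)^2 of [local_bound], while on
    t >= 0 the weight still dominates (1+t)^2 exp(-t) up to a constant. *)
Definition wt (t : R) : R := ((1 + Num.max 0 t) ^+ 4)^-1.

Lemma wt_max_gt0 (t : R) : 0 < 1 + Num.max 0 t.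
Proof. by rewrite ltr_pwDl// le_max lexx. Qed.

Lemma wt_gt0 t : 0 < wt t.
Proof. by rewrite invr_gt0 exprn_gt0// wt_max_gt0. Qed.

Lemma wt_anti s t : s <= t -> wt t <= wt s.
Proof.
move=> st; rewrite lef_pV2 ?posrE ?exprn_gt0 ?wt_max_gt0//.
rewrite ler_pXn2r// ?nnegrE ?(ltW (wt_max_gt0 _))// lerD2l.
by rewrite ge_max le_max lexx/= le_max st orbT.
Qed.

Lemma wt_le1 t : wt t <= 1.
Proof. by rewrite invf_le1 ?exprn_gt0 ?wt_max_gt0// exprn_ege1// lerDl le_max lexx. Qed.

Lemma wtE t : 0 <= t -> wt t = ((1 + t) ^+ 4)^-1.
Proof. by move=> t0; rewrite /wt (max_idPr t0). Qed.

Lemma measurable_wt : measurable_fun setT wt.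
Proof. by apply: nonincreasing_measurable => // s t; exact: wt_anti. Qed.

Definition kern_fun (L : T -> R) n (x : X) : R :=
  \1_(wstay L n) x * wt (rwalk L n x).

Definition kern (L : T -> R) n : R := \int[mu]_x kern_fun L n x.

Lemma kern_fun_ge0 L n x : 0 <= kern_fun L n x.
Proof. by rewrite mulr_ge0// ltW// wt_gt0. Qed.

Lemma rintegrable_kern_fun (L : T -> R) n : measurable_fun setT L ->
  rintegrable mu (kern_fun L n).
Proof.
move=> mL; have mf : measurable_fun setT (kern_fun L n).
  apply: measurable_funM; first by apply: measurable_indic; exact: measurable_wstay.
  by apply: measurableT_comp; [exact: measurable_wt|exact: measurable_rwalk].
apply: le_rintegrable (rintegrable_cst mu 1) => // x.
rewrite normr1 ger0_norm ?kern_fun_ge0// /kern_fun indicE.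
by case: (_ \in _); rewrite ?mul1r ?mul0r ?wt_le1.
Qed.

Lemma kern_ge0 (L : T -> R) n : 0 <= kern L n.
Proof. by apply: Rintegral_ge0 => x _; exact: kern_fun_ge0. Qed.

(** Slice by unit windows: window j contributes (2+j)^2/(1+j)^4 <= 9/(1+j)^2, and these sum to at
    most 18. Above level n + 1 the weight alone is small enough, which keeps the sum finite and
    accounts for the + 1. *)
Lemma kern_bound (L : T -> R) : centered mu L -> exists2 C : R, 0 < C &
  forall n, kern L n <= C / (n.+1%:R * rt4 n).
Proof.
move=> cL; have [mL _ _ _ _] := cL.
have [C C0 HC] := local_bound iid cL.
exists (18 * C + 1); first by rewrite addr_gt0// mulr_gt0.
move=> n; set w := n.+1%:R * rt4 n.
have r4 := rt4_gt0 (R := R) n; have w0 : 0 < w by rewrite mulr_gt0.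
pose J j := [set x : X | wstay L n x /\ j.+1%:R - 1 <= rwalk L n x < j.+1%:R].
have mJ j : measurable (J j).
  by apply: measurableI; [exact: measurable_wstay|exact: measurable_itvoset].
pose N := n.+1.
have iJ j : rintegrable mu (fun x => ((1 + j%:R) ^+ 4)^-1 * \1_(J j) x : R).
  by apply: rintegrableZ; exact: rintegrable_indic.
have iS N' : rintegrable mu (fun x => \sum_(j < N') ((1 + j%:R) ^+ 4)^-1 * \1_(J j) x : R).
  elim: N' => [|N' IH].
    by under eq_fun do rewrite big_ord0; exact: rintegrable_cst.
  by under eq_fun do rewrite big_ord_recr /=; exact: rintegrableD.
have ES N' : \int[mu]_x (\sum_(j < N') ((1 + j%:R) ^+ 4)^-1 * \1_(J j) x : R) =
    \sum_(j < N') ((1 + j%:R) ^+ 4)^-1 * pr mu (J j).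
  elim: N' => [|N' IH].
    by under eq_Rintegral do rewrite big_ord0; rewrite big_ord0 Rintegral_cstT.
  under eq_Rintegral do rewrite big_ord_recr /=.
  rewrite big_ord_recr /= -IH (RintegralD measurableT (iS N') (iJ N')); congr (_ + _).
  by rewrite (RintegralZT _ (rintegrable_indic mu (mJ N'))) Rintegral_indicT.
apply: (@le_trans _ _ (\int[mu]_x (((1 + N%:R) ^+ 4)^-1 +
   \sum_(j < N) ((1 + j%:R) ^+ 4)^-1 * \1_(J j) x))).
  apply: le_Rintegral => //; first exact: rintegrable_kern_fun.
    by apply: rintegrableD => //; exact: rintegrable_cst.
  move=> x _; rewrite /kern_fun [X in X * _]indicE.
  have S0 : 0 <= \sum_(j < N) ((1 + j%:R) ^+ 4)^-1 * \1_(J j) x :> R.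
    by apply: sumr_ge0 => j _; rewrite mulr_ge0// invr_ge0 exprn_ge0// addr_ge0.
  have V0 m : 0 <= ((1 + m%:R) ^+ 4)^-1 :> R by rewrite invr_ge0 exprn_ge0// addr_ge0.
  have [/set_mem h|_] := boolP (_ \in _); last by rewrite mul0r addr_ge0.
  have s0 : 0 <= rwalk L n x := h n (leqnn n).
  have /andP[t1 t2] := truncn_itv s0; set j := Num.truncn _ in t1 t2.
  have wj : wt (rwalk L n x) <= ((1 + j%:R) ^+ 4)^-1.
    by rewrite -wtE//; exact: wt_anti.
  rewrite mul1r; have [jN|Nj] := ltnP j N.
    apply: (le_trans wj); rewrite (bigD1 (Ordinal jN))//= [X in _ * X]indicE mem_set ?mulr1.
      rewrite addrCA lerDl; apply: addr_ge0 => //; apply: sumr_ge0 => i _.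
      by apply: mulr_ge0.
    by split => //; rewrite -natr1 addrK t1 natr1.
  apply: (@le_trans _ _ ((1 + N%:R) ^+ 4)^-1); last by rewrite lerDl.
  rewrite -wtE//; apply: wt_anti; apply: le_trans t1; by rewrite ler_nat.
rewrite (RintegralD measurableT (rintegrable_cst mu _) (iS N)).
rewrite Rintegral_cstT ES.
have sumV m : \sum_(j < m.+1) ((j.+1%:R) ^+ 2)^-1 <= 2 - (m.+1%:R)^-1 :> R.
  elim: m => [|m IH]; first by rewrite big_ord1 expr1n invr1; lra.
  rewrite big_ord_recr /=; apply: (le_trans (lerD IH (lexx _))).
  set a : R := m.+1%:R; have a0 : 0 < a by rewrite ltr0n.
  have -> : m.+2%:R = a + 1 :> R by rewrite -natr1.
  rewrite -subr_ge0 (_ : _ - _ = (a * (a + 1) ^+ 2)^-1); last by field; rewrite !gt_eqF//; lra.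
  by rewrite invr_ge0 mulr_ge0 ?sqr_ge0// ltW.
rewrite mulrDl mul1r addrC; apply: lerD.
  apply: (@le_trans _ _ (\sum_(j < N) 9 * C / w * ((j.+1%:R) ^+ 2)^-1)).
    apply: ler_sum => j _; set a : R := j%:R; have a0 : 0 <= a by [].
    have -> : (nat_of_ord j).+1%:R = 1 + a by rewrite -natr1 addrC.
    apply: (@le_trans _ _ (((1 + a) ^+ 4)^-1 * (C * (2 + a) ^+ 2 / w))).
      rewrite ler_wpM2l ?invr_ge0 ?exprn_ge0 ?addr_ge0//.
      have := HC n (j.+1)%:R (ler0n _ _); rewrite -/w /J.
      by rewrite (_ : 1 + j.+1%:R = 2 + a)// -natr1 /a; ring.
    have -> : 9 * C / w * ((1 + a) ^+ 2)^-1 = ((1 + a) ^+ 4)^-1 * (C * (9 * (1 + a) ^+ 2) / w).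
      by field; rewrite !gt_eqF//; lra.
    rewrite ler_wpM2l ?invr_ge0 ?exprn_ge0 ?addr_ge0//.
    rewrite ler_pM2r ?invr_gt0// ler_pM2l//.
    by nra.
  rewrite -mulr_sumr; apply: (@le_trans _ _ (9 * C / w * 2)).
    rewrite ler_pM2l; first by apply: le_trans (sumV n) _; rewrite gerBl invr_ge0.
    by rewrite divr_gt0// mulr_gt0.
  by rewrite le_eqVlt; apply/orP; left; apply/eqP; ring.
rewrite lef_pV2 ?posrE ?exprn_gt0//.
apply: (@le_trans _ _ (n.+1%:R ^+ 2)).
  rewrite /w expr2 ler_pM2l//.
  have := rt4K4 (R := R) n; have := rt4_ge1 (R := R) n => h1 <-.
  by rewrite exprS ler_peMr ?exprn_ege1// (ltW r4).
rewrite -/N (_ : 4 = 2 * 2)%N// exprM.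
have N1 : 1 <= N%:R :> R by rewrite ler1n.
have h : N%:R <= (1 + N%:R) ^+ 2 :> R by nra.
by rewrite ler_sqr ?nnegrE ?sqr_ge0.
Qed.

Lemma survival_gt0 (L : T -> R) n : centered mu L -> 0 < p L n.
Proof.
move=> cL; have [c [C [c0 _ H]]] := survival_bounds iid cL.
by have [h _ _] := H n; apply: lt_le_trans h; rewrite divr_gt0// rt2_gt0.
Qed.

Lemma kern_conv_bound (L L' : T -> R) : centered mu L -> centered mu L' ->
  exists2 D : R, 0 < D & forall m n,
    \sum_(m <= k < n.+1) kern L k * p L' (n - k)%N <= D / rt4 m * p L' n.
Proof.
move=> cL cL'; have [B B0 HB] := kern_bound cL.
have [c [C [c0 C0 H]]] := survival_bounds iid cL'.
exists (66 * B * C / c); first by rewrite divr_gt0 ?mulr_gt0.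
move=> m n; apply: (conv_bound (b := kern L) (p := fun k => p L' k)) => // k.
- exact: kern_ge0.
- exact: survival_ge0.
- by case: (H k).
- by case: (H k).
- by case: (H k).
Qed.

(** Markov inequality: on this event the weight is at least (1+b)^(-4). *)
Lemma stay_below_le_kern (L : T -> R) n (b : R) : measurable_fun setT L -> 0 <= b ->
  pr mu [set x | wstay L n x /\ rwalk L n x <= b] <= (1 + b) ^+ 4 * kern L n.
Proof.
move=> mL b0.
have mA : measurable [set x : X | wstay L n x /\ rwalk L n x <= b].
  apply: measurableI; first exact: measurable_wstay.
  by apply: measurable_leset => //; exact: measurable_rwalk.
rewrite -(Rintegral_indicT mu mA) /kern -(RintegralZT _ (rintegrable_kern_fun n mL)).
apply: le_Rintegral => //; first exact: rintegrable_indic.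
  by apply: rintegrableZ; exact: rintegrable_kern_fun.
move=> x _; rewrite indicE; have [/set_mem[h1 h2]|_] := boolP (_ \in _); last first.
  by rewrite mulr_ge0 ?kern_fun_ge0// exprn_ge0// addr_ge0.
rewrite /kern_fun indicE mem_set// mul1r.
apply: (@le_trans _ _ ((1 + b) ^+ 4 * wt b)).
  by rewrite wtE// mulfV// gt_eqF// exprn_gt0//; lra.
by rewrite ler_wpM2l ?exprn_ge0 ?addr_ge0//; exact: wt_anti.
Qed.

Lemma rt4_large (M : R) : exists N, forall n, (N <= n)%N -> M <= rt4 n.
Proof.
pose M' := Num.max M 0; have M'0 : 0 <= M' by rewrite le_max lexx orbT.
exists (Num.truncn (M' ^+ 4)) => n nN.
apply: (@le_trans _ _ M'); first by rewrite le_max lexx.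
rewrite -(ler_pXn2r (n := 4))// ?nnegrE// ?(ltW (rt4_gt0 _))// rt4K4.
have /andP[_ /ltW h] := truncn_itv (exprn_ge0 4 M'0).
by apply: (le_trans h); rewrite ler_nat.
Qed.

Lemma tail_chebyshev (L : T -> R) (K : R) : centered mu L -> 0 < K ->
  pr mu [set x | L (x 0%N) <= - K] <= step_var mu L / K ^+ 2.
Proof.
move=> cL K0; have [mL _ i2 _ _] := cL.
have mA : measurable [set x : X | L (x 0%N) <= - K].
  apply: measurable_leset => //.
  by apply: measurableT_comp => //; exact: measurable_coord.
rewrite mulrC -(RintegralZT _ i2) -(Rintegral_indicT mu mA).
apply: le_Rintegral => //; first exact: rintegrable_indic.
  exact: rintegrableZ.
move=> x _; rewrite indicE; have [/set_mem h|_] := boolP (_ \in _); last first.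
  by rewrite mulr_ge0 ?sqr_ge0// invr_ge0 sqr_ge0.
rewrite mulrC ler_pdivlMr ?exprn_gt0// mul1r.
by rewrite -[leRHS]sqrrN ler_sqr ?nnegrE; rewrite /= in h; lra.
Qed.

(* Given survival up to time n, the walk is unlikely to be below a fixed level
   at time n, hence unlikely to die at the next step. *)
Lemma survival_ratio1 (L : T -> R) : centered mu L ->
  p L n / p L n.+1 @[n --> \oo] --> (1 : R).
Proof.
move=> cL; have [mL _ _ _ v0] := cL.
have [B B0 HB] := kern_bound cL.
have [c [C [c0 C0 H]]] := survival_bounds iid cL.
have step (e : R) : 0 < e -> \forall n \near \oo, p L n - p L n.+1 <= e * p L n.
  (* By Chebyshev a step below -K then has probability at most e/2. *)
  move=> e0; pose K := 1 + 2 * step_var mu L / e.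
  have s0 : 0 < 2 * step_var mu L / e by rewrite divr_gt0// mulr_gt0.
  have K1 : 1 <= K by rewrite /K; lra.
  have K0 : 0 < K by lra.
  have [N HN] := rt4_large (2 * (1 + K) ^+ 4 * B / c / e).
  near=> n.
  have nN : (N <= n)%N by near: n; exact: nbhs_infty_ge.
  have r4 := rt4_gt0 (R := R) n.
  pose A := [set x : X | wstay L n x /\ rwalk L n x <= K].
  pose D := [set x : X | stay L n 0 x /\ L (x n) <= - K].
  have mc k : measurable_fun setT (fun x : X => L (x k)).
    by apply: measurableT_comp => //; exact: measurable_coord.
  have mA : measurable A.
    apply: measurableI; first exact: measurable_wstay.
    by apply: measurable_leset => //; exact: measurable_rwalk.
  have mD : measurable D.
    by apply: measurableI; [exact: measurable_stay|exact: measurable_leset].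
  have prD : pr mu D = p L n * pr mu [set x | L (x 0%N) <= - K].
    apply: (pr_splice_eq iid (m := n)) => //.
    - exact: measurable_stay.
    - exact: measurable_leset.
    - move=> x y; have spl : splice n (x, y) n = y 0%N by rewrite /splice ltnn subnn.
      rewrite /D /= spl; split => -[h1 h2]; split => //.
      + by move=> k kn; have := h1 k kn; rewrite rwalk_splice//; case/andP: kn.
      + by move=> k kn; rewrite rwalk_splice//; [exact: h1|case/andP: kn].
  (* Death at step n + 1 needs S_n <= K or a last step <= -K; [kern] controls the first event, and
     in the second the step is independent of survival up to n. *)
  have sub : p L n <= p L n.+1 + (pr mu A + pr mu D).
    apply: (@le_trans _ _ (p L n.+1 + pr mu (A `|` D))); last first.
      by rewrite lerD2l; exact: prU_le.
    apply: pr_sub_le; [exact: measurable_stay|exact: measurable_stay|exact: measurableU|].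
    move=> x hx; have [h|h] := lerP (rwalk L n x) K; first by right; left; split => //; exact: stay_wstay.
    have [h'|h'] := lerP (L (x n)) (- K); first by right; right.
    left => k /andP[k0]; rewrite leq_eqVlt => /orP[/eqP ->|]; first by rewrite rwalkS; lra.
    by rewrite ltnS => kn; apply: hx; rewrite k0.
  have bD : pr mu D <= e / 2 * p L n.
    rewrite prD mulrC ler_wpM2r ?survival_ge0//.
    apply: (le_trans (tail_chebyshev cL K0)); rewrite ler_pdivrMr ?exprn_gt0//.
    have h : step_var mu L <= e / 2 * K.
      by rewrite /K mulrDr mulr1 (_ : e / 2 * (2 * step_var mu L / e) = step_var mu L);
        [lra|field; rewrite gt_eqF].
    apply: (le_trans h); rewrite ler_pM2l ?divr_gt0// expr2.
    by rewrite ler_peMr// ltW.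
  have bA : pr mu A <= e / 2 * p L n.
    apply: (le_trans (stay_below_le_kern n mL (ltW K0))).
    have K40 : 0 < (1 + K) ^+ 4 by rewrite exprn_gt0//; lra.
    apply: (le_trans (ler_wpM2l (ltW K40) (HB n))).
    have [pc _ _] := H n.
    apply: (@le_trans _ _ (e / 2 * (c / rt2 n))); last by rewrite ler_pM2l ?divr_gt0.
    have := HN n nN; rewrite ler_pdivrMr// ler_pdivrMr// => h.
    have r2 := rt2_gt0 (R := R) n; have r21 := rt2_ge1 (R := R) n.
    rewrite -rt2K [leLHS]mulrA ler_pdivrMr ?mulr_gt0 ?exprn_gt0//.
    have -> : e / 2 * (c / rt2 n) * (rt2 n ^+ 2 * rt4 n) = (rt4 n * e * c) / 2 * rt2 n.
      by field; rewrite gt_eqF.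
    apply: (@le_trans _ _ (rt4 n * e * c / 2)); first by lra.
    by rewrite ler_peMr// divr_ge0// !mulr_ge0 ?ltW.
  by lra.
apply/cvgrPdist_le => e e0.
(* With e' <= 1/2 at least half of the survival probability remains at n + 1, so e' <= e/2 suffices
   after dividing by it. *)
pose e' := Num.min (e / 2) 2^-1.
have e'0 : 0 < e' by rewrite lt_min divr_gt0//= invr_gt0.
near=> n.
have q0 := survival_gt0 n cL; have q1 := survival_gt0 n.+1 cL.
have le : p L n.+1 <= p L n by exact: le_survival.
have h : p L n - p L n.+1 <= e' * p L n by near: n; exact: step.
have [e1 e2] : e' <= e / 2 /\ e' <= 2^-1 by rewrite /e' !ge_min !lexx orbT.
rewrite ler0_norm; last by rewrite subr_le0 ler_pdivlMr// mul1r.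
rewrite opprB lerBlDr ler_pdivrMr//.
by nra.
Unshelve. all: by end_near. Qed.

Lemma survival_ratio (L : T -> R) j : centered mu L ->
  p L n / p L (n + j)%N @[n --> \oo] --> (1 : R).
Proof.
move=> cL; elim: j => [|j IH].
  rewrite (_ : (fun n => _) = fun=> 1); first exact: cvg_cst.
  by apply/funext => n; rewrite addn0 divff// gt_eqF// survival_gt0.
have S1 : p L (n + j)%N / p L (n + j).+1 @[n --> \oo] --> (1 : R).
  exact: (cvg_comp _ _ (cvg_addnr j) (survival_ratio1 cL)).
rewrite (_ : (fun n => _) = fun n => (p L n / p L (n + j)%N) * (p L (n + j)%N / p L (n + j).+1)).
  by rewrite -[X in _ --> X](mulr1 1); exact: cvgM IH S1.
by apply/funext => n; rewrite addnS mulrA divfK// gt_eqF// survival_gt0.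
Qed.

Lemma descent_le_kern (L : T -> R) k (a : R) : measurable_fun setT L -> 0 < a ->
  descent mu L k a <= (1 + a) ^+ 4 * kern (\- L) k.
Proof.
move=> mL a0; have mN := measurable_oppfun mL.
apply: le_trans (stay_below_le_kern k mN (ltW a0)).
apply: le_pr; first exact: measurable_descent.
  apply: measurableI; first exact: measurable_wstay.
  by apply: measurable_leset => //; exact: measurable_rwalk.
move=> x [h1 h2]; split; last by rewrite rwalkN; lra.
by move=> j jk; rewrite rwalkN oppr_ge0; exact: h1.
Qed.

(** In the decomposition at the last minimum each ratio p(n-k)/p(n) tends to 1, and the terms with k
    >= N are uniformly small by the convolution bound. The limit is the sum of [descent] over all
    k. *)
Lemma survival_cvg (L : T -> R) (a : R) : centered mu L -> 0 < a ->
  cvgn (fun n => survival mu L n a / p L n).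
Proof.
move=> cL a0; have [mL _ _ _ _] := cL.
have [D D0 HD] := kern_conv_bound (centeredN cL) cL.
apply/cauchy_cvgP/cauchy_exP => e e0.
pose a4 := (1 + a) ^+ 4; have a40 : 0 < a4 by rewrite exprn_gt0//; lra.
have [N HN] := rt4_large (4 * a4 * D / e).
have small : a4 * (D / rt4 N) <= e / 4.
  have := HN N (leqnn N); have r4 := rt4_gt0 (R := R) N.
  by rewrite ler_pdivrMr// => h; rewrite mulrA ler_pdivrMr//; lra.
(* The Cauchy criterion takes a truncated sum as centre, so the limit need not be identified. *)
exists (\sum_(k < N) descent mu L k a).
have C1 : \sum_(k < N) descent mu L k a * (p L (n - k)%N / p L n) @[n --> \oo] -->
    \sum_(k < N) descent mu L k a.
  move: {HN small}N; elim=> [|N IH].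
    by rewrite big_ord0; under eq_fun do rewrite big_ord0; exact: cvg_cst.
  rewrite big_ord_recr /=; under eq_fun do rewrite big_ord_recr /=.
  apply: cvgD => //; rewrite -[X in _ --> X]mulr1; apply: cvgM; first exact: cvg_cst.
  rewrite -(cvg_shiftn N) /=.
  by under eq_fun do rewrite addnK; exact: survival_ratio.
have e20 : 0 < e / 2 by rewrite divr_gt0.
move/cvgrPdist_lt : C1 => /(_ _ e20) C1.
suff : \forall n \near \oo, ball (\sum_(k < N) descent mu L k a) e
    (survival mu L n a / p L n) by exact.
near=> n.
have nN : (N <= n)%N by near: n; exact: nbhs_infty_ge.
have C1n : `|\sum_(k < N) descent mu L k a -
    \sum_(k < N) descent mu L k a * (p L (n - k)%N / p L n)| < e / 2.
  by near: n; exact: C1.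
rewrite /ball /=.
have pn := survival_gt0 n cL.
have E : survival mu L n a / p L n = \sum_(k < N) descent mu L k a * (p L (n - k)%N / p L n)
    + (\sum_(N <= k < n.+1) descent mu L k a * p L (n - k)%N) / p L n.
  rewrite (survival_descent iid n mL a0) -(big_mkord xpredT (fun k => descent mu L k a * p L (n - k)%N)).
  rewrite (big_cat_nat _ (n := N))//=; last exact: leqW.
  rewrite mulrDl; congr (_ + _); rewrite big_mkord mulr_suml.
  by apply: eq_bigr => k _; rewrite mulrA.
set s := \sum_(N <= k < n.+1) _ in E.
have s0 : 0 <= s.
  by apply: sumr_ge0 => k _; apply: mulr_ge0; [exact: pr_ge0|exact: survival_ge0].
have s1 : s / p L n <= e / 4.
  rewrite ler_pdivrMr//.
  apply: (@le_trans _ _ (a4 * (\sum_(N <= k < n.+1) kern (\- L) k * p L (n - k)%N))).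
    rewrite mulr_sumr; apply: ler_sum => k _; rewrite mulrA ler_wpM2r ?survival_ge0//.
    exact: descent_le_kern.
  apply: (@le_trans _ _ (a4 * (D / rt4 N * p L n))); first by rewrite ler_pM2l.
  by rewrite mulrA ler_pM2r.
have s2 : 0 <= s / p L n by rewrite divr_ge0// ltW.
rewrite E opprD addrA.
apply: (le_lt_trans (ler_normB _ _)).
rewrite [X in _ + X]ger0_norm//; lra.
Unshelve. all: by end_near. Qed.

End Kernel.

(** * Convergence given survival *)

Section Conditioned.
Context {d} {T : measurableType d} {R : realType}.
Local Notation X := (@seqspace d T).
Variable mu : probability X R.
Hypothesis iid : iid_law mu.

Local Notation p L n := (survival mu L n 0).

Lemma measurable_survival (L : T -> R) n : measurable_fun setT L ->
  measurable_fun setT (survival mu L n).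
Proof. by move=> mL; apply: nondecreasing_measurable => // a b; exact: le_survival. Qed.

Lemma integral_stay_splice (L : T -> R) m n (F : X -> R) : measurable_fun setT L ->
  measurable_fun setT F -> (forall x, 0 <= F x) ->
  (forall x y, F (splice m (x, y)) = F x) ->
  (\int[mu]_x (F x * \1_(stay L (m + n) 0) x)%:E =
   \int[mu]_x (F x * (\1_(stay L m 0) x * survival mu L n (rwalk L m x)))%:E)%E.
Proof.
move=> mL mF F0 Fm.
have ms := measurable_stay (m + n) 0 mL.
rewrite (integral_splice iid m); first last.
- by move=> x; rewrite lee_fin mulr_ge0.
- by apply/measurable_EFinP; apply: measurable_funM => //; exact: measurable_indic.
apply: eq_integral => x _.
have msn := measurable_stay n (0 + rwalk L m x) mL.
transitivity (\int[mu]_y ((F x * \1_(stay L m 0) x)%:E *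
    (\1_(stay L n (0 + rwalk L m x)) y)%:E))%E.
  apply: eq_integral => y _; rewrite Fm -EFinM -mulrA; congr (_ * _)%:E.
  rewrite !indicE -natrM mulnb; congr (nat_of_bool _)%:R.
  apply/idP/andP => [/set_mem/stay_splice[h1 h2]|[/set_mem h1 /set_mem h2]].
    by rewrite !mem_set.
  by apply/mem_set/stay_splice.
rewrite ge0_integralZl//; last 2 first.
- exact: measurable_EFin_indic.
- by rewrite lee_fin mulr_ge0.
rewrite integral_indicT// add0r prE; last exact: measurable_stay.
by rewrite -EFinM mulrA.
Qed.

(** The exponent is 2 + 4: the quadratic growth of survival and the power in [wt]. *)
Lemma expR_poly6 (s : R) : 0 <= s -> (1 + s) ^+ 6 <= 6 ^+ 6 * expR s.
Proof.
move=> s0; have h : 1 + s / 6 <= expR (s / 6) := expR_ge1Dx _.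
have -> : expR s = expR (s / 6) ^+ 6.
  by rewrite -expRM_natl -mulr_natl; congr expR; field.
have h0 : 0 <= 1 + s by rewrite addr_ge0.
have h1 : 0 <= 6 * expR (s / 6) by rewrite mulr_ge0 ?expR_ge0.
rewrite -exprMn ler_pXn2r// ?nnegrE//.
by apply: (@le_trans _ _ (6 * (1 + s / 6))); [lra|rewrite ler_pM2l].
Qed.

(** From S_k the walk survives n - k more steps with probability at most C (1+S_k)^2 p(n-k), and
    exp(-S_k) pays for this square and for the weight. *)
Lemma exp_stay_bound (L : T -> R) : centered mu L -> exists2 C : R, 0 < C &
  forall k n, (k <= n)%N ->
  (\int[mu]_x (expR (- rwalk L k x) * \1_(stay L n 0) x)%:E <=
   (C * (kern mu L k * p L (n - k)%N))%:E)%E.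
Proof.
move=> cL; have [mL _ _ _ _] := cL.
have [C C0 HC] := survival_quadratic iid cL.
exists (6 ^+ 6 * C); first by rewrite mulr_gt0// exprn_gt0.
move=> k n kn; rewrite -{1}(subnKC kn).
have mE : measurable_fun setT (fun x => expR (- rwalk L k x)).
  apply: measurableT_comp => //; apply: measurableT_comp => //; exact: measurable_rwalk.
rewrite integral_stay_splice//; last by move=> x y; rewrite rwalk_splice.
rewrite (_ : _ * (kern mu L k * _) = p L (n - k) * (6 ^+ 6 * C) * kern mu L k); last by ring.
rewrite /kern.
have ik := rintegrable_kern_fun mu k mL.
rewrite -(RintegralZT _ ik) -Rintegral_EFin; last exact: rintegrableZ.
apply: ge0_le_integral => //.
- by move=> x _; rewrite lee_fin !mulr_ge0 ?expR_ge0 ?survival_ge0.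
- apply/measurable_EFinP; apply: measurable_funM => //; apply: measurable_funM.
    by apply: measurable_indic; exact: measurable_stay.
  by apply: measurableT_comp; [exact: measurable_survival|exact: measurable_rwalk].
- apply/measurable_EFinP; apply: measurable_funM => //.
  exact: rintegrable_measurable ik.
move=> x _; rewrite lee_fin indicE.
have [/set_mem h|_] := boolP (x \in _); last first.
  rewrite mul0r mulr0 mulr_ge0 ?kern_fun_ge0// mulr_ge0 ?survival_ge0//.
  by rewrite mulr_ge0 ?exprn_ge0// ltW.
have s0 : 0 <= rwalk L k x := stay_wstay h (leqnn k).
rewrite mul1r /kern_fun indicE mem_set ?mul1r; last exact: stay_wstay.
apply: (@le_trans _ _ (expR (- rwalk L k x) * (C * (1 + rwalk L k x) ^+ 2 * p L (n - k)%N))).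
  by rewrite ler_wpM2l ?expR_ge0// HC.
rewrite wtE//; set s := rwalk L k x in s0 *; set q := survival _ _ _ _.
have q0 : 0 <= q by exact: survival_ge0.
have s1 : 0 < (1 + s) ^+ 4 by rewrite exprn_gt0//; lra.
rewrite ler_pdivlMr// expRN.
rewrite [leLHS](_ : _ = q * C * (1 + s) ^+ 6 / expR s); last by ring.
rewrite ler_pdivrMr ?expR_gt0//.
rewrite (_ : q * (6 ^+ 6 * C) * expR s = q * C * (6 ^+ 6 * expR s)); last by ring.
by rewrite ler_wpM2l ?expR_poly6// mulr_ge0// ltW.
Qed.

Lemma exp_stay_tail (L : T -> R) : centered mu L -> exists2 D : R, 0 < D &
  forall m n,
  (\sum_(m <= k < n.+1) \int[mu]_x (expR (- rwalk L k x) * \1_(stay L n 0) x)%:E <=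
   (D / rt4 m * p L n)%:E)%E.
Proof.
move=> cL; have [C C0 HC] := exp_stay_bound cL.
have [D D0 HD] := kern_conv_bound iid cL cL.
exists (C * D); first by rewrite mulr_gt0.
move=> m n.
apply: (@le_trans _ _ (\sum_(m <= k < n.+1) (C * (kern mu L k * p L (n - k)%N))%:E)%E).
  rewrite big_nat [leRHS]big_nat; apply: lee_sum => k /andP[_ kn].
  by apply: HC; rewrite -ltnS.
by rewrite sumEFin lee_fin -mulr_sumr -!mulrA ler_pM2l// mulrA.
Qed.

(** Given survival, the first m + 1 marks have density [g n] with respect to [mu]. These densities
    converge pointwise under an integrable bound, hence in L1, so [N] can be chosen before [F]; this
    uniformity is what total variation needs. *)
Lemma conditioned_cauchy (L : T -> R) m (e : R) : centered mu L -> 0 < e ->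
  exists N, forall n n' (F : X -> R), (N <= n)%N -> (N <= n')%N ->
    measurable_fun setT F -> (forall x, 0 <= F x <= 1) ->
    (forall x y, F (splice m.+1 (x, y)) = F x) ->
    `|(\int[mu]_x (F x * \1_(stay L (m.+1 + n) 0) x)) / p L (m.+1 + n) -
      (\int[mu]_x (F x * \1_(stay L (m.+1 + n') 0) x)) / p L (m.+1 + n')| <= e.
Proof.
move=> cL e0; have [mL _ _ _ _] := cL.
have [C C0 HC] := survival_quadratic iid cL.
have [c [c' [c0 c'0 HB]]] := survival_bounds iid cL.
have [_ _ I2 _] := rwalk_moments iid m.+1 cL.
pose g n (x : X) : R := \1_(stay L m.+1 0) x *
  (survival mu L n (rwalk L m.+1 x) / p L (m.+1 + n)).
have mg n : measurable_fun setT (g n).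
  apply: measurable_funM; first by apply: measurable_indic; exact: measurable_stay.
  apply: measurable_funM => //.
  by apply: measurableT_comp; [exact: measurable_survival|exact: measurable_rwalk].
have cg x : cvgn (g ^~ x).
  have [h|h] := pselect (stay L m.+1 0 x); last first.
    by rewrite /g; under eq_fun do rewrite indicE memNset// mul0r; exact: is_cvg_cst.
  (* A block of m + 1 >= 1 steps ends strictly above 0 on survival, as [survival_cvg] requires. *)
  have S0 : 0 < rwalk L m.+1 x by have := h m.+1; rewrite leqnn add0r; exact.
  rewrite /g; under eq_fun do rewrite indicE mem_set// mul1r.
  have h1 := survival_cvg iid cL S0.
  have h2 : p L n / p L (m.+1 + n)%N @[n --> \oo] --> (1 : R).
    by under eq_fun do rewrite addnC; exact: survival_ratio.
  rewrite (_ : (fun n => _) = fun n => (survival mu L n (rwalk L m.+1 x) / p L n) *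
     (p L n / p L (m.+1 + n)%N)).
    by apply/cvg_ex; exists (limn (fun n => survival mu L n (rwalk L m.+1 x) / p L n) * 1);
      exact: cvgM h1 h2.
  by apply/funext => n; rewrite mulrA divfK// gt_eqF// survival_gt0.
pose gl (x : X) : R := limn (g ^~ x).
(* Quadratic growth of survival times the ratio p(n)/p(m+1+n), which is bounded because m+n+2 <=
   (m+2)(n+1). *)
pose K := C * (c' / c * rt2 m.+1).
pose G (x : X) : R := K * (2 + 2 * rwalk L m.+1 x ^+ 2).
have K0 : 0 < K by rewrite !mulr_gt0 ?invr_gt0 ?rt2_gt0.
have iG : mu.-integrable setT (EFin \o G).
  apply: rintegrableZ; apply: rintegrableD; first exact: rintegrable_cst.
  exact: rintegrableZ.
have g0 n x : 0 <= g n x.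
  by rewrite mulr_ge0// divr_ge0 ?survival_ge0.
have gG n x : g n x <= G x.
  rewrite /g indicE; have [/set_mem h|_] := boolP (x \in _); last first.
    by rewrite mul0r mulr_ge0 ?(ltW K0)// addr_ge0// mulr_ge0 ?sqr_ge0.
  have S0 : 0 <= rwalk L m.+1 x := stay_wstay h (leqnn _).
  set s := rwalk L m.+1 x in S0 *; rewrite mul1r.
  have [_ pC _] := HB n; have [pc _ _] := HB (m.+1 + n)%N.
  have pmn := survival_gt0 iid (m.+1 + n) cL.
  rewrite ler_pdivrMr//.
  apply: (le_trans (HC n s S0)).
  have r1 : rt2 (m.+1 + n) <= rt2 m.+1 * rt2 n :> R.
    rewrite -sqrtrM// ler_wsqrtr// -natrM ler_nat; clear; lia.
  have ratio : p L n <= c' / c * rt2 m.+1 * p L (m.+1 + n).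
    apply: (le_trans pC).
    apply: (@le_trans _ _ (c' / c * rt2 m.+1 * (c / rt2 (m.+1 + n)))); last first.
      by rewrite ler_pM2l// mulr_gt0 ?rt2_gt0 ?divr_gt0.
    have -> : c' / c * rt2 m.+1 * (c / rt2 (m.+1 + n)) = c' * (rt2 m.+1 / rt2 (m.+1 + n)).
      by field; rewrite !gt_eqF ?rt2_gt0.
    rewrite ler_pM2l// ler_pdivlMr ?rt2_gt0// mulrC ler_pdivrMr ?rt2_gt0//.
  have sq : (1 + s) ^+ 2 <= 2 + 2 * s ^+ 2 by have := sqr_ge0 (1 - s); nra.
  rewrite /G /K -/s [leRHS](_ : _ =
    C * (2 + 2 * s ^+ 2) * (c' / c * rt2 m.+1 * p L (m.+1 + n))); last by ring.
  apply: ler_pM => //; first by rewrite mulr_ge0 ?sqr_ge0// ltW.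
    exact: survival_ge0.
  by rewrite ler_pM2l.
have cgl x : (EFin \o g ^~ x) @ \oo --> (gl x)%:E.
  by apply: cvg_EFin; [exact: nearW|exact: cg].
have mgl : measurable_fun setT (EFin \o gl).
  apply: (emeasurable_fun_cvg (fun n => EFin \o g n)).
    by move=> n; exact/measurable_EFinP.
  by move=> x _; exact: cgl.
have H1 n : measurable_fun setT (EFin \o g n) by exact/measurable_EFinP.
have H2 : {ae mu, forall x, setT x -> (fun n => (EFin \o g n) x) @ \oo --> (EFin \o gl) x}.
  by apply: aeW => x _; exact: cgl.
have H3 : {ae mu, forall x n, setT x -> (`|(EFin \o g n) x| <= (EFin \o G) x)%E}.
  by apply: aeW => x n _; rewrite /= lee_fin ger0_norm.
have [igl dom _] := dominated_convergence measurableT H1 mgl H2 iG H3.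
have ig n : rintegrable mu (g n).
  apply: le_rintegrable iG => //= x.
  by rewrite ger0_norm// (le_trans (gG n x))// ler_norm.
have iD n : rintegrable mu (fun x => `|g n x - gl x|).
  have h := rintegrableD (ig n) (rintegrableZ (-1) igl).
  apply: le_rintegrable h.
    apply: measurableT_comp => //; apply: measurable_funB => //.
    exact: rintegrable_measurable igl.
  by move=> x; rewrite normr_id mulN1r.
have dom' : \int[mu]_x `|g n x - gl x| @[n --> \oo] --> (0 : R).
  exact: (fine_cvg dom).
have e2 : 0 < e / 2 by rewrite divr_gt0.
move/cvgrPdist_le : dom' => /(_ _ e2) [N _ HN].
exists N.
have main n (F : X -> R) : (N <= n)%N -> measurable_fun setT F -> (forall x, 0 <= F x <= 1) ->
    (forall x y, F (splice m.+1 (x, y)) = F x) ->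
    `|(\int[mu]_x (F x * \1_(stay L (m.+1 + n) 0) x)) / p L (m.+1 + n) -
      \int[mu]_x (F x * gl x)| <= e / 2.
  move=> nN mF F01 Fm.
  have F0 x : 0 <= F x by case/andP: (F01 x).
  have F1 x : F x <= 1 by case/andP: (F01 x).
  have -> : (\int[mu]_x (F x * \1_(stay L (m.+1 + n) 0) x)) / p L (m.+1 + n) =
      \int[mu]_x (F x * g n x).
    rewrite {1}/Rintegral integral_stay_splice// -/(Rintegral _ _ _).
    rewrite -[LHS]mulrC -RintegralZT.
      by apply: eq_Rintegral => x _; rewrite /g; ring.
    apply: le_rintegrable (rintegrable_cst mu 1).
      apply: measurable_funM => //; apply: measurable_funM.
        by apply: measurable_indic; exact: measurable_stay.
      by apply: measurableT_comp; [exact: measurable_survival|exact: measurable_rwalk].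
    move=> x; rewrite normr1 ger0_norm ?mulr_ge0 ?survival_ge0//.
    have q0 : 0 <= survival mu L n (rwalk L m.+1 x) by exact: survival_ge0.
    have q1 : survival mu L n (rwalk L m.+1 x) <= 1 by exact: survival_le1.
    apply: mulr_ile1 => //; first exact: mulr_ge0.
    by apply: mulr_ile1 => //; rewrite indicE; case: (_ \in _).
  have iFg : rintegrable mu (fun x => F x * g n x).
    apply: le_rintegrable (ig n); first exact: measurable_funM.
    by move=> x; rewrite normrM ler_piMl// ger0_norm.
  have iFl : rintegrable mu (fun x => F x * gl x).
    apply: le_rintegrable (igl); first by apply: measurable_funM => //; exact: rintegrable_measurable igl.
    by move=> x; rewrite normrM ler_piMl// ger0_norm.
  rewrite -(RintegralB measurableT iFg iFl).
  have iB : rintegrable mu (fun x => F x * g n x - F x * gl x).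
    by have := rintegrableD iFg (rintegrableZ (-1) iFl); congr rintegrable;
      apply/funext => x; rewrite mulN1r.
  apply: (le_trans (le_normr_Rintegral measurableT iB)).
  have := HN n nN; rewrite /= sub0r normrN => /(le_trans (ler_norm _)) h.
  apply: le_trans h; apply: le_Rintegral => //.
    by apply: le_rintegrable (iB) => [|x]; [apply: measurableT_comp => //;
      exact: rintegrable_measurable iB|rewrite normr_id].
    exact: iD.
  by move=> x _; rewrite -mulrBr normrM ler_piMl// ger0_norm.
move=> n n' F nN n'N mF F01 Fm.
have h1 := main n F nN mF F01 Fm; have h2 := main n' F n'N mF F01 Fm.
rewrite distrC in h2.
apply: (le_trans (ler_distD (\int[mu]_x (F x * gl x)) _ _)).
by rewrite [leRHS](splitr e) lerD.
Qed.

End Conditioned.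

(** * The quenched semigroup *)

Local Open Scope ereal_scope.

Section NatIntegral.
Context {R : realType}.
Implicit Types (Q : probability nat R) (f g : nat -> \bar R).

Lemma integral_nat Q f : (forall k, 0 <= f k) ->
  \int[Q]_k f k = \sum_(k <oo) f k * Q [set k].
Proof.
move=> f0.
have E : \bigcup_k [set k] = [set: nat] by apply/seteqP; split => // k _; exists k.
rewrite -E ge0_integral_bigcup//; last first.
  by apply/trivIsetP => i j _ _ ij; apply/seteqP; split => // k [/= -> /eqP]; rewrite (negPf ij).
apply: eq_eseriesr => k _.
transitivity (\int[Q]_(x in [set k]) (cst (f k) x)); last by rewrite integral_cst.
by apply: eq_integral => x; rewrite inE => ->.
Qed.

Lemma le_integral_nat Q f g : (forall k, 0 <= f k) -> (forall k, f k <= g k) ->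
  \int[Q]_k f k <= \int[Q]_k g k.
Proof.
by move=> f0 fg; apply: ge0_le_integral => //; move=> k _; exact: f0.
Qed.

Lemma integral_natD Q f g : (forall k, 0 <= f k) -> (forall k, 0 <= g k) ->
  \int[Q]_k (f k + g k) = \int[Q]_k f k + \int[Q]_k g k.
Proof. by move=> f0 g0; rewrite ge0_integralD. Qed.

Lemma integral_natZ Q (c : \bar R) f : 0 <= c -> (forall k, 0 <= f k) ->
  \int[Q]_k (c * f k) = c * \int[Q]_k f k.
Proof. by move=> c0 f0; rewrite ge0_integralZl. Qed.

Lemma integral_nat_cst Q (c : \bar R) : \int[Q]_k c = c.
Proof. by rewrite integral_cst// -[RHS]mule1 -(probability_setT Q). Qed.

Lemma measurable_pprobability d' (U : measurableType d') (P : U -> pprobability nat R)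
    (A : set nat) : measurable_fun setT P -> measurable_fun setT (fun u => P u A).
Proof. by move=> mP; exact: (measurable_kernel (kprobability mP) A I). Qed.

Lemma measurable_integral_nat d' (U : measurableType d') (P : U -> pprobability nat R)
    (f : U -> nat -> \bar R) : measurable_fun setT P ->
  (forall k, measurable_fun setT (f ^~ k)) -> (forall u k, 0 <= f u k) ->
  measurable_fun setT (fun u => \int[P u]_k f u k).
Proof.
move=> mP mf f0; under eq_fun do rewrite integral_nat//.
apply: ge0_emeasurable_sum => [k u _ _|k _]; first exact: mule_ge0.
by apply: emeasurable_funM => //; exact: measurable_pprobability.
Qed.

End NatIntegral.

Section Quenched.
Context {R : realType}.
Implicit Types (e : mark R) (Q : probability nat R) (f g : nat -> \bar R).

Definition nat_mean Q : \bar R := \int[Q]_k (k%:R)%:E.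

Definition add_offspring Q f : nat -> \bar R := fun y => \int[Q]_j f (y + j)%N.

(** Offspring are added one at a time to the y immigrants: k iterations give the mean of f(y + xi_1
    + ... + xi_k) without a k-fold convolution. *)
Definition quenched_step e f : nat -> \bar R :=
  fun k => \int[(e.2 : probability nat R)]_y iter k (add_offspring e.1) f y.

(* [x 0] is the mark of the last generation: marks are listed backwards in time. *)
Fixpoint quenched n (x : nat -> mark R) f : nat -> \bar R :=
  if n is m.+1 then quenched_step (x m) (quenched m x f) else f.

Lemma add_offspring_ge0 Q f : (forall k, 0 <= f k) -> forall k, 0 <= add_offspring Q f k.
Proof. by move=> f0 k; apply: integral_ge0 => j _. Qed.

Lemma iter_add_offspring_ge0 Q f n : (forall k, 0 <= f k) ->
  forall k, 0 <= iter n (add_offspring Q) f k.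
Proof. by move=> f0; elim: n => //= n IH; exact: add_offspring_ge0. Qed.

Lemma quenched_step_ge0 e f : (forall k, 0 <= f k) -> forall k, 0 <= quenched_step e f k.
Proof. by move=> f0 k; apply: integral_ge0 => j _; exact: iter_add_offspring_ge0. Qed.

Lemma quenched_ge0 n x f : (forall k, 0 <= f k) -> forall k, 0 <= quenched n x f k.
Proof. by move=> f0; elim: n => //= n IH; exact: quenched_step_ge0. Qed.

Lemma add_offspring_le Q f g (c : \bar R) : 0 <= c -> (forall k, 0 <= f k) ->
  (forall k, 0 <= g k) -> (forall k, f k <= g k + c) ->
  forall k, add_offspring Q f k <= add_offspring Q g k + c.
Proof.
move=> c0 f0 g0 fg k; rewrite -[X in _ + X](integral_nat_cst Q) -integral_natD//.
exact: le_integral_nat.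
Qed.

Lemma iter_add_offspring_le Q f g (c : \bar R) n : 0 <= c -> (forall k, 0 <= f k) ->
  (forall k, 0 <= g k) -> (forall k, f k <= g k + c) ->
  forall k, iter n (add_offspring Q) f k <= iter n (add_offspring Q) g k + c.
Proof.
move=> c0 f0 g0 fg; elim: n => //= n IH; apply: add_offspring_le => //;
  exact: iter_add_offspring_ge0.
Qed.

Lemma quenched_le1 n x f : (forall k, 0 <= f k <= 1) -> forall k, quenched n x f k <= 1.
Proof.
move=> f01; have f0 k : 0 <= f k by case/andP: (f01 k).
elim: n => [k|n IH k] /=; first by case/andP: (f01 k).
rewrite -[leRHS](integral_nat_cst (x n).2); apply: le_integral_nat.
  by apply: iter_add_offspring_ge0; exact: quenched_ge0.
elim: k => //= k IHk y; rewrite -[leRHS](integral_nat_cst (x n).1).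
by apply: le_integral_nat => // j; apply: iter_add_offspring_ge0; exact: quenched_ge0.
Qed.

Lemma iter_add_offspringZ Q f (c : \bar R) n k : 0 <= c -> (forall k, 0 <= f k) ->
  iter n (add_offspring Q) (fun y => c * f y) k = c * iter n (add_offspring Q) f k.
Proof.
move=> c0 f0; elim: n k => //= n IH k; rewrite /add_offspring -integral_natZ//.
  by apply: eq_integral => j _; rewrite IH.
by move=> j; exact: iter_add_offspring_ge0.
Qed.

Lemma quenched_stepZ e f (c : \bar R) k : 0 <= c -> (forall k, 0 <= f k) ->
  quenched_step e (fun y => c * f y) k = c * quenched_step e f k.
Proof.
move=> c0 f0; rewrite /quenched_step -integral_natZ//.
  by apply: eq_integral => j _; rewrite iter_add_offspringZ.
by move=> j; exact: iter_add_offspring_ge0.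
Qed.

Lemma quenchedZ n x f (c : \bar R) k : 0 <= c -> (forall k, 0 <= f k) ->
  quenched n x (fun y => c * f y) k = c * quenched n x f k.
Proof.
move=> c0 f0; elim: n k => //= n IH k.
rewrite (_ : quenched n x _ = fun y => c * quenched n x f y); last exact/funext.
by rewrite quenched_stepZ//; exact: quenched_ge0.
Qed.

(** Two one-sided inequalities in place of a bound on a difference, since the values are extended
    reals. *)
Definition lipschitz_nat f (c : R) := forall k, f k.+1 <= f k + c%:E /\ f k <= f k.+1 + c%:E.

Lemma lipschitz_natD f (c : R) y j : lipschitz_nat f c ->
  f (y + j)%N <= f y + (j%:R * c)%:E /\ f y <= f (y + j)%N + (j%:R * c)%:E.
Proof.
move=> fc; elim: j => [|j [IH1 IH2]]; first by rewrite addn0 mul0r adde0.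
rewrite addnS -natr1 mulrDl mul1r EFinD; have [h1 h2] := fc (y + j)%N; split.
  by apply: (le_trans h1); rewrite addeA leeD2r.
by apply: (le_trans IH2); rewrite (addeC (j%:R * c)%:E) addeA leeD2r.
Qed.

(** Serves twice: with the reproduction law for one more parent, and with the immigration law for
    one more generation. *)
Lemma integral_lipschitz_nat Q f (c m : R) y : (0 <= c)%R -> (forall k, 0 <= f k) ->
  lipschitz_nat f c -> nat_mean Q <= m%:E ->
  add_offspring Q f y <= f y + (m * c)%:E /\ f y <= add_offspring Q f y + (m * c)%:E.
Proof.
move=> c0 f0 fc Qm.
have jc j : 0 <= (j%:R * c)%:E by rewrite lee_fin mulr_ge0.
have E : \int[Q]_j (j%:R * c)%:E <= (m * c)%:E.
  under eq_integral do rewrite mulrC EFinM.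
  rewrite integral_natZ; [|by rewrite lee_fin|by move=> k; rewrite lee_fin].
  by rewrite mulrC EFinM; apply: lee_wpmul2l => //; rewrite lee_fin.
split.
  apply: (@le_trans _ _ (\int[Q]_j (f y + (j%:R * c)%:E))).
    by apply: le_integral_nat => // j; case: (lipschitz_natD y j fc).
  by rewrite integral_natD// integral_nat_cst leeD2l.
apply: (@le_trans _ _ (\int[Q]_j (f (y + j)%N + (j%:R * c)%:E))).
  rewrite -[leLHS](integral_nat_cst Q).
  by apply: le_integral_nat => // j; case: (lipschitz_natD y j fc).
by rewrite integral_natD// leeD2l.
Qed.

(** One more individual is one more [add_offspring]; [iterSr] puts it next to f, where it costs m c,
    and the outer operators do not enlarge the error. *)
Lemma lipschitz_quenched_step e f (c m : R) : (0 <= c)%R -> (0 <= m)%R ->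
  (forall k, 0 <= f k) -> lipschitz_nat f c -> nat_mean e.1 <= m%:E ->
  lipschitz_nat (quenched_step e f) (m * c)%R.
Proof.
move=> c0 m0 f0 fc em k.
have mc : 0 <= (m * c)%:E by rewrite lee_fin mulr_ge0.
have i0 n := iter_add_offspring_ge0 e.1 n f0.
split; rewrite /quenched_step -[X in _ + X](integral_nat_cst e.2) -integral_natD//;
  apply: le_integral_nat => // y; rewrite iterSr.
  apply: iter_add_offspring_le => //; first exact: add_offspring_ge0.
  by move=> z; case: (integral_lipschitz_nat z c0 f0 fc em).
apply: iter_add_offspring_le => //; first exact: add_offspring_ge0.
by move=> z; case: (integral_lipschitz_nat z c0 f0 fc em).
Qed.

Definition neg_log_mean e : R := (- ln (fine (nat_mean e.1)))%R.

Definition good_mark (b : R) e := 0 < nat_mean e.1 < +oo /\ nat_mean e.2 <= b%:E.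

Lemma nat_mean_expR (b : R) e : good_mark b e ->
  nat_mean e.1 = (expR (- neg_log_mean e))%:E.
Proof.
move=> [/andP[h1 h2] _]; rewrite /neg_log_mean opprK lnK ?posrE.
  by rewrite fineK// ge0_fin_numE// ltW.
by rewrite fine_gt0// h1.
Qed.

Lemma lipschitz_quenched (b : R) n x f : (forall k, good_mark b (x k)) ->
  (forall k, 0 <= f k) -> lipschitz_nat f 1 ->
  lipschitz_nat (quenched n x f) (expR (- rwalk neg_log_mean n x)).
Proof.
move=> gx f0 f1; elim: n => [|n IH]; first by rewrite rwalk0 oppr0 expR0.
rewrite rwalkS opprD addrC expRD /=.
apply: lipschitz_quenched_step; rewrite ?expR_ge0//; first exact: quenched_ge0.
by rewrite (nat_mean_expR (gx n)).
Qed.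

(** Telescoping over populations started from nobody: the mark at index k changes the value at 0 by
    at most b exp(-S_k), the mean number of its immigrants times the Lipschitz constant. The i
    ancestors cost i exp(-S_n), which is why the sum includes k = n. *)
Lemma quenched_diff (b : R) m n x f i : (forall k, good_mark b (x k)) -> (0 <= b)%R ->
  (forall k, 0 <= f k) -> lipschitz_nat f 1 -> (m <= n)%N ->
  let r := ((b + i%:R) * \sum_(m <= k < n.+1) expR (- rwalk neg_log_mean k x))%R%:E in
  quenched n x f i <= quenched m x f 0%N + r /\ quenched m x f 0%N <= quenched n x f i + r.
Proof.
move=> gx b0 f0 f1 mn r.
have ex0 k : (0 <= expR (- rwalk neg_log_mean k x))%R by rewrite expR_ge0.
have S : let s := (b * \sum_(m <= k < n) expR (- rwalk neg_log_mean k x))%R%:E in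
    quenched n x f 0%N <= quenched m x f 0%N + s /\ quenched m x f 0%N <= quenched n x f 0%N + s.
  elim: n mn {r} => [|n IH].
    by rewrite leqn0 => /eqP -> /=; rewrite big_geq// mulr0 adde0.
  rewrite leq_eqVlt => /orP[/eqP ->|]; first by rewrite /= big_geq// mulr0 adde0.
  rewrite ltnS => mn; rewrite big_nat_recr//= mulrDr EFinD.
  have [IH1 IH2] := IH mn.
  (* With nobody present, [quenched_step] is the average over immigrants, that is [add_offspring] at
     0 for the immigration law. *)
  have := integral_lipschitz_nat 0%N (ex0 n) (quenched_ge0 n x f0)
    (lipschitz_quenched n gx f0 f1) (gx n).2.
  rewrite /add_offspring; under eq_integral do rewrite add0n.
  rewrite -/(quenched_step (x n) (quenched n x f) 0%N).
  move=> -[h1 h2]; split.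
    by apply: (le_trans h1); rewrite addeA leeD2r.
  apply: (le_trans IH2); set s := (_ * \sum_(m <= k < n) _)%R%:E.
  by rewrite (addeC s) addeA leeD2r.
have [h1 h2] := lipschitz_natD 0%N i (lipschitz_quenched n gx f0 f1).
rewrite add0n in h1 h2; case: S => S1 S2.
set s := (_ * _)%R%:E in S1 S2; set t := (_ * _)%R%:E in h1 h2.
have st : s + t <= r.
  rewrite /r /s /t -EFinD lee_fin big_nat_recr//= mulrDr.
  apply: lerD; apply: ler_wpM2r; rewrite ?lerDl ?lerDr//.
  exact: sumr_ge0.
split.
  apply: (le_trans h1); apply: (le_trans (leeD2r _ S1)).
  by rewrite -addeA leeD2l.
apply: (le_trans S2); apply: (le_trans (leeD2r _ h2)).
by rewrite -addeA leeD2l// addeC.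
Qed.

Lemma measurable_iter_add_offspring d (U : measurableType d) (e : U -> mark R)
    (f : U -> nat -> \bar R) j : measurable_fun setT e ->
  (forall k, measurable_fun setT (f ^~ k)) -> (forall u k, 0 <= f u k) ->
  forall k, measurable_fun setT (fun u => iter j (add_offspring (e u).1) (f u) k).
Proof.
move=> me mf f0; elim: j => [|j IH] k /=; first exact: mf.
apply: (@measurable_integral_nat _ _ U (fun u => (e u).1)
  (fun u l => iter j (add_offspring (e u).1) (f u) (k + l)%N)).
- exact: measurableT_comp measurable_fst me.
- by move=> l; exact: IH.
- by move=> u l; exact: iter_add_offspring_ge0.
Qed.

Lemma measurable_quenched_step d (U : measurableType d) (e : U -> mark R)
    (f : U -> nat -> \bar R) k : measurable_fun setT e ->
  (forall k, measurable_fun setT (f ^~ k)) -> (forall u k, 0 <= f u k) ->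
  measurable_fun setT (fun u => quenched_step (e u) (f u) k).
Proof.
move=> me mf f0; apply: measurable_integral_nat.
- exact: measurableT_comp measurable_snd me.
- by move=> l; exact: measurable_iter_add_offspring.
- by move=> u l; exact: iter_add_offspring_ge0.
Qed.

Lemma measurable_quenched n f : (forall k, 0 <= f k) -> forall k,
  measurable_fun setT (fun x : seqspace (T := mark R) => quenched n x f k).
Proof.
move=> f0; elim: n => [k|n IH k] /=; first exact: measurable_cst.
apply: measurable_quenched_step => [|//|x l]; first exact: measurable_coord.
exact: quenched_ge0.
Qed.

(** The recursion of [quenched] peels off the oldest mark, that of [Zproc] the newest. *)
Lemma quenched_shift n x f :
  quenched n.+1 x f = quenched n (fun k => x k.+1) (quenched_step (x 0%N) f).
Proof. by elim: n => //= n ->. Qed.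

Lemma eq_quenched n (x y : nat -> mark R) f : (forall k, (k < n)%N -> x k = y k) ->
  quenched n x f = quenched n y f.
Proof.
elim: n => //= n IH xy; rewrite IH ?xy// => k kn; apply: xy; exact: ltnW.
Qed.

Lemma measurable_nat_mean1 : measurable_fun setT (fun e : mark R => nat_mean e.1).
Proof. by apply: measurable_integral_nat => //; exact: measurable_fst. Qed.

Lemma measurable_nat_mean2 : measurable_fun setT (fun e : mark R => nat_mean e.2).
Proof. by apply: measurable_integral_nat => //; exact: measurable_snd. Qed.

Lemma measurable_neg_log_mean : measurable_fun setT neg_log_mean.
Proof.
apply: measurableT_comp => //; apply: measurableT_comp; first exact: measurable_ln.
by apply: measurableT_comp => //; exact: measurable_nat_mean1.
Qed.

End Quenched.

(** * Conditional independence given the environment *)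

Section Density.
Context {d} {T : measurableType d} {R : realType} (mu : {measure set T -> \bar R}).
Variables (f : T -> \bar R) (mf : measurable_fun setT f) (f0 : forall x, 0 <= f x).

Definition density_measure (A : set T) : \bar R := \int[mu]_(x in A) f x.

Let density0 : density_measure set0 = 0.
Proof. exact: integral_set0. Qed.

Let density_ge0 A : 0 <= density_measure A.
Proof. by apply: integral_ge0 => x _. Qed.

Let density_additive : semi_sigma_additive density_measure.
Proof.
move=> F mF tF mUF; rewrite /density_measure ge0_integral_bigcup//; last first.
  exact: measurable_funTS.
apply: is_cvg_ereal_nneg_natsum_cond => n _ _.
by apply: integral_ge0 => /= x _.
Qed.

HB.instance Definition _ := isMeasure.Build _ _ _
  density_measure density0 density_ge0 density_additive.

Definition density : {measure set T -> \bar R} := density_measure.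

Hypothesis ffin : forall x, f x \is a fin_num.

Import HBNNSimple.

Lemma integral_density (W : T -> \bar R) : measurable_fun setT W ->
  (forall x, 0 <= W x) -> \int[density]_x W x = \int[mu]_x (W x * f x).
Proof.
move=> mW W0; pose w := nnsfun_approx measurableT mW.
have mA n y : measurable (w n @^-1` [set y]).
  by rewrite -[_ @^-1` _]setTI; exact: (measurable_funPT (w n)).
have mi n y : measurable_fun setT (fun x => (y * \1_(w n @^-1` [set y]) x)%:E).
  by apply/measurable_EFinP; apply: measurable_funM.
have simple n : \int[density]_x (w n x)%:E = \int[mu]_x ((w n x)%:E * f x).
  transitivity (\sum_(y \in range (w n)) y%:E * density (w n @^-1` [set y])).
    transitivity (\int[density]_x (\sum_(y \in range (w n))
        (y * \1_(w n @^-1` [set y]) x)%:E)).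
      by apply: eq_integral => x _; rewrite fimfunE -fsumEFin.
    rewrite ge0_integral_fsum//; last by move=> y x _; exact: nnfun_muleindic_ge0.
    apply: eq_fsbigr => y; rewrite inE => -[x0 _ yE].
    have y0 : (0 <= y)%R by rewrite -yE.
    under eq_integral do rewrite EFinM.
    rewrite ge0_integralZl//; last exact: measurable_EFin_indic.
    by rewrite integral_indic// setIT.
  transitivity (\int[mu]_x (\sum_(y \in range (w n))
      ((y * \1_(w n @^-1` [set y]) x)%:E * f x))); last first.
    apply: eq_integral => x _; rewrite fimfunE -fsumEFin//.
    by rewrite ge0_mule_fsuml// => y; rewrite EFinM; exact: nnfun_muleindic_ge0.
  rewrite ge0_integral_fsum//; last 2 first.
  - by move=> y; exact: emeasurable_funM.
  - by move=> y x _; rewrite mule_ge0//; exact: nnfun_muleindic_ge0.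
  apply: eq_fsbigr => y; rewrite inE => -[x0 _ yE].
  have y0 : (0 <= y)%R by rewrite -yE.
  under [RHS]eq_integral do rewrite EFinM -muleA.
  rewrite ge0_integralZl//; last 2 first.
  - by apply: emeasurable_funM => //; exact: measurable_EFin_indic.
  - by move=> x _; rewrite mule_ge0// lee_fin.
  congr (_ * _); rewrite /density /= /density_measure [LHS]integral_mkcond.
  apply: eq_integral => x _.
  by rewrite patchE indicE; case: (_ \in _); rewrite ?mul1e ?mul0e.
have wW x : (w n x)%:E @[n --> \oo] --> W x.
  exact: (cvg_nnsfun_approx measurableT mW (fun x _ => W0 x)).
have wnd x a b : (a <= b)%N -> (w a x <= w b x)%R.
  by move=> ab; exact/lefP/nd_nnsfun_approx.
transitivity (limn (fun n => \int[density]_x (w n x)%:E)).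
  rewrite -monotone_convergence//.
  - by apply: eq_integral => x _; apply/esym/cvg_lim.
  - by move=> n; exact/measurable_EFinP.
  - by move=> n x _; rewrite lee_fin.
  - by move=> x _ a b ab; rewrite lee_fin; exact: wnd.
transitivity (limn (fun n => \int[mu]_x ((w n x)%:E * f x))).
  by congr (limn _); apply/funext => n; rewrite simple.
rewrite -monotone_convergence//.
- by apply: eq_integral => x _; apply/cvg_lim => //; exact: cvgeZr.
- by move=> n; apply: emeasurable_funM => //; exact/measurable_EFinP.
- by move=> n x _; rewrite mule_ge0// lee_fin.
- by move=> x _ a b ab; apply: lee_wpmul2r => //; rewrite lee_fin; exact: wnd.
Qed.

End Density.

Section SubSigmaAlgebra.
Context {d} {T : measurableType d} {R : realType} (mu : probability T R).
Variable G : set (set T).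
Hypothesis Gm : G `<=` measurable.

Local Notation GT := (g_sigma_algebraType G).

Lemma sub_measurable : <<s G >> `<=` measurable.
Proof. exact: (smallest_sub (@sigma_algebra_measurable _ T) Gm). Qed.

Lemma measurable_sub d' (U : measurableType d') (h : T -> U) :
  measurable_fun (setT : set GT) (h : GT -> U) -> measurable_fun setT h.
Proof. by move=> mh _ B mB; rewrite setTI; apply: sub_measurable; rewrite -[_ @^-1` _]setTI; exact: mh. Qed.

(** The measures with densities f and g agree on the sub-sigma-algebra, hence so do their integrals
    of W. This extends conditional expectations, tested on sets, to nonnegative weights. *)
Lemma integral_weight (f g : T -> \bar R) (W : GT -> \bar R) :
  measurable_fun setT f -> measurable_fun setT g ->
  (forall x, 0 <= f x) -> (forall x, 0 <= g x) ->
  (forall x, f x \is a fin_num) -> (forall x, g x \is a fin_num) ->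
  (forall A, <<s G >> A -> \int[mu]_(x in A) f x = \int[mu]_(x in A) g x) ->
  measurable_fun setT W -> (forall x, 0 <= W x) ->
  \int[mu]_x (W x * f x) = \int[mu]_x (W x * g x).
Proof.
move=> mf mg f0 g0 ffin gfin fg mW W0.
have mWT := measurable_sub (h := W) mW.
have mid : measurable_fun setT (id : T -> GT).
  by move=> _ A mA; rewrite setTI; exact: sub_measurable.
rewrite -(integral_density mu mf f0 ffin mWT W0) -(integral_density mu mg g0 gfin mWT W0).
transitivity (\int[pushforward (density mu mf f0) (id : T -> GT)]_x W x).
  by rewrite ge0_integral_pushforward.
transitivity (\int[pushforward (density mu mg g0) (id : T -> GT)]_x W x).
  by apply: eq_measure_integral => A mA _; exact: fg.
by rewrite ge0_integral_pushforward.
Qed.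

End SubSigmaAlgebra.

Section Glue.
Context {d d'} {U : measurableType d} {V : measurableType d'}.

(** Substitution of a random index, as in a sum over a random number of individuals. *)
Lemma measurable_glue (N : U -> nat) (F : nat -> U -> V) : measurable_fun setT N ->
  (forall k, measurable_fun setT (F k)) -> measurable_fun setT (fun u => F (N u) u).
Proof.
move=> mN mF _ B mB; rewrite setTI.
rewrite (_ : _ @^-1` B = \bigcup_k (N @^-1` [set k] `&` F k @^-1` B)); last first.
  apply/seteqP; split => [u h|u [k _ [/= <-]]//].
  by exists (N u).
apply: bigcupT_measurable => k; apply: measurableI.
  by rewrite -[_ @^-1` _]setTI; exact: mN.
by rewrite -[_ @^-1` _]setTI; exact: mF.
Qed.

End Glue.

Lemma measurable_nat_comp2 d (U : measurableType d) (h : nat -> nat -> nat) (f g : U -> nat) :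
  measurable_fun setT f -> measurable_fun setT g ->
  measurable_fun setT (fun u => h (f u) (g u)).
Proof.
move=> mf mg; apply: (measurable_glue (F := fun k u => h k (g u))) => // k.
by apply: (measurableT_comp (f := h k)).
Qed.

Lemma measurable_sum_nat d (U : measurableType d) (f : nat -> U -> nat) n :
  (forall k, (k < n)%N -> measurable_fun setT (f k)) ->
  measurable_fun setT (fun u => \sum_(k < n) f k u)%N.
Proof.
elim: n => [|n IH] mf; first by under eq_fun do rewrite big_ord0; exact: measurable_cst.
under eq_fun do rewrite big_ord_recr /=; apply: (measurable_nat_comp2 addn); last exact: mf.
by apply: IH => k kn; apply: mf; exact: ltnW.
Qed.

Section Partition.
Context {d} {T : measurableType d} {R : realType} (mu : probability T R).

Lemma integral_partition (N : T -> nat) (h : nat -> T -> \bar R) :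
  measurable_fun setT N -> (forall k, measurable_fun setT (h k)) ->
  (forall k x, 0 <= h k x) ->
  \int[mu]_x h (N x) x = \sum_(k <oo) \int[mu]_x (h k x * (\1_(N @^-1` [set k]) x)%:E).
Proof.
move=> mN mh h0.
have mA k : measurable (N @^-1` [set k]) by rewrite -[_ @^-1` _]setTI; exact: mN.
have E : \bigcup_k (N @^-1` [set k]) = setT.
  by apply/seteqP; split => // x _; exists (N x).
rewrite -{1}E ge0_integral_bigcup//; last 2 first.
- by rewrite E; exact: measurable_glue.
- by apply/trivIsetP => i j _ _ ij; apply/seteqP; split => // x [/= -> /eqP]; rewrite (negPf ij).
apply: eq_eseriesr => k _; rewrite integral_mkcond; apply: eq_integral => x _.
rewrite patchE indicE; case: ifPn => [/set_mem /= ->|_]; first by rewrite mule1.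
by rewrite mule0.
Qed.

End Partition.

(** * Offspring and immigrant variables given the environment *)

Section Sites.
Context {d : measure_display} {Omega : measurableType d} {R : realType}.
Variable P : probability Omega R.
Variable env : nat -> {RV P >-> mark R}.
Variable xi : nat -> nat -> {RV P >-> nat}.
Variable eta : nat -> {RV P >-> nat}.
Hypothesis indep : cond_indep_given_env env xi eta.

(* [(m, Some j)] is the j-th individual of generation m and [(m, None)] the
   immigration into generation m.+1; both are governed by the mark of time m. *)
Definition site := (nat * option nat)%type.

Definition site_var (s : site) (w : Omega) : nat :=
  if s.2 is Some j then xi s.1 j w else eta s.1.+1 w.

Definition site_law (s : site) (w : Omega) : pprobability nat R :=
  if s.2 is Some j then (env s.1 w).1 else (env s.1 w).2.

Definition box N K (s : site) : bool :=
  (s.1 < N)%N && (if s.2 is Some j then (j < K)%N else true).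

Definition site_event N K (B : site -> set nat) : set Omega :=
  [set w | forall s, box N K s -> B s (site_var s w)].

Definition site_prod N K (B : site -> set nat) (w : Omega) : \bar R :=
  \prod_(m < N) ((\prod_(j < K) site_law (m : nat, Some (j : nat)) w (B (m : nat, Some (j : nat)))) *
     site_law (m : nat, None) w (B (m : nat, None))).

Local Notation genv := (\bigcup_n sigma_mark env n).
Local Notation envT := (g_sigma_algebraType genv).

Lemma genv_measurable : genv `<=` measurable.
Proof. by move=> A [n _ [B mB <-]]; exact: (measurable_funPT (env n)). Qed.

Lemma sigma_env_measurable : sigma_env env `<=` measurable.
Proof. exact: (sub_measurable genv_measurable). Qed.

Lemma measurable_site_var s : measurable_fun setT (site_var s).
Proof. by case: s => m [j|] /=; exact: measurable_funPT. Qed.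

Lemma measurable_env n : measurable_fun (setT : set envT) (env n : envT -> mark R).
Proof. by move=> _ B mB; apply: sub_sigma_algebra; exists n => //; exists B. Qed.

Lemma measurable_site_law s : measurable_fun (setT : set envT) (site_law s : envT -> _).
Proof.
case: s => m [j|].
  exact: (measurableT_comp measurable_fst (measurable_env m)).
exact: (measurableT_comp measurable_snd (measurable_env m)).
Qed.

Lemma measurable_site_event N K B : measurable (site_event N K B).
Proof.
rewrite (_ : site_event N K B = \bigcap_(m in [set` iota 0 N]) (\bigcap_(j in [set` iota 0 K])
    (site_var (m, Some j) @^-1` B (m, Some j)) `&` site_var (m, None) @^-1` B (m, None))); last first.
  apply/seteqP; split => [w h m|w h [m [j|]] /andP[/= mN jK]].
  - rewrite /= mem_iota /= add0n => mN; split => [j|].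
      by rewrite /= mem_iota /= add0n => jK; apply: h; rewrite /box /= mN.
    by apply: h; rewrite /box /= mN.
  - have [|h1 _] := h m; first by rewrite /= mem_iota /= add0n.
    by apply: h1; rewrite /= mem_iota /= add0n.
  - by have [|_ h1] := h m; first by rewrite /= mem_iota /= add0n.
have mS s : measurable (site_var s @^-1` B s).
  by rewrite -[_ @^-1` _]setTI; exact: measurable_site_var.
apply: bigcap_measurableType => m _; apply: measurableI => //.
exact: bigcap_measurableType.
Qed.

Lemma site_cond N K B (A : set Omega) : sigma_env env A ->
  \int[P]_(w in A) site_prod N K B w = \int[P]_(w in A) (\1_(site_event N K B) w)%:E.
Proof.
move=> EA.
have [_ /(_ A EA)] := indep N K (fun m j => B (m, Some j)) (fun m => B (m, None)).
rewrite (_ : \bigcap_(m < N) _ = site_event N K B)//.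
apply/seteqP; split => [w h [m [j|]] /andP[/= mN jK]|w h m mN].
- by have [h1 _] := h m mN; exact: h1.
- by have [_ h2] := h m mN.
- by split => [j jK|]; [apply: (h (m, Some j))|apply: (h (m, None))];
    rewrite /box /= (mN : (m < N)%N) ?(jK : (j < K)%N).
Qed.

Lemma site_law_fin s w B : site_law s w B \is a fin_num.
Proof. exact: (@fin_num_measure _ _ _ (site_law s w : probability nat R)). Qed.

Lemma site_prod_ge0 N K B w : 0 <= site_prod N K B w.
Proof. by apply: prode_ge0 => m _; rewrite mule_ge0//; apply: prode_ge0. Qed.

Lemma site_prod_fin N K B w : site_prod N K B w \is a fin_num.
Proof.
rewrite /site_prod; apply: (big_ind (fun x : \bar R => x \is a fin_num)) => //.
  by move=> x y; exact: fin_numM.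
move=> m _; apply: fin_numM; last exact: site_law_fin.
apply: (big_ind (fun x : \bar R => x \is a fin_num)) => //.
  by move=> x y; exact: fin_numM.
by move=> j _; exact: site_law_fin.
Qed.

(** An unconstrained site contributes the factor 1, so constraining it inserts one new factor. *)
Lemma site_prod_upd N K (B B' : site -> set nat) V w : box N K V ->
  B V = setT -> (forall s, s != V -> B' s = B s) ->
  site_prod N K B' w = site_law V w (B' V) * site_prod N K B w.
Proof.
case: V => m0 o /andP[/= mN oK] BV BB'.
have lT s : site_law s w setT = 1 := probability_setT (site_law s w : probability nat R).
rewrite /site_prod (bigD1 (Ordinal mN))//= [in RHS](bigD1 (Ordinal mN))//=.
have -> : \prod_(i < N | i != Ordinal mN)
      ((\prod_(j < K) site_law (i : nat, Some (j : nat)) w (B' (i : nat, Some (j : nat)))) *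
        site_law (i : nat, None) w (B' (i : nat, None))) =
    \prod_(i < N | i != Ordinal mN)
      ((\prod_(j < K) site_law (i : nat, Some (j : nat)) w (B (i : nat, Some (j : nat)))) *
        site_law (i : nat, None) w (B (i : nat, None))).
  apply: eq_bigr => i im.
  have ne o' : (i : nat, o') != (m0, o).
    by apply: contra im => /eqP[ie _]; apply/eqP/val_inj.
  by rewrite BB'//; congr (_ * _); apply: eq_bigr => j _; rewrite BB'.
rewrite muleA; congr (_ * _); case: o oK BV BB' => [j0|] jK BV BB'.
  rewrite (bigD1 (Ordinal jK))//= [in RHS](bigD1 (Ordinal jK))//= BV lT mul1e.
  rewrite (BB' (m0, None)) ?xpair_eqE ?andbF//.
  apply: (etrans (esym (muleA _ _ _))); congr (_ * (_ * _)); apply: eq_bigr => j jne.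
  rewrite BB'//; apply: contra jne => /eqP[je]; exact/eqP/val_inj.
rewrite BV lT mule1 muleC; congr (_ * _); apply: eq_bigr => j _.
by rewrite BB'// xpair_eqE andbF.
Qed.

(** A pi-system for the environment together with all sites other than V: [B V = setT] leaves V
    unconstrained. *)
Definition away (V : site) : set (set Omega) :=
  [set H | exists2 A, sigma_env env A & exists N K B, B V = setT /\ H = A `&` site_event N K B].

Local Notation awayT V := (g_sigma_algebraType (away V)).

Lemma away_measurable V : away V `<=` measurable.
Proof.
move=> _ [A EA [N [K [B [_ ->]]]]]; apply: measurableI; last exact: measurable_site_event.
exact: sigma_env_measurable.
Qed.

Lemma site_event_widen N K N' K' B : (N <= N')%N -> (K <= K')%N ->
  site_event N K B = site_event N' K' (fun s => if box N K s then B s else setT).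
Proof.
move=> NN KK; apply/seteqP; split => w h s bs; first by case: ifPn => // /h.
have := h s; rewrite bs; apply; case: s bs => m [j|] /andP[/= mN jK]; apply/andP; split => //=.
- exact: leq_trans mN NN.
- exact: leq_trans jK KK.
- exact: leq_trans mN NN.
Qed.

Lemma sigma_env_setI (A B : set Omega) : sigma_env env A -> sigma_env env B ->
  sigma_env env (A `&` B).
Proof. by move=> EA EB; exact: (@measurableI _ envT). Qed.

Lemma away_setI V : setI_closed (away V).
Proof.
move=> _ _ [A EA [N [K [B [BV ->]]]]] [A' EA' [N' [K' [B' [B'V ->]]]]].
exists (A `&` A'); first exact: sigma_env_setI.
exists (maxn N N'), (maxn K K').
exists (fun s => (if box N K s then B s else setT) `&` (if box N' K' s then B' s else setT)).
split; first by rewrite BV B'V !if_same setTI.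
rewrite (site_event_widen B (leq_maxl N N') (leq_maxl K K')).
rewrite (site_event_widen B' (leq_maxr N N') (leq_maxr K K')).
rewrite setIACA; congr (_ `&` _); apply/seteqP; split => w.
  by move=> [h h'] s bs; split; [exact: h|exact: h'].
by move=> h; split => s bs; have [] := h s bs.
Qed.

Lemma away_setT V : away V setT.
Proof.
exists setT; first exact: (@measurableT _ envT).
exists 0%N, 0%N, (fun=> setT); split => //.
by rewrite setTI; apply/seteqP; split.
Qed.

Lemma measurable_site_law_eval s B : measurable_fun setT (fun w => site_law s w B).
Proof.
apply: (measurable_sub genv_measurable (h := fun w => site_law s w B)).
exact: measurable_pprobability (measurable_site_law s).
Qed.

Lemma measurable_site_prod N K B :
  measurable_fun (setT : set envT) (site_prod N K B : envT -> \bar R).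
Proof.
have [+ _] := indep N K (fun m j => B (m, Some j)) (fun m => B (m, None)).
by move=> h _ C mC; rewrite setTI; exact: h.
Qed.

(** On the pi-system, constraining V to C multiplies the product of laws by an
    environment-measurable factor, and such a weight passes through the conditional probability.
    Thus V keeps its law when all other sites are known as well. *)
Lemma one_site V C A : <<s away V >> A ->
  \int[P]_(w in A) (\1_(site_var V @^-1` C) w)%:E = \int[P]_(w in A) site_law V w C.
Proof.
have mV : measurable (site_var V @^-1` C).
  by rewrite -[_ @^-1` _]setTI; exact: measurable_site_var.
have mf := measurable_EFin_indic (R := R) mV.
have f0 w : 0 <= (\1_(site_var V @^-1` C) w)%:E :> \bar R by rewrite lee_fin.
have mg := measurable_site_law_eval V C.
have g0 w : 0 <= site_law V w C by [].
move=> AA; apply: (@g_sigma_algebra_measure_unique _ R Omega (away V) _ (fun=> setT) _ _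
  (density P mf f0) (density P mg g0)) => //.
- exact: away_measurable.
- by move=> _; exact: away_setT.
- by apply/seteqP; split => // w _; exists 0%N.
- exact: away_setI.
- move=> _ [A' EA' [N [K [B [BV ->]]]]].
  rewrite /density /= /density_measure.
  (* The box is enlarged to contain V; the 0 is a dummy for the immigration site. *)
  pose j0 := if V.2 is Some j then j else 0%N.
  pose N' := maxn N V.1.+1; pose K' := maxn K j0.+1.
  rewrite (site_event_widen B (leq_maxl N V.1.+1) (leq_maxl K j0.+1)) -/N' -/K'.
  set B1 := fun s => if box N K s then B s else setT.
  have B1V : B1 V = setT by rewrite /B1 BV if_same.
  pose B2 s := if s == V then C else B1 s.
  have bV : box N' K' V.
    by rewrite /box /N' /K' /j0; case: (V) => m [j|] /=; rewrite !leq_max !leqnn !orbT.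
  have mE B0 := measurable_site_event N' K' B0.
  have mA' := sigma_env_measurable EA'.
  transitivity (\int[P]_(w in A') (\1_(site_event N' K' B2) w)%:E).
    rewrite !integral_indic//; last exact: measurableI.
    congr (P _); apply/seteqP; split => w.
      move=> [h [Aw h']]; split => // s bs; rewrite /B2; case: eqP => [->//|_]; exact: h'.
    move=> [h Aw]; split; first by have := h V bV; rewrite /B2 eqxx.
    split => // s bs; have := h s bs; rewrite /B2; case: eqP => // -> _.
    by rewrite B1V.
  rewrite -site_cond//.
  have E w : site_prod N' K' B2 w = site_law V w C * site_prod N' K' B1 w.
    rewrite (site_prod_upd (B := B1) (V := V))//; first by rewrite /B2 eqxx.
    by move=> s /negPf sV; rewrite /B2 sV.
  rewrite (eq_integral _ _ (fun w _ => E w)) integral_mkcond [RHS]integral_mkcond.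
  transitivity (\int[P]_w ((\1_A' w)%:E * site_law V w C * site_prod N' K' B1 w)).
    apply: eq_integral => w _; rewrite patchE indicE.
    by case: (_ \in _); rewrite ?mul1e ?mul0e.
  have mW : measurable_fun (setT : set envT)
      (fun w : envT => (\1_A' w)%:E * site_law V w C).
    apply: emeasurable_funM.
      by apply/measurable_EFinP; exact: (@measurable_indic _ envT).
    exact: measurable_pprobability (measurable_site_law V).
  rewrite (integral_weight genv_measurable (f := site_prod N' K' B1)
    (g := fun w => (\1_(site_event N' K' B1) w)%:E) _ _ _ _ _ _ _ mW) //.
  + apply: eq_integral => w _; rewrite patchE !indicE in_setI.
    by case: (_ \in _); case: (_ \in _); rewrite ?mul1e ?mul0e ?mule1 ?mule0.
  + exact: (measurable_sub genv_measurable (measurable_site_prod N' K' B1)).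
  + exact: measurable_EFin_indic.
  + by move=> w; exact: site_prod_ge0.
  + by move=> w; exact: site_prod_fin.
  + by move=> A0 EA0; exact: site_cond.
  + by move=> w; rewrite mule_ge0// lee_fin.
- move=> _; rewrite /density /= /density_measure integral_indic// setIT.
  by rewrite (le_lt_trans (probability_le1 _ _))// ltry.
Qed.

End Sites.

(** * Integrating out one generation at a time *)

Section Step.
Context {d : measure_display} {Omega : measurableType d} {R : realType}.
Variable P : probability Omega R.
Variable env : nat -> {RV P >-> mark R}.
Variable xi : nat -> nat -> {RV P >-> nat}.
Variable eta : nat -> {RV P >-> nat}.
Hypothesis indep : cond_indep_given_env env xi eta.

Local Notation genv := (\bigcup_n sigma_mark env n).
Local Notation envT := (g_sigma_algebraType genv).
Local Notation awayT V := (g_sigma_algebraType (away env xi eta V)).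

Lemma away_site_var (V s : site) : s != V ->
  measurable_fun (setT : set (awayT V)) (site_var xi eta s : awayT V -> nat).
Proof.
move=> sV _ B mB; rewrite setTI; apply: sub_sigma_algebra; exists setT.
  exact: (@measurableT _ envT).
exists s.1.+1, (if s.2 is Some j then j.+1 else 0%N), (fun s' => if s' == s then B else setT).
rewrite eq_sym (negPf sV); split => //; rewrite setTI; apply/seteqP; split => w.
  by move=> h s' _; case: eqP => // ->.
move=> h; have := h s; rewrite eqxx; apply; rewrite /box ltnSn /=.
by case: (s.2) => /=.
Qed.

Lemma away_env V d' (U : measurableType d') (h : Omega -> U) :
  measurable_fun (setT : set envT) (h : envT -> U) ->
  measurable_fun (setT : set (awayT V)) (h : awayT V -> U).
Proof.
move=> mh _ B mB; rewrite setTI; apply: sub_sigma_algebra; exists (h @^-1` B).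
  by rewrite -[_ @^-1` _]setTI; exact: mh.
by exists 0%N, 0%N, (fun=> setT); split => //; apply/seteqP; split => [w|w []].
Qed.

(** Z_m uses sites of generations before m, and V lies in generation m or later. *)
Lemma away_Zproc V i m : (m <= V.1)%N ->
  measurable_fun (setT : set (awayT V)) (Zproc xi eta i m : awayT V -> nat).
Proof.
elim: m => [_|m IH mV] /=; first exact: measurable_cst.
have ne o : (m, o) != V by apply: contraTneq mV => <-; rewrite ltnn.
apply: (measurable_nat_comp2 addn); last exact: (away_site_var (ne None)).
apply: (@measurable_glue _ _ (awayT V) _ (Zproc xi eta i m) (fun k w => \sum_(j < k) xi m j w)%N); first exact: IH (ltnW mV).
move=> k; apply: (@measurable_sum_nat _ (awayT V) (fun j => xi m j)) => j _; exact: (away_site_var (ne (Some j))).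
Qed.

Lemma measurable_Zproc i n : measurable_fun setT (Zproc xi eta i n).
Proof.
apply: (measurable_sub (@away_measurable _ _ _ _ env xi eta (n, None))).
exact: away_Zproc.
Qed.

Lemma site_integral V (W : nat -> Omega -> \bar R) :
  (forall c, measurable_fun (setT : set (awayT V)) (W c : awayT V -> \bar R)) ->
  (forall c w, 0 <= W c w) ->
  \int[P]_w W (site_var xi eta V w) w =
  \int[P]_w (\int[site_law env V w : probability nat R]_c W c w).
Proof.
move=> mW W0; have am := @away_measurable _ _ _ _ env xi eta V.
have mWT c := measurable_sub am (mW c).
have ml c := measurable_site_law_eval env V [set c].
have mv c : measurable (site_var xi eta V @^-1` [set c]).
  by rewrite -[_ @^-1` _]setTI; exact: measurable_site_var.
rewrite (integral_partition P (h := W))//; last exact: measurable_site_var.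
transitivity (\sum_(c <oo) \int[P]_w (W c w * site_law env V w [set c])).
  apply: eq_eseriesr => c _.
  apply: (integral_weight am _ _ _ _ _ _ _ (mW c)) => //.
  - exact: measurable_EFin_indic.
  - by move=> w; exact: site_law_fin.
  - by move=> A AA; exact: one_site.
rewrite -integral_nneseries//; last 2 first.
- by move=> c; exact: emeasurable_funM.
- by move=> c w _; rewrite mule_ge0.
by apply: eq_integral => w _; rewrite integral_nat.
Qed.

Definition partial (n k : nat) (w : Omega) : nat := (\sum_(j < k) xi n j w + eta n.+1 w)%N.

(** Sites are integrated out one by one, the last individual first and the immigrants at the end.
    [H] carries information on the past and must ignore every site of generation n. *)
Lemma offspring_integral n k (F : nat -> Omega -> \bar R) (H : Omega -> \bar R) :
  (forall c, measurable_fun (setT : set envT) (F c : envT -> \bar R)) ->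
  (forall c w, 0 <= F c w) -> (forall w, 0 <= H w) ->
  (forall o, measurable_fun (setT : set (awayT (n, o))) (H : awayT (n, o) -> \bar R)) ->
  \int[P]_w (F (partial n k w) w * H w) =
  \int[P]_w (quenched_step (env n w) (F ^~ w) k * H w).
Proof.
move=> mF F0 H0 mH; elim: k F mF F0 => [|k IH] F mF F0.
  rewrite /partial /quenched_step /=.
  under eq_integral do rewrite big_ord0 add0n.
  rewrite (@site_integral (n, None) (fun c w => F c w * H w))//.
  - by apply: eq_integral => w _; rewrite ge0_integralZr// => c _; exact: F0.
  - by move=> c; apply: emeasurable_funM => //; exact: away_env.
  - by move=> c w; rewrite mule_ge0.
pose F' c w := add_offspring (env n w).1 (F ^~ w) c.
have F'0 c w : 0 <= F' c w by exact: add_offspring_ge0.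
have mF' c : measurable_fun (setT : set envT) (F' c : envT -> \bar R).
  apply: (@measurable_iter_add_offspring R _ envT (env n) (fun w c => F c w) 1) => //.
  exact: measurable_env.
have -> : \int[P]_w (quenched_step (env n w) (F ^~ w) k.+1 * H w) =
    \int[P]_w (quenched_step (env n w) (F' ^~ w) k * H w).
  apply: eq_integral => w _; congr (_ * _); apply: eq_integral => y _.
  by rewrite iterSr.
rewrite -IH//.
have E w : partial n k.+1 w = (partial n k w + xi n k w)%N.
  by rewrite /partial big_ord_recr /= addnAC.
under eq_integral do rewrite E.
have ne o : o != Some k -> (n, o) != (n, Some k) :> site.
  by move=> ok; rewrite xpair_eqE eqxx.
rewrite (@site_integral (n, Some k) (fun c w => F (partial n k w + c)%N w * H w))//.
- by apply: eq_integral => w _; rewrite /F' /add_offspring ge0_integralZr.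
- move=> c; apply: emeasurable_funM => //.
  apply: (@measurable_glue _ _ (awayT (n, Some k)) _ (partial n k) (fun l w => F (l + c)%N w)); last first.
    by move=> l; exact: away_env.
  apply: (measurable_nat_comp2 addn); last exact: (away_site_var (ne None isT)).
  apply: (@measurable_sum_nat _ (awayT (n, Some k)) (fun j => xi n j)) => j jk; apply: (away_site_var (ne (Some j) _)).
  by apply: contraTneq jk => -[->]; rewrite ltnn.
- by move=> c w; rewrite mule_ge0.
Qed.

Lemma env_quenched_step n (F : nat -> Omega -> \bar R) k :
  (forall c, measurable_fun (setT : set envT) (F c : envT -> \bar R)) ->
  (forall c w, 0 <= F c w) ->
  measurable_fun (setT : set envT) (fun w : envT => quenched_step (env n w) (F ^~ w) k).
Proof.
move=> mF F0; apply: (@measurable_quenched_step R _ envT (env n) (fun w c => F c w)) => //.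
exact: measurable_env.
Qed.

Lemma step_integral i n (F : nat -> Omega -> \bar R) :
  (forall c, measurable_fun (setT : set envT) (F c : envT -> \bar R)) ->
  (forall c w, 0 <= F c w) ->
  \int[P]_w F (Zproc xi eta i n.+1 w) w =
  \int[P]_w quenched_step (env n w) (F ^~ w) (Zproc xi eta i n w).
Proof.
move=> mF F0.
have sub_env (h : Omega -> \bar R) : measurable_fun (setT : set envT) (h : envT -> \bar R) ->
    measurable_fun setT h by exact: (measurable_sub (@genv_measurable _ _ _ _ env)).
have mZ := measurable_Zproc i n.
have mpart k : measurable_fun setT (partial n k).
  apply: (measurable_nat_comp2 addn); last exact: measurable_funPT.
  by apply: (@measurable_sum_nat _ Omega (fun j => xi n j)) => j _; exact: (measurable_funPT (xi n j)).
rewrite -[LHS]/(\int[P]_w ((fun k w => F (partial n k w) w) (Zproc xi eta i n w) w)).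
rewrite (integral_partition P (h := fun k w => F (partial n k w) w))//; last first.
  by move=> k; apply: measurable_glue => // c; exact: sub_env.
rewrite (integral_partition P (h := fun k w => quenched_step (env n w) (F ^~ w) k))//; last 2 first.
- move=> k; apply: sub_env; exact: env_quenched_step.
- by move=> k w; exact: quenched_step_ge0.
(* The weight is the indicator of Z_n = k, which ignores the sites of generation n. *)
apply: eq_eseriesr => k _; apply: offspring_integral => // o.
apply/measurable_EFinP; apply: (@measurable_indic _ (awayT (n, o))).
by rewrite -[_ @^-1` _]setTI; exact: away_Zproc.
Qed.

(** [F] may depend on the environment because removing the newest generation turns it into a
    [quenched_step], which does. *)
Lemma quenched_integral i n (F : nat -> Omega -> \bar R) :
  (forall c, measurable_fun (setT : set envT) (F c : envT -> \bar R)) ->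
  (forall c w, 0 <= F c w) ->
  \int[P]_w F (Zproc xi eta i n w) w =
  \int[P]_w quenched n (reindex (rev n) (env ^~ w)) (F ^~ w) i.
Proof.
elim: n F => [//|n IH] F mF F0; rewrite step_integral//.
rewrite (IH (fun k w => quenched_step (env n w) (F ^~ w) k)); last 2 first.
- move=> c; exact: env_quenched_step.
- by move=> c w; exact: quenched_step_ge0.
apply: eq_integral => w _; rewrite quenched_shift; congr (_ i).
have -> : reindex (rev n.+1) (fun k => env k w) 0%N = env n w by rewrite /reindex /rev subn1.
apply: eq_quenched => k kn.
by rewrite /reindex /rev ltnS kn subSS.
Qed.

Lemma quenched_integral_env i n (A : set Omega) (f : nat -> \bar R) :
  sigma_env env A -> (forall c, 0 <= f c) ->
  \int[P]_(w in A) f (Zproc xi eta i n w) =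
  \int[P]_(w in A) quenched n (reindex (rev n) (env ^~ w)) f i.
Proof.
move=> EA f0; rewrite integral_mkcond [RHS]integral_mkcond.
transitivity (\int[P]_w ((\1_A w)%:E * f (Zproc xi eta i n w))).
  apply: eq_integral => w _; rewrite patchE indicE.
  by case: (_ \in _); rewrite ?mul1e ?mul0e.
rewrite (@quenched_integral i n (fun c w => (\1_A w)%:E * f c)); last 2 first.
- move=> c; apply: emeasurable_funM; last exact: measurable_cst.
  by apply/measurable_EFinP; exact: (@measurable_indic _ envT).
- by move=> c w; rewrite mule_ge0// lee_fin.
apply: eq_integral => w _; rewrite patchE indicE quenchedZ//.
by case: (_ \in _); rewrite ?mul1e ?mul0e.
Qed.

End Step.

Local Close Scope ereal_scope.

(** * Uniform limits of laws *)

Section LimitLaw.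
Context {R : realType} (q : nat -> probability nat R).
Hypothesis q_cauchy : forall e : R, 0 < e -> exists N, forall n n' A,
  (N <= n)%N -> (N <= n')%N -> `|pr (q n) A - pr (q n') A| <= e.

Definition limit_pr (A : set nat) : R := limn (fun n => pr (q n) A).

Lemma limit_pr_cvg A : pr (q n) A @[n --> \oo] --> limit_pr A.
Proof.
apply/cauchy_cvgP/cauchy_exP => e e0; have [|N HN] := q_cauchy (e := e / 2); first by lra.
exists (pr (q N) A); exists N => // n /= Nn; rewrite /ball /=.
by apply: (le_lt_trans (HN N n A (leqnn N) Nn)); lra.
Qed.

Lemma limit_pr_unif e : 0 < e -> exists N, forall n A, (N <= n)%N ->
  `|pr (q n) A - limit_pr A| <= e.
Proof.
move=> e0; have [N HN] := q_cauchy e0; exists N => n A Nn.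
have H : `|pr (q n) A - pr (q m) A| @[m --> \oo] --> `|pr (q n) A - limit_pr A|.
  by apply: cvg_norm; apply: cvgB; [exact: cvg_cst|exact: limit_pr_cvg].
rewrite -(cvg_lim _ H)//; apply: limr_le; first by apply/cvg_ex; eexists; exact: H.
by exists N => // m /= Nm; exact: HN.
Qed.

Definition limit_measure (A : set nat) : \bar R := (limit_pr A)%:E.

Let limit_measure0 : limit_measure set0 = 0%E.
Proof.
rewrite /limit_measure; congr EFin; apply: cvg_lim => //.
by rewrite /pr; under eq_fun do rewrite measure0; exact: cvg_cst.
Qed.

Let limit_measure_ge0 A : (0 <= limit_measure A)%E.
Proof.
rewrite lee_fin; apply: limr_ge; first by apply/cvg_ex; eexists; exact: limit_pr_cvg.
by apply: nearW => n; exact: pr_ge0.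
Qed.

Let limit_prU (F : nat -> set nat) n : trivIset setT F ->
  \sum_(k < n) limit_pr (F k) = limit_pr [set x | exists2 k, (k < n)%N & F k x].
Proof.
move=> tF; apply/esym/cvg_lim => //.
rewrite (_ : (fun m => _) = fun m => \sum_(k < n) pr (q m) (F k)); last first.
  apply/funext => m; apply: pr_sum => // i j x _ _ Fi Fj.
  by apply: (tF i j) => //; exists x.
elim: n => [|n IH]; first by rewrite big_ord0; under eq_fun do rewrite big_ord0; exact: cvg_cst.
rewrite big_ord_recr /=; under eq_fun do rewrite big_ord_recr /=.
by apply: cvgD => //; exact: limit_pr_cvg.
Qed.

(** Uniform convergence lets a single law [q N], itself sigma-additive, control the finite unions
    and the full one: e/4 for each approximation and e/2 for the convergence under [q N]. *)
Let limit_measure_additive : semi_sigma_additive limit_measure.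
Proof.
move=> F mF tF mU; rewrite /limit_measure.
under eq_fun do rewrite big_mkord sumEFin limit_prU//.
apply/fine_cvgP; split; first by apply: nearW.
apply/cvgrPdist_le => e e0; have [|N HN] := limit_pr_unif (e := e / 4); first by lra.
have E n : (\sum_(k < n) q N (F k))%E = (pr (q N) [set x | exists2 k, (k < n)%N & F k x])%:E.
  rewrite pr_sum//; first by rewrite -sumEFin; apply: eq_bigr => k _; exact: prE.
  by move=> i j x _ _ Fi Fj; apply: (tF i j) => //; exists x.
have : (pr (q N) [set x | exists2 k, (k < n)%N & F k x])%:E @[n --> \oo] -->
    (pr (q N) (\bigcup_n F n))%:E.
  rewrite -(prE (q N) mU); under eq_fun do rewrite -E -(big_mkord xpredT (fun k => q N (F k))).
  exact: (@measure_semi_sigma_additive _ _ _ (q N) F mF tF mU).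
move=> /fine_cvgP[_ /cvgrPdist_le] /(_ (e / 2)) H.
have {H} [|M _ HM] := H; first by lra.
exists M => // n /= Mn; have := HM n Mn; rewrite /=.
have := HN N (\bigcup_n F n) (leqnn N); have := HN N [set x | exists2 k, (k < n)%N & F k x] (leqnn N).
by rewrite !ler_norml; lra.
Qed.

HB.instance Definition _ := isMeasure.Build _ _ _
  limit_measure limit_measure0 limit_measure_ge0 limit_measure_additive.

Let limit_measureT : limit_measure setT = 1%E.
Proof.
rewrite /limit_measure; congr EFin; apply: cvg_lim => //.
by under eq_fun do rewrite prT; exact: cvg_cst.
Qed.

HB.instance Definition _ := Measure_isProbability.Build _ _ _ limit_measure limit_measureT.

Definition limit_law : probability nat R := limit_measure.

Lemma limit_law_unif e : 0 < e -> exists N, forall n A, (N <= n)%N ->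
  `|pr (q n) A - pr limit_law A| <= e.
Proof. exact: limit_pr_unif. Qed.

End LimitLaw.

(** * Averaging over the environment *)

Section Annealed.
Context {R : realType} (mu : probability (seqspace (T := mark R)) R) (b : R).
Hypothesis iid : iid_law mu.
Local Notation L := (@neg_log_mean R).
Hypothesis cL : centered mu L.
Hypothesis b0 : 0 <= b.
Hypothesis gd : {ae mu, forall x, forall k, good_mark b (x k)}.
Local Notation p n := (survival mu L n 0).

(** For m < n the marks older than the newest m act through the survival event alone, and i is the
    state just before these m marks. *)
Definition annealed m n (f : nat -> \bar R) i : \bar R :=
  (\int[mu]_x (quenched m x f i * (\1_(stay L n 0) x)%:E))%E.

Definition ind (A : set nat) (k : nat) : \bar R := (\1_A k)%:E.

Lemma ind_01 A k : (0 <= ind A k <= 1)%E.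
Proof. by rewrite /ind indicE !lee_fin; case: (_ \in _); rewrite ?lexx ?ler01. Qed.

Lemma ind_ge0 A k : (0 <= ind A k)%E. Proof. by case/andP: (ind_01 A k). Qed.

Lemma lipschitz_ind A : lipschitz_nat (R := R) (ind A) 1.
Proof.
move=> k; rewrite /ind -!EFinD !lee_fin !indicE.
by case: (_ \in _); case: (_ \in _) => /=; split; lra.
Qed.

Lemma measurable_stay_indic n : measurable_fun setT (fun x => (\1_(stay L n 0) x)%:E : \bar R).
Proof. by apply: measurable_EFin_indic; apply: measurable_stay; exact: measurable_neg_log_mean. Qed.

Lemma annealed_ge0 m n f i : (forall k, 0 <= f k)%E -> (0 <= annealed m n f i)%E.
Proof. by move=> f0; apply: integral_ge0 => x _; rewrite mule_ge0// quenched_ge0. Qed.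

Lemma annealed_diff : exists2 D : R, 0 < D & forall m n (f : nat -> \bar R) i,
  (forall k, 0 <= f k)%E -> lipschitz_nat f 1 -> (m <= n)%N ->
  let r := ((b + i%:R) * (D / rt4 m * p n))%:E in
  (annealed n n f i <= annealed m n f 0%N + r /\ annealed m n f 0%N <= annealed n n f i + r)%E.
Proof.
have [D D0 HD] := exp_stay_tail iid cL; exists D => // m n f i f0 f1 mn r.
have bi0 : 0 <= b + i%:R by rewrite addr_ge0.
pose s (x : seqspace (T := mark R)) := \sum_(m <= k < n.+1) expR (- rwalk L k x).
have s0 x : 0 <= s x by apply: sumr_ge0 => k _; exact: expR_ge0.
have ms : measurable_fun setT s.
  apply: measurable_sum => k; apply: measurableT_comp => //; apply: measurableT_comp => //.
  by apply: measurable_rwalk; exact: measurable_neg_log_mean.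
have mr : measurable_fun setT (fun x => ((b + i%:R) * s x)%:E).
  by apply/measurable_EFinP; exact: measurable_funM.
have mi := measurable_stay_indic n.
have key (u v : seqspace (T := mark R) -> \bar R) : measurable_fun setT u -> measurable_fun setT v ->
    (forall x, 0 <= u x)%E -> (forall x, 0 <= v x)%E ->
    {ae mu, forall x, (u x <= v x + ((b + i%:R) * s x)%:E)%E} ->
    (\int[mu]_x (u x * (\1_(stay L n 0) x)%:E) <= \int[mu]_x (v x * (\1_(stay L n 0) x)%:E) + r)%E.
  move=> mu_ mv u0 v0 uv.
  apply: (@le_trans _ _ (\int[mu]_x (v x * (\1_(stay L n 0) x)%:E +
      ((b + i%:R) * s x)%:E * (\1_(stay L n 0) x)%:E))%E).
    apply: ae_ge0_le_integral => //.
    - by move=> x _; rewrite mule_ge0.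
    - exact: emeasurable_funM.
    - move=> x _; rewrite adde_ge0 ?mule_ge0// lee_fin mulr_ge0//.
    - by apply: emeasurable_funD; exact: emeasurable_funM.
    - apply: filterS uv => x /= h _; rewrite -ge0_muleDl// ?lee_fin ?mulr_ge0//.
      exact: lee_wpmul2r.
  rewrite ge0_integralD//; last 4 first.
  - by move=> x _; rewrite mule_ge0.
  - exact: emeasurable_funM.
  - by move=> x _; rewrite mule_ge0// lee_fin mulr_ge0.
  - exact: emeasurable_funM.
  rewrite leeD2l// /r.
  under eq_integral do rewrite EFinM -muleA.
  rewrite ge0_integralZl//; last 2 first.
  - by apply: emeasurable_funM => //; exact/measurable_EFinP.
  - by move=> x _; rewrite mule_ge0// lee_fin.
  rewrite EFinM; apply: lee_wpmul2l; first by rewrite lee_fin.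
  apply: (le_trans _ (HD m n)); rewrite le_eqVlt; apply/orP; left; apply/eqP.
  rewrite -ge0_integral_sum//; last first.
    move=> k; apply/measurable_EFinP; apply: measurable_funM.
      apply: measurableT_comp => //; apply: measurableT_comp => //.
      by apply: measurable_rwalk; exact: measurable_neg_log_mean.
    by apply: measurable_indic; apply: measurable_stay; exact: measurable_neg_log_mean.
  by apply: eq_integral => x _; rewrite sumEFin -mulr_suml EFinM.
split; apply: key; try (by move=> x; exact: quenched_ge0); try exact: measurable_quenched.
  by apply: (@filterS _ (almost_everywhere mu) (ae_filter_ringOfSetsType mu) _ _ _ gd) => x gx; case: (@quenched_diff _ b m n x f i gx b0 f0 f1 mn).
by apply: (@filterS _ (almost_everywhere mu) (ae_filter_ringOfSetsType mu) _ _ _ gd) => x gx; case: (@quenched_diff _ b m n x f i gx b0 f0 f1 mn).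
Qed.

Lemma annealed_ind_le m n A i : (annealed m n (ind A) i <= (p n)%:E)%E.
Proof.
have mS : measurable (stay L n 0) by apply: measurable_stay; exact: measurable_neg_log_mean.
rewrite -prE// -integral_indicT//; apply: ge0_le_integral => //.
- by move=> x _; rewrite mule_ge0// quenched_ge0// => k; exact: ind_ge0.
- apply: emeasurable_funM; last exact: measurable_stay_indic.
  by apply: measurable_quenched => k; exact: ind_ge0.
- exact: measurable_stay_indic.
- move=> x _; rewrite -[leRHS]mul1e; apply: lee_wpmul2r => //.
  by apply: quenched_le1 => k; exact: ind_01.
Qed.

Lemma annealed_ind_fin m n A i : annealed m n (ind A) i \is a fin_num.
Proof.
rewrite ge0_fin_numE; last by apply: annealed_ge0 => k; exact: ind_ge0.
by rewrite (le_lt_trans (annealed_ind_le m n A i))// ltry.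
Qed.

Definition annealed_pr m n A i : R := fine (annealed m n (ind A) i) / p n.

(** Three errors of e/3: forgetting the old marks and the initial state in each term, and the law of
    the newest marks given survival. Both terms are compared with a process started from 0, so i and
    i' may differ. *)
Lemma annealed_pr_cauchy i i' e : 0 < e -> exists N, forall n n' A,
  (N <= n)%N -> (N <= n')%N -> `|annealed_pr n n A i - annealed_pr n' n' A i'| <= e.
Proof.
move=> e0; have [D D0 HD] := annealed_diff.
have approx m n A j : (m <= n)%N ->
    `|annealed_pr n n A j - annealed_pr m n A 0%N| <= (b + j%:R) * (D / rt4 m).
  move=> mn; have [] := HD m n (ind A) j (ind_ge0 A) (@lipschitz_ind A) mn.
  rewrite /annealed_pr -(fineK (annealed_ind_fin n n A j)) -(fineK (annealed_ind_fin m n A 0%N)).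
  have p0 := survival_gt0 iid n cL.
  rewrite -!EFinD !lee_fin /= -mulrBl normrM (gtr0_norm (x := _^-1)) ?invr_gt0//.
  by move=> h1 h2; rewrite ler_pdivrMr// -!mulrA ler_norml; lra.
have [M HM] := rt4_large (3 * ((b + i%:R + i'%:R) * D) / e).
have small j : (j <= i + i')%N -> (b + j%:R) * (D / rt4 M.+1) <= e / 3.
  move=> ji; have r0 := rt4_gt0 (R := R) M.+1.
  rewrite mulrA ler_pdivrMr//; have := HM M.+1 (leqnSn M).
  rewrite ler_pdivrMr// => h.
  have : (b + j%:R) * D <= (b + i%:R + i'%:R) * D.
    by rewrite ler_pM2r// -addrA -natrD lerD2l ler_nat.
  by lra.
have e30 : 0 < e / 3 by lra.
have [N HN] := conditioned_cauchy iid M cL e30.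
exists (M.+1 + N)%N => n n' A Nn Nn'.
have Mn : (M.+1 <= n)%N by rewrite (leq_trans _ Nn)// leq_addr.
have Mn' : (M.+1 <= n')%N by rewrite (leq_trans _ Nn')// leq_addr.
(* A function of the newest M + 1 marks with values in [0, 1], hence admissible in
   [conditioned_cauchy]. *)
pose F (x : seqspace (T := mark R)) := fine (quenched M.+1 x (ind A) 0%N).
have F01 x : 0 <= F x <= 1.
  have h0 : (0 <= quenched M.+1 x (ind A) 0)%E by apply: quenched_ge0 => k; exact: ind_ge0.
  have h1 : (quenched M.+1 x (ind A) 0 <= 1)%E by apply: quenched_le1 => k; exact: ind_01.
  have hf : quenched M.+1 x (ind A) 0 \is a fin_num by rewrite ge0_fin_numE// (le_lt_trans h1)// ltry.
  by rewrite -!lee_fin /F fineK// h0 h1.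
have FE l : annealed_pr M.+1 l A 0 = (\int[mu]_x (F x * \1_(stay L l 0) x)) / p l.
  rewrite /annealed_pr; congr (fine _ / _); apply: eq_integral => x _; rewrite EFinM /F fineK//.
  have h0 : (0 <= quenched M.+1 x (ind A) 0)%E by apply: quenched_ge0 => k; exact: ind_ge0.
  rewrite ge0_fin_numE//; apply: le_lt_trans (ltry 1).
  by apply: quenched_le1 => k; exact: ind_01.
have mF : measurable_fun setT F.
  apply: measurableT_comp => //; apply: measurable_quenched => k; exact: ind_ge0.
have FS x y : F (splice M.+1 (x, y)) = F x.
  rewrite /F (@eq_quenched _ _ (splice M.+1 (x, y)) x)// => k kM.
  by rewrite /splice /= kM.
have := HN (n - M.+1)%N (n' - M.+1)%N F _ _ mF F01 FS; rewrite !subnKC// -!FE.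
move=> H; have {}H := H ltac:(lia) ltac:(lia).
have h1 := le_trans (approx _ _ A i Mn) (small i (leq_addr _ _)).
have h2 := le_trans (approx _ _ A i' Mn') (small i' (leq_addl _ _)).
by move: h1 h2 H; rewrite !ler_norml; lra.
Qed.

(** The case m = 0 of [annealed_diff] for the identity: no mark is kept, and the identity vanishes
    at 0. *)
Lemma annealed_mean : exists C : R, forall n i,
  (annealed n n (fun k => k%:R%:E) i <= ((b + i%:R) * C * p n)%:E)%E.
Proof.
have [D D0 HD] := annealed_diff; exists (D / rt4 0) => n i.
have [|||] := HD 0%N n (fun k => k%:R%:E) i.
- by move=> k; rewrite lee_fin.
- by move=> k; rewrite -!EFinD !lee_fin -natr1; split; lra.
- by [].
move=> + _; rewrite {2}/annealed /=; under eq_integral do rewrite mul0e.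
by rewrite integral0 add0e -!mulrA.
Qed.

End Annealed.

(** * The process seen from the environment *)

Section EnvironmentLaw.
Context {d : measure_display} {Omega : measurableType d} {R : realType}.
Variable P : probability Omega R.
Variable env : nat -> {RV P >-> mark R}.

Definition env_path (w : Omega) : seqspace (T := mark R) := fun n => env n w.

Lemma measurable_env_path : measurable_fun setT env_path.
Proof. by apply: measurable_to_seqspace => n; exact: measurable_funPT. Qed.

HB.instance Definition _ := isMeasurableFun.Build _ _ _ _ env_path measurable_env_path.

Definition env_law : probability (seqspace (T := mark R)) R := distribution P env_path.

Lemma integral_env_law (F : seqspace (T := mark R) -> \bar R) :
  measurable_fun setT F -> (forall x, 0 <= F x)%E ->
  (\int[env_law]_x F x = \int[P]_w F (env_path w))%E.
Proof. by move=> mF F0; rewrite ge0_integral_distribution. Qed.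

Lemma iid_env_law : mutually_independent P (fun n => env n : Omega -> mark R) ->
  identically_distributed P (fun n => env n : Omega -> mark R) -> iid_law env_law.
Proof.
move=> ind idt s B us mB; rewrite [LHS](ind s B us mB); apply: eq_bigr => n _.
by rewrite idt.
Qed.

Local Notation L := (@neg_log_mean R).

Lemma log_meanE n w : log_mean env n w = - L (env_path w n).
Proof. by rewrite /neg_log_mean opprK. Qed.

Lemma walkE n w : walk env n w = - rwalk L n (env_path w).
Proof. by rewrite /walk /rwalk -sumrN; apply: eq_bigr => k _; exact: log_meanE. Qed.

Lemma centered_env_law : ('E_P[log_mean env 0] = 0)%E ->
  (0 < 'V_P[log_mean env 0] < +oo)%E -> centered env_law L.
Proof.
move=> hE; have mL : measurable_fun setT L := measurable_neg_log_mean.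
have mL0 : measurable_fun setT (fun x : seqspace (T := mark R) => L (x 0%N)).
  by apply: measurableT_comp => //; exact: measurable_coord.
have mX : measurable_fun setT (fun w => L (env_path w 0%N)).
  by apply: (measurableT_comp mL0); exact: measurable_env_path.
have -> : ('V_P[log_mean env 0] = \int[env_law]_x (L (x 0%N) ^+ 2)%:E)%E.
  rewrite /variance covariance.unlock hE expectation.unlock integral_env_law//.
  - apply: eq_integral => w _; congr EFin.
    by rewrite /GRing.mul /= log_meanE subr0 mulrNN expr2.
  - by apply/measurable_EFinP; exact: measurable_funX.
  - by move=> x; rewrite lee_fin sqr_ge0.
move=> /andP[V0 Vfin].
have I2 : rintegrable env_law (fun x => L (x 0%N) ^+ 2).
  apply/integrableP; split; first by apply/measurable_EFinP; exact: measurable_funX.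
  by under eq_integral do rewrite /= ger0_norm ?sqr_ge0//.
(* Integrability of the step from its second moment, by |y| <= 1 + y^2. *)
have I1 : rintegrable env_law (fun x => L (x 0%N)).
  apply: (le_rintegrable _ _ (rintegrableD (rintegrable_cst env_law 1) I2)) => // x /=.
  rewrite [leRHS]ger0_norm; last by rewrite addr_ge0// sqr_ge0.
  rewrite ler_norml; set y := L _; have := sqr_ge0 (y - 1); have := sqr_ge0 (y + 1); nra.
have I1P : P.-integrable setT (fun w => (L (env_path w 0%N))%:E).
  apply/integrableP; split; first exact/measurable_EFinP.
  have /integrableP[_] := I1; rewrite integral_env_law//.
  by apply: measurableT_comp => //; exact/measurable_EFinP.
split => //.
- rewrite /Rintegral (@integral_distribution _ _ _ _ _ P env_path (fun x => (L (x 0%N))%:E))//; last exact/measurable_EFinP.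
  move: hE; rewrite expectation.unlock; under eq_integral do rewrite log_meanE EFinN.
  rewrite (integralN (integrable_add_def measurableT I1P)).
  move=> /eqP; rewrite oppe_eq0 => /eqP ->; by [].
- by rewrite /Rintegral fine_gt0// V0 Vfin.
Qed.

End EnvironmentLaw.

(** * Strict minimum at the end and the reversed environment *)

Lemma first_min_at_end {R : realType} (W : nat -> R) n :
  index (\big[Num.min/W 0%N]_(l < n.+1) W l) [seq W j | j <- iota 0 n.+1] = n <->
  (forall j, (j < n)%N -> W n < W j).
Proof.
set m := \big[_/_]_(_ < _) _.
have mle j : (j <= n)%N -> m <= W j.
  by move=> jn; exact: (bigmin_le _ (Ordinal (jn : (j < n.+1)%N)) (fun l : 'I_n.+1 => W l)).
have sE : [seq W j | j <- iota 0 n.+1] = [seq W j | j <- iota 0 n] ++ [:: W n].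
  by rewrite -addn1 iotaD map_cat.
split=> [h j jn|h].
  have mn : m \in [seq W j | j <- iota 0 n.+1].
    by rewrite -index_mem h size_map size_iota.
  have mW : m = W n by rewrite -(nth_index 0 mn) h (nth_map 0%N) ?size_iota ?nth_iota// add0n.
  rewrite lt_neqAle -mW mle 1?ltnW// andbT; apply/eqP => mj.
  have : index m [seq W j | j <- iota 0 n.+1] = n by [].
  rewrite sE index_cat.
  have mi : m \in [seq W j | j <- iota 0 n].
    by apply/mapP; exists j => //; rewrite mem_iota.
  by rewrite mi => iE; move: mi; rewrite -index_mem iE size_map size_iota ltnn.
have mW : m = W n.
  apply/eqP; rewrite eq_le mle//=; apply: le_bigmin => [|i _].
    by case: n h {m mle sE} => [//|n] h; exact: ltW (h _ _).
  by have := ltn_ord i; rewrite ltnS leq_eqVlt => /orP[/eqP ->//|/h /ltW].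
rewrite sE index_cat mW; case: ifPn => [/mapP[j]|_].
  by rewrite mem_iota add0n => /= jn Wj; have := h _ jn; rewrite Wj ltxx.
by rewrite /= eqxx size_map size_iota addn0.
Qed.

Section ReversedEnvironment.
Context {d : measure_display} {Omega : measurableType d} {R : realType}.
Variable P : probability Omega R.
Variable env : nat -> {RV P >-> mark R}.
Variable xi : nat -> nat -> {RV P >-> nat}.
Variable eta : nat -> {RV P >-> nat}.

Local Notation L := (@neg_log_mean R).

Lemma min_at_endE n : min_at_end env n = env_path env @^-1` (reindex (rev n) @^-1` stay L n 0).
Proof.
apply/seteqP; split => w /=; rewrite /min_at_end /tau /walk_min /=.
  move=> /(first_min_at_end (fun j => walk env j w)) h k /andP[k0 kn].
  rewrite add0r rwalk_rev// subr_gt0; have := h (n - k)%N.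
  by rewrite !walkE ltrN2; apply; lia.
move=> h; apply/(first_min_at_end (fun j => walk env j w)) => j jn.
have nj : (0 < n - j <= n)%N by lia.
have := h _ nj; rewrite add0r (rwalk_rev L (env_path env w) (leq_subr j n)) subr_gt0.
by rewrite subKn ?(ltnW jn)// !walkE ltrN2.
Qed.

Lemma measurable_pos_rev n : measurable (reindex (rev n) @^-1` stay L n 0).
Proof.
rewrite -[_ @^-1` _]setTI; apply: measurable_reindex => //.
by apply: measurable_stay; exact: measurable_neg_log_mean.
Qed.

Lemma sigma_env_path (A : set (seqspace (T := mark R))) :
  measurable A -> sigma_env env (env_path env @^-1` A).
Proof.
move=> mA; rewrite -[_ @^-1` _]setTI.
apply: (@measurable_to_seqspace _ (mark R) _ (g_sigma_algebraType (\bigcup_n sigma_mark env n)) (env_path env)) => //.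
by move=> n; exact: measurable_env.
Qed.

Lemma sigma_env_min_at_end n : sigma_env env (min_at_end env n).
Proof. by rewrite min_at_endE; apply: sigma_env_path; exact: measurable_pos_rev. Qed.

Lemma measurable_min_at_end n : measurable (min_at_end env n).
Proof. exact: sigma_env_measurable (sigma_env_min_at_end n). Qed.

Hypothesis hB : is_BPREI env xi eta.

Let iid : iid_law (env_law env).
Proof. by case: hB => h1 h2 _ _; exact: iid_env_law. Qed.

(** Event and conditional law both read the marks from newest to oldest; reversing the first n
    coordinates preserves the law of the environment and leaves a walk staying positive. *)
Lemma annealedE n (f : nat -> \bar R) i : (forall k, 0 <= f k)%E ->
  (\int[P]_(w in min_at_end env n) f (Zproc xi eta i n w) =
   annealed (env_law env) n n f i)%E.
Proof.
move=> f0; rewrite (quenched_integral_env (offspring_immigration hB))//; last exact: sigma_env_min_at_end.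
have mS : measurable (stay L n 0) by apply: measurable_stay; exact: measurable_neg_log_mean.
have mF : measurable_fun setT (fun x : seqspace (T := mark R) => quenched n x f i * (\1_(stay L n 0) x)%:E)%E.
  by apply: emeasurable_funM; [exact: measurable_quenched|exact: measurable_EFin_indic].
have F0 x : (0 <= quenched n x f i * (\1_(stay L n 0) x)%:E)%E.
  by rewrite mule_ge0 ?lee_fin//; exact: quenched_ge0.
rewrite /annealed -(integral_reindex iid (@rev_inj n) mF F0) integral_env_law//; last first.
  by apply: (measurableT_comp mF); exact: measurable_reindex.
rewrite integral_mkcond; apply: eq_integral => w _; rewrite patchE indicE.
rewrite min_at_endE; case: ifPn => [/set_mem h|/negP h].
  by rewrite mem_set ?mule1.
rewrite memNset ?mule0// => h'; apply: h; exact: mem_set.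
Qed.

Lemma pr_min_at_end n : pr P (min_at_end env n) = survival (env_law env) L n 0.
Proof.
rewrite min_at_endE -[LHS]/(pr (env_law env) (reindex (rev n) @^-1` stay L n 0)).
by rewrite (pr_reindex iid (@rev_inj n))//; apply: measurable_stay; exact: measurable_neg_log_mean.
Qed.

Lemma immig_integral n (E : set Omega) : sigma_mark env n E ->
  (\int[P]_(w in E) ((eta n.+1 w)%:R)%:E = \int[P]_(w in E) nat_mean (env n w).2)%E.
Proof.
move=> hE; have EE : sigma_env env E by apply: sub_sigma_algebra; exists n.
rewrite integral_mkcond [RHS]integral_mkcond.
transitivity (\int[P]_w ((\1_E w)%:E * ((eta n.+1 w)%:R)%:E))%E.
  apply: eq_integral => w _; rewrite patchE indicE.
  by case: (_ \in _); rewrite ?mul1e ?mul0e.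
rewrite (@site_integral _ _ _ _ _ _ _ (offspring_immigration hB) (n, None)
  (fun c w => (\1_E w)%:E * (c%:R)%:E)%E).
- apply: eq_integral => w _; rewrite integral_natZ//.
  by rewrite patchE indicE; case: (_ \in _); rewrite ?mul1e ?mul0e.
- move=> c; apply: away_env; apply: emeasurable_funM; last exact: measurable_cst.
  by apply/measurable_EFinP; exact: (@measurable_indic _ (g_sigma_algebraType (\bigcup_n sigma_mark env n))).
- by move=> c w; rewrite mule_ge0// lee_fin.
Qed.

(** On the set E where the immigration mean exceeds b, it has the same integral as Y, at most b
    P(E). So its excess over b has integral 0 on E, and E is null. *)
Lemma immig_mean_le n (b : R) (Y : Omega -> \bar R) : 0 <= b ->
  is_cond_exp P (sigma_mark env n) (fun w => ((eta n.+1 w)%:R)%:E) Y ->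
  {ae P, forall w, (Y w <= b%:E)%E} -> {ae P, forall w, (nat_mean (env n w).2 <= b%:E)%E}.
Proof.
move=> b0 [mY HY] Yb.
pose m w : \bar R := nat_mean (env n w).2.
have mm : measurable_fun setT m.
  by apply: (measurableT_comp measurable_nat_mean2); exact: measurable_funPT.
pose E := [set w | (b%:E < m w)%E].
have SE : sigma_mark env n E.
  exists [set e | (b%:E < nat_mean e.2)%E]; last by rewrite setTI.
  rewrite (_ : mkset _ = (fun e : mark R => nat_mean e.2) @^-1` `]b%:E, +oo[%classic); last first.
    by apply/seteqP; split => e /=; rewrite in_itv /= andbT.
  by rewrite -[_ @^-1` _]setTI; apply: measurable_nat_mean2 => //; exact: emeasurable_itv.
have mE : measurable E by apply: (@genv_measurable _ _ _ P env); exists n.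
have mYT : measurable_fun setT Y.
  move=> _ B mB; rewrite setTI; apply: (@genv_measurable _ _ _ P env); exists n => //.
  exact: mY.
have PE : P E \is a fin_num by rewrite fin_num_measure.
have h1 : (\int[P]_(w in E) m w <= b%:E * P E)%E.
  (* [Y] is not known to be nonnegative, so it is replaced by its positive part, which is still at
     most b since b >= 0. *)
  rewrite -(immig_integral SE) -HY// integralE.
  apply: (@le_trans _ _ (\int[P]_(w in E) Y^\+ w)%E).
    by rewrite -[leRHS]sube0; apply: leeB => //; apply: integral_ge0 => w _; exact: funeneg_ge0.
  rewrite -(integral_cst P mE b%:E); apply: ae_ge0_le_integral => //.
  - by apply: measurable_funTS; exact: measurable_funepos.
  - apply: (@filterS _ (almost_everywhere P) (ae_filter_ringOfSetsType P) _ _ _ Yb) => w wb _.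
    by rewrite funepos.unlock ge_max wb lee_fin.
have mb0 w : E w -> (0 <= m w - b%:E)%E by move=> Ew; rewrite sube_ge0 ?ltW//.
have mmb : measurable_fun setT (fun w => m w - b%:E)%E by exact: emeasurable_funB.
have h2 : (\int[P]_(w in E) (m w - b%:E) = 0)%E.
  apply/eqP; rewrite eq_le integral_ge0 ?andbT//.
  have : (\int[P]_(w in E) (m w - b%:E) + b%:E * P E <= b%:E * P E)%E.
    rewrite -{1}(integral_cst P mE b%:E) -ge0_integralD//; last exact: measurable_funTS.
    by rewrite (eq_integral m)// => w _; exact: subeK.
  by rewrite -[leRHS]add0e leeD2rE// fin_numM.
have /ae_eq_integral_abs : (\int[P]_(w in E) `|m w - b%:E| = 0)%E.
  rewrite -[RHS]h2; apply: eq_integral => w; rewrite inE => Ew; rewrite gee0_abs//.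
  exact: mb0.
move=> H; have {}H := H mE (measurable_funTS mmb).
apply: (@filterS _ (almost_everywhere P) (ae_filter_ringOfSetsType P) _ _ _ H) => w /= Hw.
rewrite leNgt; apply/negP => Ew; have Hw0 : (m w - b%:E = 0)%E := Hw Ew.
have mb : m w = b%:E by rewrite -[LHS](@subeK _ (m w) b%:E)// Hw0 add0e.
by move: Ew; rewrite -/(m w) mb ltxx.
Qed.

Lemma good_mark_ae (b : R) : 0 <= b ->
  (forall n, {ae P, forall w, (nat_mean (env n w).2 <= b%:E)%E}) ->
  {ae env_law env, forall x, forall k, good_mark b (x k)}.
Proof.
move=> b0 Hb; apply: ae_foralln => n.
have : {ae P, forall w, good_mark b (env n w)}.
  apply: (@filterS2 _ (almost_everywhere P) (ae_filter_ringOfSetsType P) _ _ _ _ (Hb n) (repro_mean_pos_finite hB n)) => w h1 h2.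
  by split.
move=> [A [mA A0 HA]].
(* The null set given on [Omega] need not be a preimage under [env_path], so the bad set is shown
   measurable on sequences. *)
pose B := [set x : seqspace (T := mark R) | ~ good_mark b (x n)].
have mB : measurable B.
  rewrite (_ : B = ~` ((fun x : seqspace (T := mark R) => nat_mean (x n).1) @^-1` `]0%E, (+oo)%E[%classic `&`
     (fun x : seqspace (T := mark R) => nat_mean (x n).2) @^-1` `]-oo, b%:E]%classic)); last first.
    apply/seteqP; split => x /=; rewrite !in_itv /=; by apply: contra_not => -[h1 h2].
  apply: measurableC; apply: measurableI; rewrite -[_ @^-1` _]setTI.
    by apply: (measurableT_comp measurable_nat_mean1 (measurable_coord n)) => //; exact: emeasurable_itv.
  by apply: (measurableT_comp measurable_nat_mean2 (measurable_coord n)) => //; exact: emeasurable_itv.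
exists B; split => //; apply/eqP; rewrite eq_le measure_ge0 andbT -A0.
rewrite -[leLHS]/(P (env_path env @^-1` B)); apply: le_measure; rewrite ?inE//.
by rewrite -[_ @^-1` _]setTI; exact: measurable_env_path.
Qed.

End ReversedEnvironment.

(** * Conditional laws of the process *)

Local Open Scope ereal_scope.

Section ConditionedProcess.
Context {d : measure_display} {Omega : measurableType d} {R : realType}.
Variable P : probability Omega R.
Variable env : nat -> {RV P >-> mark R}.
Variable xi : nat -> nat -> {RV P >-> nat}.
Variable eta : nat -> {RV P >-> nat}.
Hypothesis hB : is_BPREI env xi eta.
Local Notation L := (@neg_log_mean R).
Hypothesis cL : centered (env_law env) L.

Local Notation p n := (survival (env_law env) L n 0).

Let iid : iid_law (env_law env).
Proof. by case: hB => h1 h2 _ _; exact: iid_env_law. Qed.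

Let p0 n : (0 < p n)%R := survival_gt0 iid n cL.

Lemma prob_min_at_end n : P (min_at_end env n) = (p n)%:E.
Proof. by rewrite -(pr_min_at_end hB) -prE//; exact: measurable_min_at_end. Qed.

Definition Zvar i n : {mfun Omega >-> nat} := mfun_Sub (mem_set (measurable_Zproc env xi eta i n)).

(** The last [P] is the default value of the normalisation for a null event; [prob_min_at_end] and
    [p0] rule this case out. *)
Definition cond_min_at_end n : probability Omega R :=
  mnormalize (mrestr P (@measurable_min_at_end _ _ _ P env n)) P.

Definition cond_prob_Z i n : probability nat R := distribution (cond_min_at_end n) (Zvar i n).

Lemma nu_minusE i n A : nu_minus_n env xi eta i n A = cond_prob_Z i n A.
Proof.
rewrite /nu_minus_n /cond_law /cond_prob_Z /distribution /pushforward /=.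
rewrite /cond_min_at_end /mnormalize /= /mrestr setTI prob_min_at_end eqe gt_eqF//=.
by rewrite inver gt_eqF.
Qed.

Lemma cond_prob_ZE i n A : pr (cond_prob_Z i n) A = annealed_pr (env_law env) n n A i.
Proof.
rewrite /pr -nu_minusE /nu_minus_n /cond_law prob_min_at_end inver gt_eqF//.
have mZ : measurable (Zproc xi eta i n @^-1` A).
  by rewrite -[_ @^-1` _]setTI; exact: measurable_Zproc.
rewrite /annealed_pr -(annealedE hB); last exact: ind_ge0.
rewrite -[X in _ = (fine X / _)%R]/(\int[P]_(w in min_at_end env n) (\1_(Zproc xi eta i n @^-1` A) w)%:E).
rewrite integral_indic//; last exact: measurable_min_at_end.
rewrite fineM//.
by rewrite fin_num_measure//; apply: measurableI => //; exact: measurable_min_at_end.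
Qed.

Lemma cond_meanE i n : cond_mean P (Zproc xi eta i n) (min_at_end env n) =
  annealed (env_law env) n n (fun k => k%:R%:E) i * ((p n)^-1)%:E.
Proof.
by rewrite /cond_mean prob_min_at_end inver gt_eqF// (@annealedE _ _ _ _ _ _ _ hB n (fun k => k%:R%:E)).
Qed.

(** For n >= 1 the immigrants of generation n alone make Z_n positive almost surely. *)
Lemma nu_minus0 i n : (forall n : nat, (1 <= n)%N -> {ae P, forall w, (1 <= eta n w)%N}) ->
  (0 < n)%N -> pr (cond_prob_Z i n) [set 0%N] = 0%R.
Proof.
move=> H n0; rewrite /pr -nu_minusE /nu_minus_n /cond_law.
rewrite (_ : P _ = 0) ?mul0e//.
have [N [mN N0 HN]] := H n n0.
apply/eqP; rewrite eq_le measure_ge0 andbT -N0; apply: le_measure; rewrite ?inE//.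
  apply: measurableI; last exact: measurable_min_at_end.
  by rewrite -[_ @^-1` _]setTI; exact: measurable_Zproc.
move=> w [/= Z0 _]; apply: HN => /=; move: Z0; case: n n0 {H mN N0} => // n _ /=.
by move/eqP; rewrite addn_eq0 => /andP[_ /eqP ->].
Qed.

End ConditionedProcess.

Theorem propositionA6 (R : realType) (d : measure_display)
    (Omega : measurableType d) (P : probability Omega R)
    (env : nat -> {RV P >-> mark R})
    (xi : nat -> nat -> {RV P >-> nat}) (eta : nat -> {RV P >-> nat})
    (etabar : R)
    (hBPREI : is_BPREI env xi eta)
    (hE : 'E_P[log_mean env 0] = 0)
    (hV : 0 < 'V_P[log_mean env 0] < +oo)
    (heta_ge1 : forall n : nat, (1 <= n)%N ->
       {ae P, forall w, (1 <= eta n w)%N})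
    (heta_mean : forall n : nat, exists2 Y : Omega -> \bar R,
       is_cond_exp P (sigma_mark env n) (fun w => ((eta n.+1 w)%:R)%:E) Y &
       {ae P, forall w, Y w <= etabar%:E}) :
  (exists nu : probability nat R,
     nu [set 0%N] = 0 /\
     forall i : nat,
       tv_dist (nu_minus_n env xi eta i n) nu @[n --> \oo] --> (0 : \bar R)) /\
  (forall i : nat,
     ereal_sup [set cond_mean P (Zproc xi eta i n) (min_at_end env n)
               | n in [set n : nat | (1 <= n)%N]] < +oo).
Proof.
have cL := centered_env_law hE hV.
have iid : iid_law (env_law env) by case: (hBPREI) => h1 h2 _ _; exact: iid_env_law.
(* [etabar] carries no sign assumption, while the estimates use a nonnegative bound. *)
pose b := Num.max etabar 0%R.
have b0 : (0 <= b)%R by rewrite le_max lexx orbT.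
have gd : {ae env_law env, forall x, forall k, good_mark b (x k)}.
  apply: (good_mark_ae hBPREI b0) => n; have [Y hY Yb] := heta_mean n.
  apply: (immig_mean_le hBPREI b0 hY).
  apply: (@filterS _ (almost_everywhere P) (ae_filter_ringOfSetsType P) _ _ _ Yb) => w /le_trans; apply.
  by rewrite lee_fin le_max lexx.
(* Two initial states at once, so that the limit built from one of them serves for all. *)
have cauchy i i' e : (0 < e)%R -> exists N, forall n n' A, (N <= n)%N -> (N <= n')%N ->
    (`|pr (cond_prob_Z env xi eta i n) A - pr (cond_prob_Z env xi eta i' n') A| <= e)%R.
  move=> e0; have [N HN] := annealed_pr_cauchy iid cL b0 gd i i' e0.
  by exists N => n n' A Nn Nn'; rewrite !(cond_prob_ZE hBPREI cL); exact: HN.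
split; last first.
  move=> i; have [C HC] := annealed_mean iid cL b0 gd.
  apply: (@le_lt_trans _ _ ((b + i%:R) * C)%R%:E); last exact: ltry.
  apply: ge_ereal_sup => _ [n _ <-]; rewrite (cond_meanE hBPREI cL).
  have p0 := survival_gt0 iid n cL.
  by rewrite lee_pdivrMr// -EFinM; exact: HC.
(* State 0 is an arbitrary reference. *)
pose nu := limit_law (cauchy 0%N 0%N).
have unif i e : (0 < e)%R -> exists N, forall n A, (N <= n)%N ->
    (`|pr (cond_prob_Z env xi eta i n) A - pr nu A| <= e)%R.
  move=> e0; have e20 : (0 < e / 2)%R by lra.
  have [N HN] := limit_law_unif (cauchy 0%N 0%N) e20.
  have [M HM] := cauchy i 0%N _ e20.
  exists (maxn N M) => n A; rewrite geq_max => /andP[Nn Mn].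
  have := HN n A Nn; have := HM n n A Mn Mn; rewrite -/nu !ler_norml; lra.
exists nu; split.
  rewrite prE//; congr EFin; apply/eqP; rewrite -normr_le0; apply/ler_addgt0Pr => e e0.
  (* Time [N.+1] rather than [N], since [nu_minus0] needs a positive time. *)
  have [N HN] := unif 0%N e e0; have := HN N.+1 [set 0%N] (leqnSn N).
  by rewrite (nu_minus0 hBPREI cL)// sub0r normrN add0r.
move=> i.
have tv0 n : 0 <= tv_dist (nu_minus_n env xi eta i n) nu.
  apply: (@le_trans _ _ `|nu_minus_n env xi eta i n set0 - nu set0|) => //.
  by apply: ereal_sup_ubound; exists set0.
have tvle e : (0 < e)%R -> exists N, forall n, (N <= n)%N -> tv_dist (nu_minus_n env xi eta i n) nu <= e%:E.
  move=> e0; have [N HN] := unif i e e0; exists N => n Nn.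
  apply: ge_ereal_sup => _ [A _ <-]; rewrite (nu_minusE hBPREI cL) !prE// -EFinB abse_EFin lee_fin.
  exact: HN.
apply/fine_cvgP; split.
  have [N HN] := tvle 1%R ltr01; exists N => // n /= Nn.
  by rewrite ge0_fin_numE// (le_lt_trans (HN n Nn))// ltry.
apply/cvgrPdist_le => e e0; have [N HN] := tvle e e0; exists N => // n /= Nn.
have fin : tv_dist (nu_minus_n env xi eta i n) nu \is a fin_num.
  by rewrite ge0_fin_numE// (le_lt_trans (HN n Nn))// ltry.
by rewrite sub0r normrN ger0_norm ?fine_ge0// -lee_fin fineK// HN.
Qed.
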